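(* For each $n$, let $G=G_{n,p}$ and let $Q$ be the event that every edge of $G$ lies in a triangle of $G$. Then $$\max_{p\in[0,1]}\Pr\big(G \text{ satisfies } Q \text{ and } \mathcal{T}(G)\neq \mathcal{C}(G)\big)\to 0 \quad (n\to\infty).$$
   Context: $G_{n,p}$ is the binomial random graph on vertex set $[n]$ in which each of the $\binom n2$ possible edges is present independently with probability $p$. For a graph $G$, the edge space $\mathcal{E}(G)=(\mathbb{Z}/2)^{E(G)}$ is identified with the set of edge subsets of $G$, with addition being symmetric difference. The cycle space $\mathcal{C}(G)$ is the subspace of $\mathcal{E}(G)$ spanned by the cycles of $G$, and the triangle space $\mathcal{T}(G)$ is the subspace spanned by the triangles of $G$. *)

(* Defs.v *)
From HB Require Import structures.
From mathcomp Require Import all_boot all_order all_algebra.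
From mathcomp Require Import boolp reals.
Set Implicit Arguments. Unset Strict Implicit. Unset Printing Implicit Defensive.
Import Order.TTheory GRing.Theory Num.Theory.

(* Vertices: 'I_n.  An edge is a 2-element subset of 'I_n; a graph on [n]
   is a set of edges, i.e. G : {set {set 'I_n}} with G \subset Kn n. *)
Definition Kn (n : nat) : {set {set 'I_n}} := [set e : {set 'I_n} | #|e| == 2].

(* Edge space (Z/2)^{E}: edge subsets with addition = symmetric difference. *)
Definition symd (T : finType) (A B : {set T}) : {set T} := (A :\: B) :|: (B :\: A).

Definition span2 (T : finType) (F : {set T} -> Prop) (X : {set T}) : Prop :=
  exists K : {set {set T}}, (forall C, C \in K -> F C) /\
                            X = \big[@symd T/set0]_(C in K) C.

Definition triangle_of (n : nat) (G : {set {set 'I_n}}) (t : {set {set 'I_n}}) : Prop :=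
  exists a b c : 'I_n, [/\ a != b, b != c, a != c,
    t = [set [set a; b]; [set b; c]; [set a; c]] & t \subset G].

Definition cycle_edges (n : nat) (s : seq 'I_n) : {set {set 'I_n}} :=
  [set [set x.1; x.2] | x in zip s (rot 1 s)].

Definition cycle_of (n : nat) (G : {set {set 'I_n}}) (C : {set {set 'I_n}}) : Prop :=
  exists s : seq 'I_n, [/\ uniq s, 3 <= size s, C = cycle_edges s & C \subset G].

Definition triangle_space (n : nat) (G : {set {set 'I_n}}) := span2 (triangle_of G).
Definition cycle_space (n : nat) (G : {set {set 'I_n}}) := span2 (cycle_of G).

Definition Q (n : nat) (G : {set {set 'I_n}}) : Prop :=
  forall e, e \in G -> exists t, triangle_of G t /\ e \in t.

Definition Pr_Gnp (R : realType) (n : nat) (p : R) (E : {set {set 'I_n}} -> Prop) : R :=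
  (\sum_(G in powerset (Kn n) | `[< E G >])
     p ^+ #|G| * (1 - p) ^+ (#|Kn n| - #|G|))%R.

(* Main.v *)
Require Import Defs.
From HB Require Import structures.
From mathcomp Require Import all_boot all_order all_algebra.
From mathcomp Require Import boolp reals sequences exp.
From mathcomp Require Import ring lra zify.
Set Implicit Arguments. Unset Strict Implicit. Unset Printing Implicit Defensive.
Import Order.TTheory GRing.Theory Num.Theory.

(** By duality over Z/2, the triangles fail to span the cycle space exactly when some edge set [F]
    that meets every triangle evenly (a cocycle) is not a cut.  Take such an [F] smallest modulo
    cuts, so that it uses at most half of the edges at each vertex.

    Sparse case [n p^2 <= (7/5) ln n]: either there is no triangle at all, or by the second moment
    method some edge lies in no triangle, contradicting [Q].

    Dense case, global step: [F] is close to a cut.  Expose the edges touching a set [S] of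
    [delta n] vertices together with the values of [F] on them (a union bound over only
    [2^(delta n^2 p)] choices).  This predicts [F] on nearly every pair of vertices outside [S].  If
    the prediction is odd on a positive fraction of the triangles, Janson's inequality makes it
    exponentially unlikely (in [n^2 p]) that the rest of the graph contains none of them; otherwise
    some vertex [u] sees few odd triangles and the prediction is close to the cut
    [{x | F predicted on ux}].  Hence the minimal [F] has at most [eps n^2 p] edges.

    Dense case, local step: each triangle through an edge of [F] contains exactly two edges of [F].
    Let [W] be the set of vertices of [F]-degree more than [gam n p].  As [F] is small, so is [W], and
    few edges of [F] lie inside [W]; neighbourhoods of vertices outside [W] span few edges, while
    links expand, so few edges of [F] leave [W] or avoid it, except for edges in fewer than
    [n p^2 / 100] triangles.  Such edges form a matching, and by [Q] each of those in [F] is adjacent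
    to another edge of [F] that is not of this kind, so [F] is empty. *)

(** * Cocycles and cuts *)

(** The obstacle to a direct union bound is its size: the expected number of candidate edge sets is
    [(1 + p)] to the power n(n-1)/2, while Janson's inequality gains only exp(-c n^2 p) with a small
    c. Exposing few vertices shrinks the number of guesses to [(1 + p) ^+ #|touching S|] on average,
    which is below the gain once |S| is a small multiple of n, and the cocycle condition recovers
    [F] on every pair with a common neighbour in [S]. What is lost is an error of eps n^2 p edges,
    so a deterministic step has to finish. To keep the gain of order n^2 p for every p of the dense
    regime, the family of odd triangles is thinned until each edge lies in about 1 / p^2 of them;
    otherwise the correlation term of Janson's inequality could exceed the main term.

    The constants are fixed backwards from the local step: a numerical [kap] determines [gam], then
    [kap'], then [rho], and [eps = rho * gam / 2] is the closeness that the global step must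
    deliver. In the local step [Q] serves only the edges in few triangles, about which triangle
    counting says nothing. *)

Section SymmetricDifference.
Variable T : finType.
Implicit Types A B C F X : {set T}.

Lemma in_symd A B x : (x \in symd A B) = (x \in A) (+) (x \in B).
Proof. by rewrite !inE; case: (x \in A); case: (x \in B). Qed.

Lemma symdA : associative (@symd T).
Proof. by move=> A B C; apply/setP => x; rewrite !in_symd addbA. Qed.

Lemma symdC : commutative (@symd T).
Proof. by move=> A B; apply/setP => x; rewrite !in_symd addbC. Qed.

Lemma symd0 : left_id set0 (@symd T).
Proof. by move=> A; apply/setP => x; rewrite in_symd inE. Qed.

HB.instance Definition _ := Monoid.isComLaw.Build {set T} set0 (@symd T) symdA symdC symd0.

Lemma symdK A B : symd A (symd A B) = B.
Proof. by apply/setP => x; rewrite !in_symd addKb. Qed.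

Lemma setI_symd F A B : F :&: symd A B = symd (F :&: A) (F :&: B).
Proof. by apply/setP => x; rewrite !(in_symd, inE); case: (x \in F). Qed.

Lemma card_symd A B : (#|symd A B| + #|A :&: B|.*2 = #|A| + #|B|)%N.
Proof.
rewrite -(cardsID B A) -(cardsID A B) [B :&: A]setIC /symd cardsU.
have -> : (A :\: B) :&: (B :\: A) = set0.
  by apply/setP => x; rewrite !inE; case: (x \in A); rewrite ?andbF.
rewrite cards0; lia.
Qed.

Lemma odd_symd A B : odd #|symd A B| = odd #|A| (+) odd #|B|.
Proof. by rewrite -oddD -card_symd oddD odd_double addbF. Qed.

Lemma odd_setI_symd F A B : odd #|F :&: symd A B| = odd #|F :&: A| (+) odd #|F :&: B|.
Proof. by rewrite setI_symd odd_symd. Qed.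

Lemma odd_symd_setI F F' A : odd #|symd F F' :&: A| = odd #|F :&: A| (+) odd #|F' :&: A|.
Proof. by rewrite setIC odd_setI_symd ![A :&: _]setIC. Qed.

(* The maps [X |-> odd #|F :&: X|] are the linear functionals over Z/2. *)
Lemma separation (L : {set {set T}}) X :
  (exists K : {set {set T}}, K \subset L /\ X = \big[@symd T/set0]_(C in K) C) \/
  (exists F, (forall C, C \in L -> ~~ odd #|F :&: C|) /\ odd #|F :&: X|).
Proof.
have [k] := ubnP #|L|; elim: k L X => // k IH L X.
have [->|/set0Pn[D DL]] := eqVneq L set0.
  move=> _; have [->|/set0Pn[x xX]] := eqVneq X set0.
    by left; exists set0; rewrite sub0set big_set0.
  right; exists [set x]; split=> [C|]; first by rewrite inE.
  by rewrite (setIidPl _) ?sub1set // cards1.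
rewrite (cardsD1 D L) DL add1n ltnS => cL.
have LD C : C \in L -> C = D \/ C \in L :\ D.
  by move=> CL; rewrite !inE CL andbT; case: eqVneq; [left|right].
have [[K [KL XK]]|[F [FL FX]]] := IH _ X cL.
  by left; exists K; split=> //; apply: subset_trans KL (subD1set _ _).
have [FD|FD] := boolP (odd #|F :&: D|); last first.
  by right; exists F; split=> // C /LD[->//|]; apply: FL.
have [[K [KL XK]]|[F' [FL' FX']]] := IH _ (symd D X) cL.
  left; exists (D |: K); split.
    by rewrite subUset sub1set DL; apply: subset_trans KL (subD1set _ _).
  rewrite big_setU1 /=; first by rewrite -XK symdK.
  by apply/negP => /(subsetP KL); rewrite !inE eqxx.
(* Here [F] is odd on both [D] and [X]. If [F'] is odd on [D], it is even on [X], and the sum of [F]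
   and [F'] is even on [D] and odd on [X]; otherwise [F'] itself separates. *)
move: FX'; rewrite odd_setI_symd; have [FD'|FD'] := boolP (odd #|F' :&: D|) => /=.
  move=> FX'; right; exists (symd F F'); split; last first.
    by rewrite odd_symd_setI FX (negPf FX').
  move=> C /LD[->|CL]; first by rewrite odd_symd_setI FD FD'.
  by rewrite odd_symd_setI (negPf (FL _ CL)) (negPf (FL' _ CL)).
move=> FX'; right; exists F'; split=> // C /LD[->//|]; exact: FL'.
Qed.

Lemma span2_separation (P : {set T} -> Prop) X : ~ span2 P X ->
  exists F, (forall C, P C -> ~~ odd #|F :&: C|) /\ odd #|F :&: X|.
Proof.
move=> nX; have [[K [KP XK]]|[F [FP FX]]] := separation [set C | `[< P C >]] X.
  by case: nX; exists K; split=> // C /(subsetP KP); rewrite inE => /asboolP.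
by exists F; split=> // C PC; apply: FP; rewrite inE; apply/asboolP.
Qed.

Lemma odd_setI_big_symd F (K : {set {set T}}) :
  odd #|F :&: \big[@symd T/set0]_(C in K) C| -> exists2 C, C \in K & odd #|F :&: C|.
Proof.
move=> oF; have [/exists_inP//|/exists_inPn h] := boolP [exists C in K, odd #|F :&: C|].
suff : ~~ odd #|F :&: \big[@symd T/set0]_(C in K) C| by rewrite oF.
apply: (big_ind (fun X => ~~ odd #|F :&: X|)) => [|A B /negPf hA /negPf hB|C /h//].
  by rewrite setI0 cards0.
by rewrite odd_setI_symd hA hB.
Qed.

End SymmetricDifference.

(** * Cycles, cuts, and a cocycle that is not a cut *)

Section Cocycles.
Variable n : nat.
Implicit Types (G F C : {set {set 'I_n}}) (A : {set 'I_n}).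

Definition cocycle G F := F \subset G /\ forall t, triangle_of G t -> ~~ odd #|F :&: t|.
Definition cut_edges G A := [set e in G | #|e :&: A| == 1%N].

Lemma set2_eq (a b c d : 'I_n) : [set a; b] = [set c; d] ->
  (a = c /\ b = d) \/ (a = d /\ b = c).
Proof.
move=> E; have := set21 a b; have := set22 a b; rewrite E !inE.
have := set21 c d; have := set22 c d; rewrite -E !inE.
by move=> /orP[]/eqP ? /orP[]/eqP ? /orP[]/eqP ? /orP[]/eqP ?; subst; auto.
Qed.

Lemma card_set2I (a b : 'I_n) A : a != b -> (#|[set a; b] :&: A| == 1%N) = (a \in A) (+) (b \in A).
Proof.
move=> ab; have -> : [set a; b] :&: A = (if a \in A then [set a] else set0) :|: (if b \in A then [set b] else set0).
  apply/setP => x; rewrite !inE; case: (boolP (a \in A)) => aA; case: (boolP (b \in A)) => bA; rewrite ?inE.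
  - by apply/andP/idP => [[]//|/orP[]/eqP->]; rewrite ?eqxx ?orbT.
  - rewrite orbF; apply/andP/idP => [[/orP[//|/eqP->]]|/eqP->]; first by rewrite (negPf bA).
    by rewrite eqxx.
  - apply/andP/idP => [[/orP[/eqP->|//]]|/eqP->]; first by rewrite (negPf aA).
    by rewrite eqxx orbT.
  - by apply/negP => /andP[/orP[]/eqP->]; rewrite ?(negPf aA) ?(negPf bA).
case: (a \in A); case: (b \in A); rewrite ?setU0 ?set0U ?cards1 ?cards0 //.
by rewrite cards2 ab.
Qed.

Lemma nth_rot1 (s : seq 'I_n) x0 i : (i < size s)%N ->
  nth x0 (rot 1 s) i = nth x0 s (if (i.+1 < size s)%N then i.+1 else 0%N).
Proof.
case: s => // a s; rewrite /= rot1_cons nth_rcons ltnS => le_is; rewrite ltnS.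
by case: ltngtP le_is => // ->.
Qed.

(** Over Z/2, an edge is cut exactly when the indicators of [A] at its two ends sum to 1. Around the
    cycle the first ends run through [s] and the second ends through [rot 1 s], so the two sums
    cancel. *)
Lemma cycle_cut_even (s : seq 'I_n) A : uniq s -> (3 <= size s)%N ->
  ~~ odd #|[set e in cycle_edges s | #|e :&: A| == 1%N]|.
Proof.
move=> us s3; set Z := zip s (rot 1 s).
have x0 : 'I_n by case: s s3 {us Z}.
have sZ : size Z = size s by rewrite size_zip size_rot minnn.
have nZ i : (i < size s)%N -> nth (x0, x0) Z i =
    (nth x0 s i, nth x0 s (if (i.+1 < size s)%N then i.+1 else 0%N)).
  by move=> lis; rewrite nth_zip ?size_rot // nth_rot1.
have ne0 k : ((if (k.+1 < size s)%N then k.+1 else 0) < size s)%N by case: ifP => ?; lia.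
(* This is where [3 <= size s] enters: with two vertices, both consecutive pairs would give the same
   edge. *)
have inj : {in Z &, injective (fun x : 'I_n * 'I_n => [set x.1; x.2])}.
  move=> x y /(nthP (x0, x0))[i]; rewrite sZ => li <- /(nthP (x0, x0))[j]; rewrite sZ => lj <-.
  rewrite !nZ //= => /set2_eq [] [/eqP e1 /eqP e2].
    by move: e1; rewrite nth_uniq // => /eqP ->.
  move: e1 e2; rewrite !nth_uniq // => /eqP ij /eqP.
  by move: ij; case: ifP; case: ifP => ? ? ? ?; lia.
have dist x : x \in Z -> x.1 != x.2.
  move=> /(nthP (x0, x0))[i]; rewrite sZ => li <-; rewrite nZ //= nth_uniq //.
  by case: ifP => ?; apply/eqP; lia.
have uZ : uniq Z by apply: zip_uniql.
have odd_sum (I : finType) (P Q : pred I) : odd #|[set x in P | Q x]| = \big[addb/false]_(x in P) Q x.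
  rewrite -sum1_card big_mkcond /= (big_morph odd oddD (erefl (odd 0))).
  rewrite [RHS]big_mkcond; apply: eq_bigr => x _.
  by rewrite inE; case: (x \in P) => //=; case: (Q x).
rewrite odd_sum big_imset //=.
rewrite (eq_bigr (fun x => (x.1 \in A) (+) (x.2 \in A))); last first.
  by move=> x xZ; rewrite card_set2I // dist.
rewrite -big_uniq //= big_split /=.
rewrite -(big_map fst predT (fun a => a \in A)) -(big_map snd predT (fun a => a \in A)) /=.
rewrite -/(unzip1 _) -/(unzip2 _) unzip1_zip ?size_rot // unzip2_zip ?size_rot //.
have -> : \big[addb/false]_(i <- rot 1 s) (i \in A) = \big[addb/false]_(i <- s) (i \in A).
  by apply: perm_big; rewrite perm_rot.
by rewrite addbb.
Qed.

Lemma span2_mono (P P' : {set {set 'I_n}} -> Prop) X :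
  (forall C, P C -> P' C) -> span2 P X -> span2 P' X.
Proof. by move=> PP' [K [KP ->]]; exists K; split=> // C /KP/PP'. Qed.

Lemma triangle_cycle G t : triangle_of G t -> cycle_of G t.
Proof.
move=> [a [b [c [ab bc ac -> tG]]]]; exists [:: a; b; c]; split=> //.
  by rewrite /= !inE negb_or ab ac bc.
apply/setP => e; rewrite !inE; apply/idP/imsetP.
  case/orP => [/orP[]|] /eqP ->.
  - by exists (a, b); rewrite ?inE ?eqxx.
  - by exists (b, c); rewrite ?inE ?eqxx ?orbT.
  - by exists (c, a); rewrite ?inE ?eqxx ?orbT //= setUC.
case=> [[x y]]; rewrite !inE /= => /or3P[] /eqP[-> ->] ->; rewrite ?eqxx ?orbT //.
by rewrite [[set c; a]]setUC eqxx orbT.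
Qed.

(** A functional that vanishes on triangles but not on some element of the cycle space is odd on
    some cycle. Restricting it to [G] keeps its values on subgraphs of [G], and no cut is odd on a
    cycle. *)
Lemma exists_noncut_cocycle G : ~ (forall X, triangle_space G X <-> cycle_space G X) ->
  exists F, cocycle G F /\ forall A, F <> cut_edges G A.
Proof.
move=> nTC; have [X [CX nTX]] : exists X, cycle_space G X /\ ~ triangle_space G X.
  apply: contrapT => h; apply: nTC => X; split.
    apply: span2_mono; exact: triangle_cycle.
  by move=> CX; apply: contrapT => nTX; apply: h; exists X.
have [F [FT FX]] := span2_separation nTX.
case: CX => K [KC XK]; move: FX; rewrite XK => /odd_setI_big_symd [C CK FC].
have [s [us s3 Cs CG]] := KC _ CK.
exists (F :&: G); split.
  split=> [|t tG]; first exact: subsetIr.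
  have sG : t \subset G by case: tG => a [b [c []]].
  by rewrite -setIA (setIidPr sG) FT.
move=> A FA; have := cycle_cut_even A us s3; rewrite -Cs.
rewrite (_ : [set e in C | _] = F :&: C) ?FC //.
rewrite -[in RHS](setIidPr CG) setIA FA; apply/setP => e; rewrite !inE.
by case eC: (e \in C); rewrite ?andbF // (subsetP CG _ eC) /= andbT.
Qed.

End Cocycles.

(** * The binomial random subset *)

Local Open Scope ring_scope.

Section RandomSubset.
Variables (R : realType) (T : finType) (p : R).
Implicit Types (E G D Z A B : {set T}) (f g : {set T} -> R).

(** The ground set [E] is a parameter, so that exposing the random graph in stages amounts to
    splitting [E] ([Ex_setU1], [Ex_setU]). *)
Definition wt E G : R := p ^+ #|G| * (1 - p) ^+ (#|E| - #|G|).
Definition Ex E f : R := \sum_(G in powerset E) wt E G * f G.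
(** Measurability with respect to the coordinates in [D]; disjoint supports give independence in
    [Ex_indep] and [Ex_prod]. *)
Definition depends_on D f := forall G, f G = f (G :&: D).

Lemma Ex_set0 f : Ex set0 f = f set0.
Proof. by rewrite /Ex powerset0 big_set1 /wt cards0 !expr0 !mul1r. Qed.

Lemma eq_Ex E f g : (forall G, G \subset E -> f G = g G) -> Ex E f = Ex E g.
Proof. by move=> fg; apply: eq_bigr => G; rewrite inE => /fg ->. Qed.

Lemma ExD E f g : Ex E (fun G => f G + g G) = Ex E f + Ex E g.
Proof. by rewrite -big_split /=; apply: eq_bigr => G _; rewrite mulrDr. Qed.

Lemma ExZ E c f : Ex E (fun G => c * f G) = c * Ex E f.
Proof. by rewrite /Ex big_distrr /=; apply: eq_bigr => G _; rewrite mulrCA. Qed.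

Lemma ExZr E c f : Ex E (fun G => f G * c) = Ex E f * c.
Proof. by rewrite mulrC -ExZ; apply: eq_Ex => G _; rewrite mulrC. Qed.

Lemma ExB E f g : Ex E (fun G => f G - g G) = Ex E f - Ex E g.
Proof.
rewrite -[- Ex E g]mulN1r -ExZ -ExD; apply: eq_Ex => G _.
by rewrite mulN1r.
Qed.

Lemma Ex_sum E (I : Type) (r : seq I) (P : pred I) (F : I -> {set T} -> R) :
  Ex E (fun G => \sum_(i <- r | P i) F i G) = \sum_(i <- r | P i) Ex E (F i).
Proof.
rewrite /Ex exchange_big /=; apply: eq_bigr => G _.
by rewrite big_distrr.
Qed.

Lemma Ex_setU1 e E f : e \notin E ->
  Ex (e |: E) f = (1 - p) * Ex E f + p * Ex E (fun G => f (e |: G)).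
Proof.
move=> eE; rewrite /Ex (bigID (fun G : {set T} => e \in G)) /= addrC.
congr (_ + _).
  rewrite big_distrr /=; apply: eq_big => G.
    rewrite !inE; apply/andP/idP => [[GE eG] | GE].
      apply/subsetP => x xG; have := subsetP GE x xG.
      by rewrite in_setU1 => /orP[/eqP xe|//]; rewrite -xe xG in eG.
    by rewrite (subset_trans GE (subsetUr _ _)); split=> //; apply: contra eE; apply/subsetP.
  case/andP; rewrite inE => GE eG; rewrite mulrA; congr (_ * _).
  have {}GE : G \subset E.
    apply/subsetP => x xG; have := subsetP GE x xG.
    by rewrite in_setU1 => /orP[/eqP xe|//]; rewrite -xe xG in eG.
  rewrite /wt cardsU1 eE add1n mulrCA -exprS subSn //.
  by apply: subset_leq_card.
rewrite big_distrr /=.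
rewrite (reindex_onto (fun G => e |: G) (fun G => G :\ e)) /=; last first.
  by move=> G /andP[_ eG]; rewrite setD1K.
apply: eq_big => G.
  rewrite !inE eqxx /= andbT; apply/andP/idP => [[GE /eqP GG]|GE].
    rewrite -GG; apply/subsetP => x; rewrite !inE => /andP[xe xG].
    have := subsetP GE x; rewrite !inE xG => /(_ isT).
    by rewrite (negPf xe).
  split; first by rewrite setUS.
  apply/eqP/setU1K; apply: contra eE; exact/subsetP.
case/andP => /andP[]; rewrite inE => GE _ /eqP GG.
have eG : e \notin G by rewrite -GG !inE eqxx.
have GE' : G \subset E.
  rewrite -GG; apply/subsetP => x; rewrite !inE => /andP[xe xG].
  have := subsetP GE x; rewrite !inE xG => /(_ isT).
  by rewrite (negPf xe).
rewrite mulrA; congr (_ * _).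
by rewrite /wt !cardsU1 eE eG !add1n subSS exprS mulrA.
Qed.

Lemma set_ind (P : {set T} -> Prop) : P set0 ->
  (forall e E, e \notin E -> P E -> P (e |: E)) -> forall E, P E.
Proof.
move=> P0 PS E; have [k] := ubnP #|E|; elim: k E => // k IH E.
have [->//|/set0Pn[e eE]] := eqVneq E set0.
rewrite -(setD1K eE) cardsU1 !inE eqxx add1n ltnS => leEk.
by apply: PS; [rewrite !inE eqxx | apply: IH].
Qed.

Lemma Ex_const E c : Ex E (fun=> c) = c.
Proof.
elim/set_ind: E => [|e E eE IH]; first by rewrite Ex_set0.
by rewrite Ex_setU1 // IH -mulrDl subrK mul1r.
Qed.

Lemma Ex_setU E1 E2 f : [disjoint E1 & E2] ->
  Ex (E1 :|: E2) f = Ex E1 (fun G1 => Ex E2 (fun G2 => f (G1 :|: G2))).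
Proof.
elim/set_ind: E1 f => [|e E1 eE IH] f dE.
  by rewrite set0U Ex_set0; apply: eq_Ex => G _; rewrite set0U.
have eE2 : e \notin E2 by rewrite (disjointFr dE) ?setU11.
have {}dE : [disjoint E1 & E2] := disjointWl (subsetUr _ _) dE.
rewrite -setUA Ex_setU1 ?inE ?negb_or ?eE // Ex_setU1 // !IH //.
congr (_ + p * _); apply: eq_Ex => G1 _; apply: eq_Ex => G2 _.
by rewrite setUA.
Qed.

Lemma disjoint_setDr A B : [disjoint A & B :\: A].
Proof. by rewrite -setI_eq0; apply/eqP/setP => x; rewrite !inE; case: (x \in A). Qed.

Lemma Ex_dep E D f : D \subset E -> depends_on D f -> Ex E f = Ex D f.
Proof.
move=> DE fD; rewrite -(setID E D) (setIidPr DE) Ex_setU ?disjoint_setDr //.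
apply: eq_Ex => G1 G1D; rewrite -[RHS](Ex_const (E :\: D)); apply: eq_Ex => G2 G2D.
rewrite fD setIUl (setIidPl G1D).
suff -> : G2 :&: D = set0 by rewrite setU0.
apply/eqP; rewrite setI_eq0; apply: disjointWl G2D _.
by rewrite disjoint_sym disjoint_setDr.
Qed.

Lemma Ex_indep E D1 D2 f g : [disjoint D1 & D2] -> depends_on D1 f -> depends_on D2 g ->
  Ex E (fun G => f G * g G) = Ex E f * Ex E g.
Proof.
move=> dD fD gD.
have disjI A B C : [disjoint A & B] -> B :&: (A :&: C) = set0.
  by rewrite -setI_eq0 setIA [B :&: A]setIC => /eqP ->; rewrite set0I.
have -> : E = (E :&: D1) :|: (E :\: D1) by rewrite setID.
have dE : [disjoint E :&: D1 & E :\: D1].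
  by rewrite -setI_eq0; apply/eqP/setP => x; rewrite !inE; case: (x \in D1); rewrite ?andbF.
rewrite !Ex_setU //.
have f1 G1 G2 : G1 \subset E :&: D1 -> G2 \subset E :\: D1 -> f (G1 :|: G2) = f G1.
  rewrite subsetI => /andP[_ G1D]; rewrite subsetD => /andP[_ G2D].
  rewrite fD setIUl (setIidPl G1D).
  by move: G2D; rewrite -setI_eq0 => /eqP->; rewrite setU0.
have g2 G1 G2 : G1 \subset E :&: D1 -> g (G1 :|: G2) = g G2.
  rewrite subsetI => /andP[_ G1D].
  rewrite gD setIUl; suff -> : G1 :&: D2 = set0 by rewrite set0U -gD.
  by apply/eqP; rewrite setI_eq0 (disjointWl G1D).
rewrite (_ : Ex _ (fun G1 => Ex _ (fun G2 => g _)) = Ex (E :\: D1) g); last first.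
  rewrite -[RHS](Ex_const (E :&: D1)); apply: eq_Ex => G1 s1.
  by apply: eq_Ex => G2 _; apply: g2.
rewrite -ExZr; apply: eq_Ex => G1 s1.
transitivity (f G1 * Ex (E :\: D1) g).
  by rewrite -ExZ; apply: eq_Ex => G2 s2; rewrite f1 ?g2.
congr (_ * _); rewrite -[LHS](Ex_const (E :\: D1)).
by apply: eq_Ex => G2 s2; rewrite f1.
Qed.

Lemma depends_onS D D' f : D \subset D' -> depends_on D f -> depends_on D' f.
Proof. by move=> DD fD G; rewrite fD [RHS]fD -setIA (setIidPr DD). Qed.

Lemma depends_onM D f g : depends_on D f -> depends_on D g ->
  depends_on D (fun G => f G * g G).
Proof. by move=> fD gD G; rewrite /= fD gD. Qed.

Lemma Ex_prod E (I : finType) (J : {set I}) (D : I -> {set T}) (F : I -> {set T} -> R) :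
  (forall i j, i \in J -> j \in J -> i != j -> [disjoint D i & D j]) ->
  (forall i, i \in J -> depends_on (D i) (F i)) ->
  Ex E (fun G => \prod_(i in J) F i G) = \prod_(i in J) Ex E (F i).
Proof.
have [k] := ubnP #|J|; elim: k J => // k IH J.
have [->|/set0Pn[i iJ]] := eqVneq J set0.
  move=> _ _ _; rewrite big_set0 -[RHS](Ex_const E); apply: eq_Ex => G _.
  by rewrite big_set0.
move=> cJ dJ FJ.
have -> : Ex E (fun G => \prod_(i in J) F i G) =
    Ex E (fun G => F i G * \prod_(j in J :\ i) F j G).
  by apply: eq_Ex => G _; rewrite (big_setD1 i).
rewrite (Ex_indep _ (D1 := D i) (D2 := \bigcup_(j in J :\ i) D j)).
- rewrite IH ?[RHS](big_setD1 i) //.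
  + by move: cJ; rewrite (cardsD1 i J) iJ add1n ltnS.
  + by move=> j j'; rewrite !inE => /andP[_ jJ] /andP[_ j'J]; apply: dJ.
  + by move=> j; rewrite !inE => /andP[_ jJ]; apply: FJ.
- apply/bigcup_disjointP => j; rewrite !inE => /andP[ji jJ].
  by apply: dJ => //; rewrite eq_sym.
- exact: FJ.
- move=> G; apply: eq_bigr => j jJ.
  apply: (depends_onS (bigcup_sup j jJ)).
  by apply: FJ; move: jJ; rewrite !inE => /andP[].
Qed.

Lemma Ex_prod_in E (h : T -> R) :
  Ex E (fun G => \prod_(x in G) h x) = \prod_(x in E) (1 - p + p * h x).
Proof.
elim/set_ind: E => [|e E eE IH]; first by rewrite Ex_set0 !big_set0.
rewrite Ex_setU1 // IH big_setU1 //= [RHS]mulrDl; congr (_ + _); rewrite -mulrA; congr (_ * _).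
rewrite -IH -ExZ; apply: eq_Ex => G GE; rewrite big_setU1 //.
by apply: contra eE; apply/subsetP.
Qed.

Lemma Ex_pow_card E Z (t : R) :
  Ex E (fun G => t ^+ #|G :&: Z|) = (1 - p + p * t) ^+ #|E :&: Z|.
Proof.
have aux G (c : R) : \prod_(x in G) (if x \in Z then c else 1) = c ^+ #|G :&: Z|.
  by rewrite -big_mkcondr /= -prodr_const; apply: eq_bigl => x; rewrite inE.
rewrite -aux -(eq_Ex (f := fun G => \prod_(x in G) (if x \in Z then t else 1))) => [|G _]; last exact: aux.
rewrite Ex_prod_in; apply: eq_bigr => x _.
by case: ifP => // _; rewrite mulr1 subrK.
Qed.

Lemma Ex_subset E D : D \subset E -> Ex E (fun G => (D \subset G)%:R) = p ^+ #|D|.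
Proof.
move=> DE; rewrite (Ex_dep DE) => [|G]; last by rewrite subsetI subxx andbT.
rewrite /Ex (bigD1 D) ?inE //= /wt subnn expr0 subxx !mulr1.
rewrite big1 ?addr0 // => G; rewrite inE => /andP[GD /negPf GnD].
by rewrite [D \subset G](_ : _ = false) ?mulr0 //; apply/negbTE; move: GnD; rewrite eqEsubset GD /= => ->.
Qed.

Hypothesis p01 : 0 <= p <= 1.

Lemma wt_ge0 E G : 0 <= wt E G.
Proof. by case/andP: p01 => p0 p1; rewrite mulr_ge0 ?exprn_ge0 ?subr_ge0. Qed.

Lemma le_Ex E f g : (forall G, G \subset E -> f G <= g G) -> Ex E f <= Ex E g.
Proof.
by move=> fg; apply: ler_sum => G; rewrite inE => /fg ?; rewrite ler_wpM2l ?wt_ge0.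
Qed.

Lemma Ex_ge0 E f : (forall G, G \subset E -> 0 <= f G) -> 0 <= Ex E f.
Proof. by move=> f0; rewrite -(Ex_const E 0); apply: le_Ex. Qed.

(* Conditioning on [D \subset G] amounts to replacing the random set [G] by [D :|: G]. *)
Lemma Ex_subset_decr E D (P : pred {set T}) : D \subset E ->
  (forall G G', G \subset G' -> P G' -> P G) ->
  Ex E (fun G => ((D \subset G) && P G)%:R) <= p ^+ #|D| * Ex E (fun G => (P G)%:R).
Proof.
move=> DE decr.
have dD : [disjoint D & E :\: D].
  exact: disjoint_setDr.
have -> : E = D :|: (E :\: D) by rewrite -{1}(setIidPr DE) setID.
rewrite !Ex_setU //.
apply: (@le_trans _ _ (Ex D (fun G1 => (D \subset G1)%:R * Ex (E :\: D) (fun G2 => (P (D :|: G2))%:R)))).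
  apply: le_Ex => G1 G1D; rewrite -ExZ; apply: le_Ex => G2 G2D.
  have -> : (D \subset G1 :|: G2) = (D \subset G1).
    apply/idP/idP => [DG|]; last by move/subset_trans; apply; apply: subsetUl.
    apply/subsetP => x xD; have := subsetP DG x xD; rewrite inE => /orP[//|xG2].
    by have := subsetP G2D x xG2; rewrite inE xD.
  have [DG1|] := boolP (D \subset G1); last by rewrite mul0r.
  by have /eqP -> : G1 == D; [rewrite eqEsubset G1D | rewrite /= mul1r].
rewrite ExZr Ex_subset // ler_wpM2l ?exprn_ge0 //; first by case/andP: p01.
rewrite -[leLHS](Ex_const D); apply: le_Ex => G1 G1D; apply: le_Ex => G2 G2D.
rewrite ler_nat; case: (boolP (P (D :|: G2))) => // PD.
by rewrite (decr _ (D :|: G2)) // setSU.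
Qed.

End RandomSubset.

(** * Janson's inequality *)

Definition avoids (T : finType) (B : {set {set T}}) (G : {set T}) : bool :=
  [forall D in B, ~~ (D \subset G)].

Lemma avoidsP (T : finType) (B : {set {set T}}) (G : {set T}) :
  reflect (forall D, D \in B -> ~~ (D \subset G)) (avoids B G).
Proof. exact: forall_inP. Qed.

(** Split the other members into [B0], disjoint from [D], and [B1], meeting [D]. The event
    [D \subset G] is independent of avoiding [B0], which gives the term p^3. A union bound over [B1]
    subtracts at most [3 * b] terms, each at most p^5 times the same probability because two members
    have a union of size at least 5 and avoidance is decreasing. *)
Lemma janson_step (R : realType) (T : finType) (p : R) (E : {set T}) (b : nat)
    (B : {set {set T}}) (D : {set T}) : 0 <= p <= 1 -> D \in B ->
  (forall D, D \in B -> D \subset E /\ #|D| = 3%N) ->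
  (forall D D', D \in B -> D' \in B -> D != D' -> (5 <= #|D :|: D'|)%N) ->
  (forall e, (#|[set D in B | e \in D]| <= b.+1)%N) ->
  (p ^+ 3 - (3 * b)%:R * p ^+ 5) * Ex p E (fun G => (avoids (B :\ D) G)%:R) <=
    Ex p E (fun G => ((D \subset G) && avoids (B :\ D) G)%:R).
Proof.
move=> p01 DB BE B5 Bb; have /andP[p0 p1] := p01.
set B' := B :\ D.
(* Only a positive coefficient allows avoidance of all of [B'] to be replaced by the likelier
   avoidance of [B0]. *)
have [r0|r0] := leP (p ^+ 3 - (3 * b)%:R * p ^+ 5) 0.
  apply: (@le_trans _ _ 0); last by apply: Ex_ge0.
  by apply: mulr_le0_ge0 => //; apply: Ex_ge0.
have [DE D3] := BE _ DB.
pose B0 := [set D' in B' | [disjoint D & D']].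
pose B1 := [set D' in B' | ~~ [disjoint D & D']].
have B01 G : avoids B' G = avoids B0 G && avoids B1 G.
  apply/avoidsP/andP => [h|[/avoidsP h0 /avoidsP h1] D' D'B].
    by split; apply/avoidsP => D'; rewrite inE => /andP[/h].
  by have [dD|dD] := boolP [disjoint D & D']; [apply: h0|apply: h1]; rewrite inE D'B.
(* The cap [b.+1] counts [D] itself, so each of the three points of [D] lies in at most [b] other
   members. *)
have B1b : (#|B1| <= 3 * b)%N.
  rewrite -sum1_card.
  apply: (@leq_trans (\sum_(D' in B1) \sum_(e in D) (e \in D'))).
    apply: leq_sum => D'; rewrite inE => /andP[_]; rewrite disjoint_subset => /subsetPn[e eD].
    by rewrite inE negbK => eD'; rewrite (bigD1 e) //= eD'.
  rewrite exchange_big /= -D3 -sum_nat_const; apply: leq_sum => e eD.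
  rewrite -big_mkcondr sum1_card -ltnS; apply: leq_trans (Bb e).
  rewrite [leqRHS](cardsD1 D) inE DB eD add1n ltnS.
  apply: subset_leq_card; apply/subsetP => D'; rewrite unfold_in /= !inE.
  by case: (D' == D); case: (D' \in B) => //= /andP[].
have dB0 D' : D' \in B0 -> [disjoint D & D'] by rewrite inE => /andP[].
have decr (G G' : {set T}) : G \subset G' -> avoids B0 G' -> avoids B0 G.
  move=> GG /avoidsP h; apply/avoidsP => D' /h; apply: contra => DG; exact: subset_trans GG.
set X := Ex p E (fun G => (avoids B0 G)%:R).
have X0 : 0 <= X by apply: Ex_ge0.
have XD : Ex p E (fun G => ((D \subset G) && avoids B0 G)%:R) = p ^+ 3 * X.
  rewrite -D3 -(Ex_subset p DE) -(Ex_indep p E (D1 := D) (D2 := ~: D)).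
  - by apply: eq_Ex => G _; rewrite -natrM mulnb.
  - by rewrite -setI_eq0 setICr.
  - by move=> G; rewrite subsetI subxx andbT.
  - move=> G; congr (nat_of_bool _)%:R; apply/avoidsP/avoidsP => h D' D'B.
      by apply: contra (h _ D'B) => /subset_trans; apply; apply: subsetIl.
    apply: contra (h _ D'B) => DG; rewrite subsetI DG /= -disjoints_subset disjoint_sym.
    exact: dB0.
apply: (@le_trans _ _ (p ^+ 3 * X - (3 * b)%:R * p ^+ 5 * X)).
  rewrite -mulrBl ler_wpM2l ?(ltW r0) //; apply: le_Ex => // G _.
  by rewrite ler_nat B01; case: avoids; case: avoids.
apply: (@le_trans _ _ (p ^+ 3 * X - \sum_(D' in B1) p ^+ #|D :|: D'| * X)).
  rewrite lerD2l lerN2 -mulr_suml ler_wpM2r //.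
  apply: (@le_trans _ _ (\sum_(D' in B1) p ^+ 5)).
    apply: ler_sum => D'; rewrite !inE => /andP[/andP[D'D D'B] _].
    by apply: ler_wiXn2l => //; apply: B5 => //; rewrite eq_sym.
  by rewrite sumr_const -[leLHS]mulr_natl ler_wpM2r ?exprn_ge0 // ler_nat.
rewrite -XD.
apply: (@le_trans _ _ (Ex p E (fun G => ((D \subset G) && avoids B0 G)%:R) -
   \sum_(D' in B1) Ex p E (fun G => ((D :|: D' \subset G) && avoids B0 G)%:R))).
  rewrite lerD2l lerN2; apply: ler_sum => D'; rewrite !inE => /andP[/andP[D'D D'B] _].
  apply: Ex_subset_decr => //; rewrite subUset DE; exact: (BE _ D'B).1.
rewrite -Ex_sum -ExB; apply: le_Ex => // G _.
rewrite B01; have [DG|] := boolP (D \subset G); last first.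
  move=> DG /=; rewrite sub0r oppr_le0; apply: sumr_ge0 => D' _; exact: ler0n.
have [a0|] /= := boolP (avoids B0 G); last first.
  move=> a0 /=; rewrite sub0r oppr_le0; apply: sumr_ge0 => D' _; exact: ler0n.
have [a1|] /= := boolP (avoids B1 G).
  by rewrite lerBlDr lerDl; apply: sumr_ge0 => D' _; exact: ler0n.
rewrite /avoids negb_forall_in => /exists_inP[D' D'B]; rewrite negbK => D'G.
rewrite (bigD1 D') //= subUset DG D'G /= opprD addrA subrr sub0r oppr_le0.
apply: sumr_ge0 => D'' _; exact: ler0n.
Qed.

(** The chain rule: each new member multiplies the probability of avoidance by the conditional
    probability of missing it, which [janson_step] bounds. Capping the number of members through a
    point makes all factors equal. *)
Lemma janson (R : realType) (T : finType) (p : R) (E : {set T}) (b : nat)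
    (B : {set {set T}}) : 0 <= p <= 1 ->
  (forall D, D \in B -> D \subset E /\ #|D| = 3%N) ->
  (forall D D', D \in B -> D' \in B -> D != D' -> (5 <= #|D :|: D'|)%N) ->
  (forall e, (#|[set D in B | e \in D]| <= b.+1)%N) ->
  Ex p E (fun G => (avoids B G)%:R) <= (1 - p ^+ 3 + (3 * b)%:R * p ^+ 5) ^+ #|B|.
Proof.
move=> p01; have /andP[p0 p1] := p01.
elim/set_ind: B => [|D B DB IH] BE B5 Bb.
  by rewrite cards0 expr0 -[leRHS](Ex_const p E); apply: le_Ex => // G _; rewrite lern1 leq_b1.
have BD : (D |: B) :\ D = B by rewrite setU1K.
have {IH}IH : Ex p E (fun G => (avoids B G)%:R) <= (1 - p ^+ 3 + (3 * b)%:R * p ^+ 5) ^+ #|B|.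
  apply: IH => [D' D'B|D' D'' D'B D''B|e].
  - by apply: BE; rewrite inE D'B orbT.
  - by apply: B5; rewrite inE ?D'B ?D''B orbT.
  apply: leq_trans (Bb e); apply: subset_leq_card; apply/subsetP => D'.
  by rewrite !inE => /andP[-> ->]; rewrite orbT.
have := janson_step p01 (setU11 D B) BE B5 Bb; rewrite BD => st.
rewrite cardsU1 DB add1n exprS.
have -> : Ex p E (fun G => (avoids (D |: B) G)%:R) = Ex p E (fun G => (avoids B G)%:R) -
    Ex p E (fun G => ((D \subset G) && avoids B G)%:R).
  rewrite -ExB; apply: eq_Ex => G _.
  have -> : avoids (D |: B) G = ~~ (D \subset G) && avoids B G.
    apply/avoidsP/andP => [h|[h0 /avoidsP h] D'].
      by split; [apply: h; rewrite setU11|apply/avoidsP => D' D'B; apply: h; rewrite inE D'B orbT].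
    by rewrite in_setU1 => /orP[/eqP->|/h].
  by case: subset; case: avoids; rewrite ?subrr ?subr0.
apply: (@le_trans _ _ ((1 - p ^+ 3 + (3 * b)%:R * p ^+ 5) * Ex p E (fun G => (avoids B G)%:R))).
  rewrite [1 - _ + _](_ : _ = 1 - (p ^+ 3 - (3 * b)%:R * p ^+ 5)); last by rewrite opprB addrA addrAC.
  by rewrite mulrBl mul1r lerD2l lerN2.
apply: ler_wpM2l => //.
rewrite addr_ge0 ?subr_ge0 ?exprn_ile1 // mulr_ge0 ?exprn_ge0 //.
Qed.

(** * Small minimal cocycles are empty *)

Definition nbr (n : nat) (G : {set {set 'I_n}}) (v : 'I_n) : {set 'I_n} :=
  [set x | [set v; x] \in G].

Section LocalArgument.
Variables (R : realType) (n : nat) (G F : {set {set 'I_n}}).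
Implicit Types (v x y z : 'I_n) (A B X Y W : {set 'I_n}).

Definition codeg v y : nat := #|nbr G v :&: nbr G y|.

Lemma nbr_sym (H : {set {set 'I_n}}) x y : (x \in nbr H y) = (y \in nbr H x).
Proof. by rewrite !inE setUC. Qed.

Lemma sub_nbr (H H' : {set {set 'I_n}}) v : H \subset H' -> nbr H v \subset nbr H' v.
Proof. by move=> HH; apply/subsetP => x; rewrite !inE; apply: (subsetP HH). Qed.

Hypotheses (GK : G \subset Kn n) (cF : cocycle G F).

Lemma nbr_irr v : v \notin nbr G v.
Proof. by rewrite inE; apply/negP => /(subsetP GK); rewrite inE setUid cards1. Qed.

Lemma nbr_neq v x : x \in nbr G v -> v != x.
Proof. by apply: contraTneq => <-; apply: nbr_irr. Qed.

Lemma cocycle_triangle x y z : y \in nbr G x -> z \in nbr G x -> z \in nbr G y ->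
  ~~ ((y \in nbr F x) (+) (z \in nbr F x) (+) (z \in nbr F y)).
Proof.
move=> xy xz yz; have nxy := nbr_neq xy; have nxz := nbr_neq xz; have nyz := nbr_neq yz.
set t := [set [set x; y]; [set y; z]; [set x; z]].
have tG : triangle_of G t.
  exists x, y, z; split=> //; apply/subsetP => e; rewrite !inE.
  by case/orP => [/orP[]|] /eqP ->; move: xy xz yz; rewrite !inE.
have := cF.2 _ tG; rewrite /t.
have e1 : [set x; y] != [set y; z].
  by apply/eqP => /set2_eq[] [e e']; subst; rewrite ?eqxx in nxy nxz nyz.
have e2 : [set x; y] != [set x; z].
  by apply/eqP => /set2_eq[] [e e']; subst; rewrite ?eqxx in nxy nxz nyz.
have e3 : [set y; z] != [set x; z].
  by apply/eqP => /set2_eq[] [e e']; subst; rewrite ?eqxx in nxy nxz nyz.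
rewrite -sum1_card big_mkcond /= (eq_bigr (fun e =>
  ((e == [set x; y]) && (e \in F)) + ((e == [set y; z]) && (e \in F)) +
   ((e == [set x; z]) && (e \in F)))%N); last first.
  move=> e _; rewrite !inE; case: (e \in F); rewrite ?andbF //= !andbT.
  case: (eqVneq e [set x; y]) => [->|_]; first by rewrite (negPf e1) (negPf e2).
  by case: (eqVneq e [set y; z]) => [->|_]; rewrite ?(negPf e3) //; case: eqP.
have pt e0 : (\sum_e ((e == e0) && (e \in F)) = (e0 \in F) :> nat)%N.
  by rewrite (bigD1 e0) //= eqxx big1 ?addn0 // => e /negPf->.
by rewrite !big_split /= !pt !oddD !oddb !inE addbAC.
Qed.

Lemma nbrF_nbr v y : y \in nbr F v -> y \in nbr G v.
Proof. exact/subsetP/sub_nbr/cF.1. Qed.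

(** In a triangle [v y z] with [vy] in [F], exactly one of [vz] and [yz] lies in [F]. So edges of
    [G] from [y] to the part of the link of [v] outside [F] are edges of [F]. *)
Lemma nbr_setD v y : y \in nbr F v ->
  nbr G y :&: (nbr G v :\: nbr F v) = nbr F y :&: nbr G v.
Proof.
move=> vy; apply/setP => z; rewrite in_setI in_setD in_setI.
case zv : (z \in nbr G v); rewrite ?andbF //= !andbT.
case zy : (z \in nbr G y); last first.
  by apply/esym/negbTE; apply: contraFN zy; apply: nbrF_nbr.
have := cocycle_triangle (nbrF_nbr vy) zv zy; rewrite vy /=.
by case: (z \in nbr F v); case: (z \in nbr F y).
Qed.

(** Each common neighbour is classified by which of its two edges is the second edge of [F] in the
    triangle. *)
Lemma codegE v y : y \in nbr F v ->
  codeg v y = (#|nbr F v :&: nbr G y| + #|nbr F y :&: nbr G v|)%N.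
Proof.
move=> vy; rewrite /codeg -(cardsID (nbr F v)) -(nbr_setD vy); congr (_ + _)%N.
  apply: eq_card => z; rewrite !in_setI.
  case zF : (z \in nbr F v); rewrite ?andbF //= andbT.
  by rewrite (nbrF_nbr zF).
apply: eq_card => z; rewrite !(in_setI, in_setD).
by case: (z \in nbr G v); case: (z \in nbr G y); rewrite ?andbF ?andbT.
Qed.

Variables (D L gam rho : R).
(** Chosen so that the edges of [F] that are not low make up at most 7/90 of [f2]:
    [2 * kap / eta = 1 / 30], and [kap' = gam / 90] pays for the edges inside [W]. In the
    application [D] is the degree scale n p and [L] the codegree scale n p^2. *)
Let eta : R := 1 / 100.
Let kap : R := 1 / 6000.
Let kap' : R := gam / 90.

Definition isolated_low_edges := forall x y z, y \in nbr G x -> z \in nbr G x -> y != z ->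
  (codeg x y)%:R < eta * L -> (codeg x z)%:R < eta * L -> False.
(** The sum is twice the number of edges inside [A]. It is used at two scales: for
    [F]-neighbourhoods of vertices outside [W] with [u = L], and for [W] itself with [u = D]. *)
Definition sparse_subsets (m k u : R) := forall A, #|A|%:R <= m ->
  \sum_(v in A) #|A :&: nbr G v|%:R <= k * #|A|%:R * u.
(** With [L = D * p], the expected number of edges between [A] and [B] is at least |A| L / 4; the
    bound asks for half of that. *)
Definition link_expansion := forall v A B, A \subset nbr G v -> B \subset nbr G v ->
  [disjoint A & B] -> gam * D / 2 <= #|A|%:R -> D / 4 <= #|B|%:R ->
  #|A|%:R * L / 8 <= \sum_(y in A) #|nbr G y :&: B|%:R.

Hypotheses (D0 : 0 < D) (L0 : 0 < L) (g0 : 0 < gam) (QG : Q G).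
Hypothesis hdeg : forall v, D / 2 <= #|nbr G v|%:R.
Hypothesis hlow : isolated_low_edges.
Hypothesis hsp1 : sparse_subsets (gam * D) kap L.
Hypothesis hsp2 : sparse_subsets (rho * n%:R) kap' D.
Hypothesis hexp : link_expansion.
Hypothesis hmin : forall v, (2 * #|nbr F v| <= #|nbr G v|)%N.
Hypothesis hsmall : \sum_v #|nbr F v|%:R <= rho * gam * n%:R * D.

(** [f2] is twice the number of edges of [F], and [K v] is twice the number of edges of [G] inside
    the [F]-neighbourhood of [v]. *)
Let f2 : R := \sum_v #|nbr F v|%:R.
Let W := [set v | gam * D < #|nbr F v|%:R].
Let K v : R := \sum_(y in nbr F v) #|nbr F v :&: nbr G y|%:R.
Let low v y := (codeg v y)%:R < eta * L.

Lemma sum_exchange (X Y : {set 'I_n}) (h : 'I_n -> 'I_n -> R) :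
  \sum_(v in X) \sum_(y in nbr F v :&: Y) h v y =
  \sum_(y in Y) \sum_(v in nbr F y :&: X) h v y.
Proof.
rewrite (exchange_big_dep (mem Y)) /=; last by move=> v y _; rewrite inE => /andP[].
by apply: eq_bigr => y yY; apply: eq_bigl => v; rewrite !in_setI yY andbT nbr_sym andbC.
Qed.

Let f2_split X (h : 'I_n -> R) : \sum_v h v = \sum_(v in X) h v + \sum_(v in ~: X) h v.
Proof.
rewrite (bigID (mem X)) /=; congr (_ + _); apply: eq_bigl => v; by rewrite in_setC.
Qed.

Lemma K_le v : v \notin W -> K v <= kap * #|nbr F v|%:R * L.
Proof. by rewrite inE -leNgt; apply: hsp1. Qed.

Lemma sumK_le : \sum_(v in ~: W) K v <= kap * L * f2.
Proof.
apply: (@le_trans _ _ (\sum_(v in ~: W) kap * #|nbr F v|%:R * L)).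
  by apply: ler_sum => v; rewrite in_setC => /K_le.
rewrite /f2 (f2_split W) mulrDr ler_wpDl //.
  apply: mulr_ge0; last exact: sumr_ge0.
  by apply: mulr_ge0; rewrite ?(ltW L0) // /kap divr_ge0.
by rewrite big_distrr /=; apply: ler_sum => v _; rewrite mulrAC.
Qed.

(** After exchanging the sums, the inner sum is part of [K y] for a vertex [y] outside [W], whatever
    [X] is. It is applied to [W] and to its complement. *)
Lemma sum_outer_le X : \sum_(v in X) \sum_(y in nbr F v :&: ~: W) #|nbr F y :&: nbr G v|%:R
  <= kap * L * f2.
Proof.
apply: le_trans sumK_le; rewrite sum_exchange; apply: ler_sum => y _.
rewrite /K [leRHS](big_setID X) /= lerDl; apply: sumr_ge0 => *; exact: ler0n.
Qed.

Let nl v := [set y in nbr F v | (y \notin W) && ~~ low v y].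

(** Every edge counted has codegree at least L / 100. By [codegE] this codegree splits into two
    parts, each charged to [K] of one end, and both ends are outside [W]. *)
Lemma nl_le : \sum_(v in ~: W) #|nl v|%:R <= 1 / 30 * f2.
Proof.
have h : eta * L * \sum_(v in ~: W) #|nl v|%:R <= 2 * (kap * L * f2).
  apply: (@le_trans _ _ (\sum_(v in ~: W) \sum_(y in nbr F v :&: ~: W) (codeg v y)%:R)).
    rewrite big_distrr /=; apply: ler_sum => v _.
    rewrite (big_setID (nl v)) /= -[leLHS]addr0 lerD //; last exact: sumr_ge0.
    rewrite -sum1_card natr_sum big_distrr /=.
    have -> : (nbr F v :&: ~: W) :&: nl v = nl v.
      by apply/setIidPr/subsetP => y; rewrite !in_setI inE in_setC => /and3P[-> ->].
    by apply: ler_sum => y; rewrite inE => /and3P[_ _]; rewrite /low -leNgt mulr1.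
  rewrite mulrDl mul1r.
  apply: (@le_trans _ _ (\sum_(v in ~: W) \sum_(y in nbr F v :&: ~: W)
     (#|nbr F v :&: nbr G y|%:R + #|nbr F y :&: nbr G v|%:R))).
    apply: ler_sum => v _; apply: ler_sum => y; rewrite in_setI => /andP[vy _].
    by rewrite codegE // natrD.
  rewrite (eq_bigr (fun v => (\sum_(y in nbr F v :&: ~: W) #|nbr F v :&: nbr G y|%:R +
     \sum_(y in nbr F v :&: ~: W) #|nbr F y :&: nbr G v|%:R))) => [|v _]; last first.
    by rewrite big_split.
  rewrite big_split /= lerD ?sum_outer_le //.
  apply: le_trans sumK_le; apply: ler_sum => v _.
  rewrite /K [leRHS](big_setID (~: W)) /= lerDl; exact: sumr_ge0.
move: h; rewrite /eta /kap; set s := \sum_(v in _) _ => h.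
have : L * (1 / 100 * s - 2 * (1 / 6000 * f2)) <= 0 by lra.
by rewrite pmulr_rle0 //; lra.
Qed.

Lemma W_le : gam * D * #|W|%:R <= f2.
Proof.
rewrite /f2 (f2_split W) -[leLHS]addr0 lerD ?sumr_ge0 //.
rewrite -sum1_card natr_sum big_distrr /=; apply: ler_sum => v.
by rewrite inE mulr1 => /ltW.
Qed.

(** By Markov's inequality and [hsmall], [W] has at most [rho * n] vertices, so [hsp2] applies to
    it; [W_le] then turns [gam * D * #|W|] back into [f2]. *)
Lemma ww_le : \sum_(v in W) #|nbr F v :&: W|%:R <= 1 / 90 * f2.
Proof.
have cW : #|W|%:R <= rho * n%:R :> R.
  have : gam * D * #|W|%:R <= gam * D * (rho * n%:R).
    apply: le_trans W_le _; apply: le_trans hsmall _.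
    by rewrite le_eqVlt; apply/orP; left; apply/eqP; ring.
  by rewrite ler_pM2l // mulr_gt0.
apply: le_trans (_ : kap' * #|W|%:R * D <= _).
  apply: le_trans (hsp2 cW); apply: ler_sum => v _; rewrite ler_nat setIC.
  exact/subset_leq_card/setIS/sub_nbr/cF.1.
by have := W_le; rewrite /kap'; lra.
Qed.

(** Let [A] be the [F]-neighbours of [v] outside [W]. If [A] is large, the link of [v] expands from
    [A] into the non-[F] neighbours of [v], at least D / 4 of them by minimality, and by [nbr_setD]
    all those edges are in [F] and counted by [sum_outer_le]. If [A] is small, [v] has more
    [F]-neighbours inside [W] than outside. *)
Lemma wu_le : \sum_(v in W) #|nbr F v :\: W|%:R <= 1 / 60 * f2.
Proof.
have h : L / 8 * \sum_(v in W) #|nbr F v :\: W|%:R <=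
   kap * L * f2 + L / 8 * \sum_(v in W) #|nbr F v :&: W|%:R.
  apply: le_trans (lerD (sum_outer_le W) (lexx _)).
  rewrite !big_distrr /= -big_split /=; apply: ler_sum => v vW.
  rewrite -setDE; set A := nbr F v :\: W.
  have [Abig|Asmall] := leP (gam * D / 2) #|A|%:R.
    apply: ler_wpDr; first by rewrite mulr_ge0 // divr_ge0 // ltW.
    apply: (@le_trans _ _ (\sum_(y in A) #|nbr G y :&: (nbr G v :\: nbr F v)|%:R)).
      rewrite mulrC mulrA; apply: hexp => //.
      - apply: subset_trans (subsetDl _ _) _; exact/sub_nbr/cF.1.
      - exact: subsetDl.
      - by rewrite disjoints_subset; apply/subsetP => y; rewrite !(in_setC, in_setD) negb_and negbK => /andP[_ ->].
      have := hmin v; have := hdeg v; rewrite cardsD (setIidPr _); last exact/sub_nbr/cF.1.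
      by move=> hd hm; rewrite natrB; [move: hm; rewrite -(ler_nat R) natrM; lra | lia].
    by apply: ler_sum => y; rewrite in_setD => /andP[_ vy]; rewrite nbr_setD.
  apply: ler_wpDl; first exact: sumr_ge0.
  apply: ler_wpM2l; first by rewrite divr_ge0 // ltW.
  move: vW; rewrite inE -(cardsID W (nbr F v)) natrD -/A => vW; lra.
have := ww_le; move: h; rewrite /kap; set s := \sum_(v in _) _; set t := \sum_(v in _) _ => h ht.
have : L * (1 / 8 * s - (1 / 6000 * f2 + 1 / 8 * t)) <= 0 by lra.
have f0 : 0 <= f2 by apply: sumr_ge0.
by rewrite pmulr_rle0 //; lra.
Qed.

Let lw v := [set y in nbr F v | low v y].
Let nw v := [set y in nbr F v | ~~ low v y].

Lemma codegC v y : codeg v y = codeg y v.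
Proof. by rewrite /codeg setIC. Qed.

Lemma lw_le1 v : (#|lw v| <= 1)%N.
Proof.
rewrite leqNgt; apply/negP => /card_gt1P[y [z [yl zl yz]]].
move: yl zl; rewrite !inE => /andP[vy ly] /andP[vz lz].
by apply: (@hlow v y z) => //; apply: nbrF_nbr; rewrite inE.
Qed.

(** By [Q] the low edge [vy] lies in a triangle [v y z], whose second edge of [F] is [vz] or [yz].
    It shares a vertex with [vy], so it is not low. *)
Lemma lw_le v : (#|lw v| <= #|nw v| + \sum_(y in lw v) #|nw y|)%N.
Proof.
have [->|/set0Pn[y yl]] := eqVneq (lw v) set0; first by rewrite cards0.
apply: leq_trans (lw_le1 v) _; rewrite (bigD1 y) //= addnA ltn_addr //.
move: yl; rewrite inE => /andP[vy ly].
have vyG := nbrF_nbr vy; have nvy := nbr_neq vyG.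
have [t [tG vyt]] : exists t, triangle_of G t /\ [set v; y] \in t.
  by apply: QG; move: vyG; rewrite inE.
have [z vz yz] : exists2 z, z \in nbr G v & z \in nbr G y.
  case: tG vyt => a [b [c [ab bc ac -> /subsetP tG]]].
  have eab : b \in nbr G a by rewrite inE; apply: tG; rewrite !inE eqxx.
  have ebc : c \in nbr G b by rewrite inE; apply: tG; rewrite !inE eqxx orbT.
  have eac : c \in nbr G a by rewrite inE; apply: tG; rewrite !inE eqxx orbT.
  rewrite !inE => /orP[/orP[]|] /eqP/set2_eq[] [-> ->].
  - by exists c.
  - by exists c.
  - by exists a; rewrite nbr_sym.
  - by exists a; rewrite nbr_sym.
  - by exists b => //; rewrite nbr_sym.
  - by exists b => //; rewrite nbr_sym.
have nyz := nbr_neq yz.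
have := cocycle_triangle vyG vz yz; rewrite vy /=.
case zF : (z \in nbr F v) => /=.
  move=> _; rewrite addn_gt0; apply/orP; left; apply/card_gt0P; exists z; rewrite inE zF /=.
  by apply/negP => lz; apply: (@hlow v y z).
rewrite negbK => zFy.
rewrite addn_gt0; apply/orP; right; apply/card_gt0P; exists z; rewrite inE zFy /=.
apply/negP => lz; apply: (@hlow y v z) => //; first by rewrite nbr_sym.
  exact: nbr_neq.
by rewrite codegC.
Qed.

Lemma sum_lw_le : (\sum_v #|lw v| <= 2 * \sum_v #|nw v|)%N.
Proof.
apply: (@leq_trans (\sum_v (#|nw v| + \sum_(y in lw v) #|nw y|))).
  by apply: leq_sum => v _; apply: lw_le.
rewrite mul2n -addnn.
rewrite big_split leq_add2l.
(* Each [y] is charged only by its unique low partner. *)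
rewrite (exchange_big_dep xpredT) //=; apply: leq_sum => y _.
rewrite sum_nat_const -[leqRHS]mul1n leq_mul2r; apply/orP; right.
apply: leq_trans (lw_le1 y); apply: subset_leq_card; apply/subsetP => v.
move=> yv; have {}yv : y \in lw v := yv.
by move: yv; rewrite !inE /low codegC setUC.
Qed.

Lemma small_cocycle_eq0 : F = set0.
Proof.
have f0 : 0 <= f2 by apply: sumr_ge0.
(* The total is 7/90 of [f2]. Low edges at most double the others, so [f2] is at most 21/90 of
   itself. *)
have nw_le : \sum_v #|nw v|%:R <= 1 / 30 * f2 + 1 / 90 * f2 + 2 * (1 / 60 * f2).
  have uw : \sum_(v in ~: W) #|nbr F v :&: W|%:R = \sum_(v in W) #|nbr F v :\: W|%:R :> R.
    have := sum_exchange (~: W) W (fun _ _ => 1) => /=.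
    rewrite (eq_bigr (fun v => #|nbr F v :&: W|%:R)) => [->|v _]; last by rewrite sumr_const.
    by apply: eq_bigr => v _; rewrite sumr_const setDE.
  rewrite (f2_split W).
  apply: (@le_trans _ _ (\sum_(v in W) (#|nbr F v :&: W|%:R + #|nbr F v :\: W|%:R) +
     \sum_(v in ~: W) (#|nl v|%:R + #|nbr F v :&: W|%:R))).
    apply: lerD; apply: ler_sum => v _; rewrite -natrD ler_nat.
      rewrite cardsID; apply: subset_leq_card; apply/subsetP => y.
      by rewrite inE => /andP[].
    rewrite -(cardsID W (nw v)) addnC; apply: leq_add; apply: subset_leq_card; apply/subsetP => y.
      rewrite in_setD => /andP[yW]; rewrite [y \in nw v]inE => /andP[vy ly].
      by rewrite [y \in nl v]inE vy yW ly.
    by rewrite !in_setI [y \in nw v]inE => /andP[/andP[-> _] ->].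
  rewrite !big_split /= uw; have := nl_le; have := ww_le; have := wu_le; lra.
have f2E : f2 = \sum_v #|lw v|%:R + \sum_v #|nw v|%:R.
  rewrite -big_split /=; apply: eq_bigr => v _; rewrite -natrD.
  rewrite -(cardsID [set y | low v y] (nbr F v)); congr (_ + _)%:R; apply: eq_card => y.
    by rewrite !inE.
  by rewrite !inE andbC.
have : \sum_v #|lw v|%:R <= 2 * \sum_v #|nw v|%:R :> R.
  by have := sum_lw_le; rewrite -(ler_nat R) natrM !natr_sum.
move: f2E nw_le; set l := \sum_v _; set m := \sum_v _ => f2E nw_le lm.
have f20 : f2 = 0 by lra.
apply/eqP; apply/set0Pn => -[e eF].
have : e \in Kn n by apply: (subsetP GK); apply: (subsetP cF.1).
rewrite inE => /cards2P[x [y [xy eE]]].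
have : #|nbr F x|%:R <= f2.
  by rewrite /f2 (bigD1 x) //= lerDl; apply: sumr_ge0.
rewrite f20 lern0 cards_eq0 => /eqP h.
have : y \in nbr F x by rewrite inE -eE.
by rewrite h inE.
Qed.

End LocalArgument.

(** * Tail bounds *)

Section TailBounds.
Variables (R : realType) (T : finType) (p : R).
Hypothesis p01 : 0 <= p <= 1.
Implicit Types (E G Z : {set T}).

Lemma expR1_ge : 5 / 2 <= expR 1 :> R.
Proof.
have e8 : 1 + 1 / 8 <= expR (1 / 8) :> R by apply: expR_ge1Dx.
have -> : (1 : R) = 8%:R * (1 / 8) by lra.
rewrite expRM_natl; apply: le_trans (_ : (1 + 1 / 8) ^+ 8 <= _); first lra.
by rewrite lerXn2r // nnegrE; lra.
Qed.

Lemma expR1_le : expR 1 <= 3 :> R.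
Proof.
have e8 : 1 - 1 / 8 <= expR (- (1 / 8)) :> R by have := expR_ge1Dx (- (1 / 8) : R); lra.
have e81 : expR (1 / 8) <= 8 / 7 :> R.
  rewrite -[1 / 8]opprK expRN -[8 / 7]invrK lef_pV2 ?posrE ?expR_gt0 ?invr_gt0 //; lra.
have -> : (1 : R) = 8%:R * (1 / 8) by lra.
rewrite expRM_natl; apply: le_trans (_ : (8 / 7) ^+ 8 <= _); last lra.
by rewrite lerXn2r // nnegrE; [apply: expR_ge0 | lra].
Qed.

Lemma expRN1_le : expR (- 1) <= 2 / 5 :> R.
Proof.
rewrite expRN -[2 / 5]invrK lef_pV2 ?posrE ?expR_gt0 ?invr_gt0 //; last lra.
by have := expR1_ge; lra.
Qed.

Lemma exprn_le_expR (x : R) (m : nat) : -1 <= x -> (1 + x) ^+ m <= expR (m%:R * x).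
Proof.
move=> x1; rewrite expRM_natl lerXn2r // ?nnegrE ?expR_ge0 ?expR_ge1Dx //; lra.
Qed.

Lemma Ex_expR_card E Z (s : R) :
  Ex p E (fun G => expR (s * #|G :&: Z|%:R)) <= expR (p * (expR s - 1) * #|E :&: Z|%:R).
Proof.
rewrite (eq_Ex p (g := fun G => expR s ^+ #|G :&: Z|)); last first.
  by move=> G _; rewrite mulrC expRM_natl.
rewrite Ex_pow_card.
have -> : 1 - p + p * expR s = 1 + p * (expR s - 1) by ring.
apply: le_trans (exprn_le_expR _ _) _; last by rewrite mulrC.
case/andP: p01 => p0 p1; have : 0 <= p * expR s by rewrite mulr_ge0 ?expR_ge0.
rewrite mulrBr mulr1; lra.
Qed.

Lemma Ex_markov E (f : {set T} -> R) (P : {set T} -> bool) :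
  (forall G, G \subset E -> 0 <= f G) -> (forall G, G \subset E -> P G -> 1 <= f G) ->
  Ex p E (fun G => (P G)%:R) <= Ex p E f.
Proof.
move=> f0 f1; apply: le_Ex => // G GE; case: (boolP (P G)) => PG; [exact: f1|exact: f0].
Qed.

(* The factors [2] here and [3/5] in [lower_tail] bound [e - 1] and [1 - 1/e]. *)
Lemma upper_tail E Z (m : R) :
  Ex p E (fun G => (m <= #|G :&: Z|%:R)%R%:R) <= expR (2 * p * #|Z|%:R - m).
Proof.
case/andP: (p01) => p0 p1.
apply: le_trans (Ex_markov (f := fun G => expR (- m) * expR (1 * #|G :&: Z|%:R)) _ _) _.
- by move=> G _; rewrite mulr_ge0 ?expR_ge0.
- move=> G _ h; rewrite -expRD -[leLHS]expR0 ler_expR; lra.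
rewrite ExZ addrC expRD ler_wpM2l ?expR_ge0 //; apply: le_trans (Ex_expR_card _ _ _) _.
rewrite ler_expR.
have : #|E :&: Z|%:R <= #|Z|%:R :> R by rewrite ler_nat subset_leq_card ?subsetIr.
have := expR1_le; have := expR1_ge; move: (#|_|%:R) (ler0n R #|E :&: Z|) (#|Z|%:R) (expR 1 : R) => a a0 b e e1 e3 ab.
rewrite [2 * p]mulrC -!mulrA ler_wpM2l //; nra.
Qed.

Lemma upper_tail_gen E Z (s m : R) : 0 <= s ->
  Ex p E (fun G => (m <= #|G :&: Z|%:R)%R%:R) <= expR (p * expR s * #|Z|%:R - s * m).
Proof.
move=> s0; case/andP: (p01) => p0 p1.
apply: le_trans (Ex_markov (f := fun G => expR (- (s * m)) * expR (s * #|G :&: Z|%:R)) _ _) _.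
- by move=> G _; rewrite mulr_ge0 ?expR_ge0.
- move=> G _ h; rewrite -expRD -[leLHS]expR0 ler_expR addrC subr_ge0 ler_wpM2l //.
rewrite ExZ addrC expRD ler_wpM2l ?expR_ge0 //; apply: le_trans (Ex_expR_card _ _ _) _.
rewrite ler_expR.
have : #|E :&: Z|%:R <= #|Z|%:R :> R by rewrite ler_nat subset_leq_card ?subsetIr.
have := expR_ge1Dx s; move: (#|_|%:R) (ler0n R #|E :&: Z|) (#|Z|%:R) (expR s : R) => a a0 b e e1 ab.
rewrite -!mulrA ler_wpM2l //; nra.
Qed.

Lemma lower_tail E Z (m : R) : Z \subset E ->
  Ex p E (fun G => (#|G :&: Z|%:R <= m)%R%:R) <= expR (m - 3 / 5 * p * #|Z|%:R).
Proof.
move=> ZE; case/andP: (p01) => p0 p1.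
apply: le_trans (Ex_markov (f := fun G => expR m * expR (-1 * #|G :&: Z|%:R)) _ _) _.
- by move=> G _; rewrite mulr_ge0 ?expR_ge0.
- move=> G _ h; rewrite -expRD -[leLHS]expR0 ler_expR; lra.
rewrite ExZ expRD ler_wpM2l ?expR_ge0 //; apply: le_trans (Ex_expR_card _ _ _) _.
rewrite ler_expR (setIidPr ZE).
have := expRN1_le; have := ler0n R #|Z|.
move: (#|_|%:R : R) (expR (-1) : R) => a e a0 e1.
rewrite [3 / 5 * p]mulrC -!mulrA -mulrN ler_wpM2l //; nra.
Qed.

(** With [e] the edge [xw] and [Z] the edges from [w] to a set [U], this is the contribution of one
    vertex [w] to the joint generating function of the codegrees of [x] with [U]; at [t = 0] it is
    the probability that [w] is a common neighbour in no case. *)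
Lemma Ex_block E e Z (t : R) : e \in E -> Z \subset E -> e \notin Z ->
  Ex p E (fun G => if e \in G then t ^+ #|G :&: Z| else 1) = 1 - p + p * (1 - p + p * t) ^+ #|Z|.
Proof.
move=> eE ZE eZ.
rewrite (@Ex_dep _ _ _ _ (e |: Z)); last 2 first.
- by rewrite subUset sub1set eE.
- by move=> G; rewrite !inE eqxx andbT -setIA (setIidPr (subsetUr _ _)).
rewrite Ex_setU1 //; congr (_ + _ * _).
  rewrite -[RHS]mulr1; congr (_ * _); rewrite -[RHS](Ex_const p Z); apply: eq_Ex => G GZ.
  by case: ifP => // eG; case/negP: eZ; apply: (subsetP GZ).
rewrite -[in RHS](setIid Z) -(Ex_pow_card p Z); apply: eq_Ex => G GZ.
rewrite !inE eqxx /=; congr (_ ^+ _); apply: eq_card => x; rewrite !inE.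
by case: eqVneq => //= ->; rewrite (negPf eZ) andbF.
Qed.

Lemma Ex_blocks E (I : finType) (J : {set I}) (e : I -> T) (Z : I -> {set T}) (k : nat) (t : R) :
  (forall i, i \in J -> [/\ e i \in E, Z i \subset E, e i \notin Z i & #|Z i| = k]) ->
  (forall i j, i \in J -> j \in J -> i != j -> [disjoint e i |: Z i & e j |: Z j]) ->
  Ex p E (fun G => \prod_(i in J) (if e i \in G then t ^+ #|G :&: Z i| else 1)) =
  (1 - p + p * (1 - p + p * t) ^+ k) ^+ #|J|.
Proof.
move=> hJ dJ; rewrite (Ex_prod _ _ (D := fun i => e i |: Z i)) //; last first.
  by move=> i iJ G; rewrite !inE eqxx andbT -setIA (setIidPr (subsetUr _ _)).
rewrite -prodr_const; apply: eq_bigr => i /hJ[eE ZE eZ <-]; exact: Ex_block.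
Qed.

End TailBounds.

Lemma sum_pow_card (R : realType) (T : finType) (x : R) :
  \sum_(A : {set T}) x ^+ #|A| = (1 + x) ^+ #|T|.
Proof.
rewrite addrC -cardsT -prodr_const (eq_bigl xpredT) => [|i]; last by rewrite inE.
rewrite bigA_distr; apply: eq_bigr => A _.
by rewrite -big_mkcond /= prodr_const.
Qed.

(** * The dense regime *)

Section Cross.
Variable n : nat.
Implicit Types (A B X Y : {set 'I_n}) (G : {set {set 'I_n}}).

Definition cross A B : {set {set 'I_n}} := [set [set q.1; q.2] | q in setX A B].

Lemma cross_inj A B : [disjoint A & B] ->
  {in setX A B &, injective (fun q : 'I_n * 'I_n => [set q.1; q.2])}.
Proof.
move=> dAB [a b] [a' b']; rewrite !in_setX /= => /andP[aA bB] /andP[a'A b'B].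
case/set2_eq => -[e e']; subst; first by [].
by rewrite (disjointFr dAB aA) in b'B.
Qed.

Lemma card_cross A B : [disjoint A & B] -> #|cross A B| = (#|A| * #|B|)%N.
Proof. by move=> dAB; rewrite card_in_imset ?cardsX //; apply: cross_inj. Qed.

Lemma crossP A B e : reflect (exists a b, [/\ a \in A, b \in B & e = [set a; b]]) (e \in cross A B).
Proof.
apply: (iffP imsetP) => [[[a b]]|[a [b [aA bB ->]]]].
  by rewrite in_setX => /andP[aA bB] ->; exists a, b.
by exists (a, b) => //; rewrite in_setX aA.
Qed.

Lemma cross_Kn A B : [disjoint A & B] -> cross A B \subset Kn n.
Proof.
move=> dAB; apply/subsetP => e /crossP[a [b [aA bB ->]]]; rewrite inE cards2.
by have [ab|//] := eqVneq a b; rewrite ab (disjointFl dAB bB) in aA.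
Qed.

Lemma sum_cross G A B : [disjoint A & B] ->
  (\sum_(y in A) #|nbr G y :&: B|)%N = #|G :&: cross A B|.
Proof.
move=> dAB.
have -> : G :&: cross A B =
    [set [set q.1; q.2] | q in [set q in setX A B | [set q.1; q.2] \in G]].
  apply/setP => e; rewrite in_setI; apply/andP/imsetP.
    by case=> eG /imsetP[q qAB eq]; exists q => //; rewrite inE qAB -eq.
  by case=> q; rewrite inE => /andP[qAB qG] ->; split=> //; apply: imset_f.
rewrite card_in_imset; last first.
  by apply: sub_in2 (cross_inj dAB) => q; rewrite [q \in _]inE => /andP[].
rewrite -sum1_card (eq_bigl (fun q : 'I_n * 'I_n => (q.1 \in A) && ((q.2 \in B) && (q.2 \in nbr G q.1)))).
  rewrite -(pair_big_dep (mem A) (fun a b => (b \in B) && (b \in nbr G a)) (fun _ _ => 1%N)) /=.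
  apply: eq_bigr => y _; rewrite -sum1_card; apply: eq_bigl => x.
  by rewrite in_setI andbC.
by move=> q; rewrite !inE andbA.
Qed.

Lemma card_nbrI G v X : v \notin X -> #|nbr G v :&: X| = #|G :&: cross [set v] X|.
Proof.
by move=> vX; rewrite -sum_cross ?big_set1 //; rewrite disjoints1.
Qed.

Definition pairs A : {set {set 'I_n}} := [set e : {set 'I_n} | e \subset A & #|e| == 2%N].

Lemma card_pairs A : #|pairs A| = 'C(#|A|, 2).
Proof. by rewrite /pairs cards_draws. Qed.

Lemma pairs_Kn A : pairs A \subset Kn n.
Proof. by apply/subsetP => e; rewrite !inE => /andP[]. Qed.

Lemma sum_nbrI_le G A : G \subset Kn n ->
  (\sum_(v in A) #|A :&: nbr G v| <= 2 * #|G :&: pairs A|)%N.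
Proof.
move=> GK; apply: (@leq_trans (\sum_(v in A) \sum_(e in G :&: pairs A) (v \in e))).
  apply: leq_sum => v vA.
  have inj : {in A :&: nbr G v &, injective (fun x => [set v; x])}.
    move=> x y; rewrite !in_setI => /andP[_ /(nbr_neq GK) vx] /andP[_ /(nbr_neq GK) vy].
    by case/set2_eq => -[] // e e'; rewrite e eqxx in vy.
  rewrite -(card_in_imset inj) -big_mkcondr sum1_card.
  apply: subset_leq_card; apply/subsetP => e /imsetP[x]; rewrite in_setI => /andP[xA vx] ->.
  rewrite unfold_in /= in_setI set21 andbT; move: (vx); rewrite inE => -> /=.
  by rewrite inE subUset !sub1set vA xA cards2 (nbr_neq GK vx).
rewrite exchange_big /= mulnC -sum_nat_const; apply: leq_sum => e.
rewrite in_setI inE => /andP[_ /andP[_ /eqP e2]].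
rewrite -[leqRHS]e2 -big_mkcondr sum1_card subset_leq_card //; apply/subsetP => v.
by rewrite unfold_in => /andP[].
Qed.

End Cross.

(** * Events of high probability in the dense regime *)

Section WithHighProbability.
Variable R : realType.

(* [7 / 5] may be any constant in (1, 3/2): above 1 the edges in few triangles form a matching,
   and below 3/2 some edge lies in no triangle. *)
Definition dense_regime (P : nat -> R -> Prop) := exists N, forall n p, (N <= n)%N -> 0 <= p <= 1 ->
  7 / 5 * ln n%:R <= n%:R * p ^+ 2 -> P n p.

Lemma dense_regimeW (P Q : nat -> R -> Prop) :
  (forall n p, P n p -> Q n p) -> dense_regime P -> dense_regime Q.
Proof. by move=> PQ [N h]; exists N => n p nN p01 pn; apply/PQ/h. Qed.

Lemma dense_regime_and (P Q : nat -> R -> Prop) :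
  dense_regime P -> dense_regime Q -> dense_regime (fun n p => P n p /\ Q n p).
Proof.
move=> [N h] [N' h']; exists (maxn N N') => n p; rewrite geq_max => /andP[nN nN'] p01 pn.
by split; [apply: h|apply: h'].
Qed.

Lemma dense_regime_p01 : dense_regime (fun n p => 0 <= p <= 1 /\ 7 / 5 * ln n%:R <= n%:R * p ^+ 2).
Proof. by exists 0%N. Qed.

Lemma ln_large (K : R) : exists N, forall n, (N <= n)%N -> K <= ln n%:R.
Proof.
have [N hN] : exists N : nat, expR K <= N%:R.
  exists (Num.truncn (expR K)).+1; apply/ltW; exact: truncnS_gt.
exists N => n nN; rewrite -[K]expRK ler_ln ?posrE ?expR_gt0 //.
  by apply: le_trans hN _; rewrite ler_nat.
by apply: lt_le_trans (expR_gt0 K) _; apply: le_trans hN _; rewrite ler_nat.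
Qed.

Lemma dense_regime_ln (K : R) : dense_regime (fun n p => K <= ln n%:R).
Proof. by have [N hN] := ln_large K; exists N => n p nN _ _; apply: hN. Qed.

Lemma dense_regime_n (K : R) : dense_regime (fun n p => K * ln n%:R <= n%:R).
Proof.
apply: dense_regimeW (dense_regime_ln (Num.max 1 (2 * K))) => n _.
rewrite ge_max => /andP[l1 lK].
have n0 : (0 : R) < n%:R.
  by rewrite ltNge; apply/negP => /ln0 h; rewrite h in l1; lra.
rewrite -[leRHS](lnK n0); have l0 : 0 <= ln n%:R :> R by lra.
have := expR_ge1Dxn 1 l0; set l := ln n%:R in l1 lK l0 * => h.
apply: le_trans h; rewrite (_ : 2`!%:R = 2) //; nra.
Qed.

(** The square of n p is n times n p^2, hence at least of order n ln n, which exceeds any multiple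
    of the square of ln n. *)
Lemma dense_regime_np (K : R) : dense_regime (fun n p => K * ln n%:R <= n%:R * p).
Proof.
have := dense_regime_and dense_regime_p01 (dense_regime_and (dense_regime_ln 1)
  (dense_regime_n (K ^+ 2))).
apply: dense_regimeW => n p [[/andP[p0 p1] pn] [l1 lK]].
set l := ln n%:R in pn l1 lK *; set x : R := n%:R in pn lK *.
have x0 : 0 <= x by apply: ler0n.
have [K0|K0] := leP K 0.
  by apply: (@le_trans _ _ 0); [nra|rewrite mulr_ge0].
have : (K * l) ^+ 2 <= (x * p) ^+ 2.
  rewrite !exprMn; apply: (@le_trans _ _ (x * l)).
    rewrite expr2 mulrA -expr2; nra.
  rewrite expr2 -mulrA ler_wpM2l //; nra.
rewrite ler_sqr // nnegrE mulr_ge0 //; lra.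
Qed.

(** The threshold hidden in [dense_regime] is common to all [p], as the maximum over [p] in the
    theorem requires. *)
Definition whp (E : forall n, R -> {set {set 'I_n}} -> Prop) := forall eps, 0 < eps ->
  dense_regime (fun n p => Pr_Gnp p (fun G => ~ E n p G) < eps).

Lemma Pr_GnpE n (p : R) (E : {set {set 'I_n}} -> Prop) :
  Pr_Gnp p E = Ex p (Kn n) (fun G => `[< E G >]%:R).
Proof.
rewrite /Pr_Gnp /Ex big_mkcondr; apply: eq_bigr => G _.
by case: `[< _ >]; rewrite ?mulr1 ?mulr0.
Qed.

Lemma Pr_Gnp_le_Ex n (p : R) (E : {set {set 'I_n}} -> Prop) (f : {set {set 'I_n}} -> R) :
  0 <= p <= 1 -> (forall G : {set {set 'I_n}}, G \subset Kn n -> 0 <= f G) ->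
  (forall G : {set {set 'I_n}}, G \subset Kn n -> E G -> 1 <= f G) -> Pr_Gnp p E <= Ex p (Kn n) f.
Proof.
move=> p01 f0 f1; rewrite Pr_GnpE.
by apply: (@Ex_markov _ _ _ p01 (Kn n) f (fun G => `[< E G >])) => // G GK /asboolP; apply: f1.
Qed.

Lemma Pr_Gnp_le n (p : R) (E E' : {set {set 'I_n}} -> Prop) : 0 <= p <= 1 ->
  (forall G : {set {set 'I_n}}, G \subset Kn n -> E G -> E' G) -> Pr_Gnp p E <= Pr_Gnp p E'.
Proof.
move=> p01 EE; rewrite !Pr_GnpE; apply: le_Ex => // G GK; rewrite ler_nat.
by case: asboolP => // /(EE _ GK) /asboolP ->.
Qed.

Lemma Pr_Gnp_or n (p : R) (E E' : {set {set 'I_n}} -> Prop) : 0 <= p <= 1 ->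
  Pr_Gnp p (fun G => E G \/ E' G) <= Pr_Gnp p E + Pr_Gnp p E'.
Proof.
move=> p01; rewrite !Pr_GnpE -ExD; apply: le_Ex => // G _; rewrite -natrD ler_nat.
by case: asboolP => // -[/asboolP->|/asboolP->]; rewrite ?addn1.
Qed.

Lemma whpW (E E' : forall n, R -> {set {set 'I_n}} -> Prop) :
  (forall n p (G : {set {set 'I_n}}), 0 <= p <= 1 -> G \subset Kn n -> E n p G -> E' n p G) -> whp E -> whp E'.
Proof.
move=> EE hE eps e0.
apply: dense_regimeW (dense_regime_and dense_regime_p01 (hE eps e0)) => n p [[p01 _]].
apply: le_lt_trans; apply: Pr_Gnp_le => // G GK nE EG; apply: nE; exact: EE.
Qed.

Lemma whp_and (E E' : forall n, R -> {set {set 'I_n}} -> Prop) :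
  whp E -> whp E' -> whp (fun n p G => E n p G /\ E' n p G).
Proof.
move=> hE hE' eps e0; have e20 : 0 < eps / 2 by lra.
have := dense_regime_and dense_regime_p01 (dense_regime_and (hE _ e20) (hE' _ e20)).
apply: dense_regimeW => n p [[p01 _] [h h']].
apply: (@le_lt_trans _ _ (Pr_Gnp p (fun G => ~ E n p G \/ ~ E' n p G))).
  apply: Pr_Gnp_le => // G _ nEE; apply: contrapT => /not_orP[/contrapT a /contrapT b].
  exact: nEE.
by apply: le_lt_trans (Pr_Gnp_or _ _ p01) _; lra.
Qed.

Lemma whp_regime (P : nat -> R -> Prop) (E : forall n, R -> {set {set 'I_n}} -> Prop) :
  dense_regime P -> whp (fun n p G => P n p -> E n p G) -> whp E.
Proof.
move=> hP hE eps e0; apply: dense_regimeW (dense_regime_and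
  (dense_regime_and dense_regime_p01 hP) (hE _ e0)) => n p [[[p01 _] Pnp]].
by apply: le_lt_trans; apply: Pr_Gnp_le => // G _ nE h; apply/nE/h.
Qed.

Lemma whp_expRM (C c : R) (E : forall n, R -> {set {set 'I_n}} -> Prop) : 0 < c ->
  dense_regime (fun n p => Pr_Gnp p (fun G => ~ E n p G) <= expR (C - c * ln n%:R)) -> whp E.
Proof.
move=> c0 hE eps e0.
apply: dense_regimeW (dense_regime_and hE (dense_regime_ln ((C - ln eps + 1) / c))) => n p [h].
rewrite ler_pdivrMr // mulrC => hn.
apply: le_lt_trans h _; rewrite -[ltRHS](lnK e0) ltr_expR; lra.
Qed.

Lemma whp_expR (C : R) (E : forall n, R -> {set {set 'I_n}} -> Prop) :
  dense_regime (fun n p => Pr_Gnp p (fun G => ~ E n p G) <= expR (C - ln n%:R)) -> whp E.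
Proof. by move=> hE; apply: (@whp_expRM C 1) => //; apply: dense_regimeW hE => n p; rewrite mul1r. Qed.

Lemma n_expR n : (0 < n)%N -> n%:R = expR (ln n%:R) :> R.
Proof. by move=> n0; rewrite lnK // posrE ltr0n. Qed.

Lemma whp_degree : whp (fun n p G => forall v, n%:R * p / 2 <= #|nbr G v|%:R).
Proof.
apply: (@whp_expR 1).
apply: dense_regimeW (dense_regime_and (dense_regime_and dense_regime_p01 (dense_regime_ln 1))
  (dense_regime_np 20)) => n p [[[p01 _] l1] hnp]; have /andP[p0 p1] := p01.
have n0 : (0 < n)%N by case: n l1 {hnp} => // h; rewrite ln0 // in h; lra.
apply: (@le_trans _ _ (Ex p (Kn n) (fun G =>
   \sum_(v : 'I_n) (#|G :&: cross [set v] (~: [set v])|%:R <= n%:R * p / 2)%R%:R))).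
  apply: Pr_Gnp_le_Ex => // [G _|G GK h]; first by apply: sumr_ge0 => v _; apply: ler0n.
  have [v hv] : exists v, #|nbr G v|%:R < n%:R * p / 2.
    apply: contrapT => /forallNP h'; apply: h => v; rewrite leNgt; apply/negP; exact: h'.
  rewrite (bigD1 v) //= -[leLHS]addr0 lerD ?sumr_ge0 //.
  rewrite -card_nbrI ?inE ?eqxx // (setIidPl _) ?(ltW hv) //.
  by apply/subsetP => x; rewrite !inE => vx; rewrite eq_sym (nbr_neq GK) // inE.
(* The gap between 3/5 and 1/2 leaves about exp(- n p / 10) per vertex; n p at least 20 ln n makes
   this small enough for the union over [v]. *)
rewrite Ex_sum; apply: (@le_trans _ _ (\sum_(v : 'I_n) expR (n%:R * p / 2 - 3 / 5 * p * (n%:R - 1)))).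
  apply: ler_sum => v _; apply: le_trans (lower_tail p01 _ _) _.
    by apply: cross_Kn; rewrite disjoints1 // !inE eqxx.
  rewrite card_cross; last by rewrite disjoints1 // !inE eqxx.
  by rewrite cards1 mul1n cardsC1 card_ord -subn1 natrB.
rewrite sumr_const card_ord -[leLHS]mulr_natl [X in X * _](n_expR n0) -expRD ler_expR.
move: hnp; set l := ln _; set x : R := n%:R => hnp; nra.
Qed.

End WithHighProbability.

Lemma nat_gt0_ln (R : realType) n : 0 < ln n%:R :> R -> (0 < n)%N.
Proof. by case: n => // h; rewrite ln0 // ltxx in h. Qed.

(* The union bound over [A] is summed as [\sum_A x ^+ #|A| = (1 + x) ^+ n]. *)
Lemma whp_sparse (R : realType) (k : R) (m u : nat -> R -> R) : 0 < k ->
  dense_regime (fun n p => 7 / 5 * ln n%:R <= u n p /\ p * m n p <= expR (- (8 / k)) * u n p) ->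
  whp (fun n p G => sparse_subsets G (m n p) k (u n p)).
Proof.
move=> k0 hmu; apply: (@whp_expR _ 1).
apply: dense_regimeW (dense_regime_and (dense_regime_and (dense_regime_p01 R)
  (dense_regime_ln 1)) hmu) => n p [[[p01 _] l1] [hu hm]]; have /andP[p0 p1] := p01.
have n0 : (0 < n)%N by apply: (@nat_gt0_ln R); lra.
move: (u n p) (m n p) hu hm => {hmu}u {}m hu hm.
pose x : R := expR (- (3 * u)).
apply: (@le_trans _ _ (Ex p (Kn n) (fun G => \sum_(A : {set 'I_n} | (A != set0) && (#|A|%:R <= m))
   (k * #|A|%:R * u / 2 <= #|G :&: pairs A|%:R)%R%:R))).
  apply: Pr_Gnp_le_Ex => // [G _|G GK]; first by apply: sumr_ge0 => A _; apply: ler0n.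
  move=> /existsNP[A] /not_implyP[Am] /negP; rewrite -ltNge => hA.
  have A0 : A != set0 by apply: contraTneq hA => ->; rewrite cards0 big_set0 mulr0 mul0r ltxx.
  rewrite (bigD1 A) ?A0 //= -[leLHS]addr0 lerD ?sumr_ge0 //.
  have := sum_nbrI_le A GK; rewrite -(ler_nat R) natr_sum natrM => hA2.
  suff -> : k * #|A|%:R * u / 2 <= #|G :&: pairs A|%:R by [].
  lra.
rewrite Ex_sum; apply: (@le_trans _ _ (\sum_(A : {set 'I_n} | (A != set0)) x ^+ #|A|)).
  rewrite [leRHS](bigID (fun A : {set 'I_n} => #|A|%:R <= m)) /=.
  rewrite -[leLHS]addr0; apply: lerD; last first.
    by apply: sumr_ge0 => A _; rewrite exprn_ge0 ?expR_ge0.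
  apply: ler_sum => A /andP[A0 Am].
  (* With [s = 8 / k] the threshold contributes -4 |A| u to the exponent, while the hypothesis on
     [m] bounds the mean term by |A| u. The difference is [x ^+ #|A|]. *)
  have s0 : 0 <= 8 / k by rewrite divr_ge0 // ltW.
  apply: le_trans (upper_tail_gen p01 _ _ _ s0) _.
  rewrite /x -expRM_natl ler_expR.
  have hP : #|pairs A|%:R <= #|A|%:R * #|A|%:R :> R.
    by rewrite -natrM ler_nat card_pairs bin2 leq_half_double; nia.
  have -> : 8 / k * (k * #|A|%:R * u / 2) = 4 * (#|A|%:R * u) by field; rewrite gt_eqF.
  have : p * expR (8 / k) * #|pairs A|%:R <= #|A|%:R * u.
    apply: (@le_trans _ _ (p * expR (8 / k) * (#|A|%:R * m))).
      rewrite ler_wpM2l ?mulr_ge0 ?expR_ge0 //.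
      by apply: le_trans hP _; rewrite ler_wpM2l.
    have -> : p * expR (8 / k) * (#|A|%:R * m) = #|A|%:R * (expR (8 / k) * (p * m)) by ring.
    rewrite ler_wpM2l //; apply: (@le_trans _ _ (expR (8 / k) * (expR (- (8 / k)) * u))).
      by rewrite ler_wpM2l ?expR_ge0.
    by rewrite mulrA -expRD subrr expR0 mul1r.
  lra.
(* The empty set cannot violate sparsity; leaving it out removes the term 1 and makes the sum tend
   to 0. *)
have -> : \sum_(A : {set 'I_n} | (A != set0)) x ^+ #|A| = (1 + x) ^+ n - 1.
  have := sum_pow_card 'I_n x; rewrite card_ord => <-.
  by rewrite [in RHS](bigD1 set0) //= cards0 expr0 [RHS]addrAC subrr add0r.
have x0 : 0 <= x by apply: expR_ge0.
have hx : n%:R * x <= expR (- (ln n%:R + 1)).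
  by rewrite {1}(n_expR R n0) /x -expRD ler_expR; lra.
have hs : expR (- (ln n%:R + 1)) <= 1 / 4 :> R.
  apply: (@le_trans _ _ (expR (- 1) * expR (- 1))); first by rewrite -expRD ler_expR; lra.
  by have := expRN1_le R; have := expR_ge0 (-1 : R); nra.
have h1 : (1 + x) ^+ n <= expR (n%:R * x) by apply: exprn_le_expR; lra.
(* For y at most 1/4 this yields exp y <= 1 + 2 y, so the whole sum is at most 2 n x. *)
have h2 : expR (n%:R * x) * (1 - n%:R * x) <= 1.
  have := expR_ge1Dx (- (n%:R * x)); rewrite -[leRHS](mulKf (lt0r_neq0 (expR_gt0 (n%:R * x)))).
  rewrite -expRD subrr expR0 mulr1 => h.
  by have := ler_wpM2l (expR_ge0 (n%:R * x)) h; rewrite divff ?gt_eqF ?expR_gt0.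
have hx0 : 0 <= n%:R * x by rewrite mulr_ge0.
have e1 : expR (1 - ln n%:R) >= 2 * expR (- (ln n%:R + 1)) :> R.
  rewrite (_ : 1 - ln n%:R = 2%:R * 1 + - (ln n%:R + 1)); last by ring.
  rewrite expRD ler_wpM2r ?expR_ge0 // expRM_natl; have := expR1_ge R; nra.
move: h1 h2; set y := n%:R * x in hx hx0 *; set E := expR y; set z := _ ^+ n => h1 h2.
have : E <= 1 + 2 * y by nra.
lra.
Qed.

(* The event [A :|: B \subset nbr G v] has probability [p ^+ (#|A| + #|B|)] and is independent of the
   edges between [A] and [B], so the union bound over [A] and [B] costs only [(1 + p) ^+ (2 * n)]. *)
Lemma whp_link_expansion (R : realType) (gam : R) : 0 < gam ->
  whp (fun n p G => link_expansion G (n%:R * p) (n%:R * p ^+ 2) gam).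
Proof.
move=> g0; apply: (@whp_expR _ 0).
apply: dense_regimeW (dense_regime_and (dense_regime_and (dense_regime_p01 R)
  (dense_regime_ln (Num.max 1 (240 / gam)))) (dense_regime_np 2)) => n p [[[p01 hL] l1] hnp].
have /andP[p0 p1] := p01; move: l1; rewrite ge_max => /andP[l1 lg].
have n0 : (0 < n)%N by apply: (@nat_gt0_ln R); lra.
set D := n%:R * p in hnp *; set L := n%:R * p ^+ 2 in hL *.
have LE : L = D * p by rewrite /L /D expr2 mulrA.
pose ok (v : 'I_n) (A B : {set 'I_n}) := [&& v \notin A :|: B, [disjoint A & B],
  gam * D / 2 <= #|A|%:R & D / 4 <= #|B|%:R].
pose f (v : 'I_n) (A B : {set 'I_n}) (G : {set {set 'I_n}}) : R :=
  (cross [set v] (A :|: B) \subset G)%:R * (#|G :&: cross A B|%:R <= #|A|%:R * L / 8)%R%:R.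
apply: (@le_trans _ _ (Ex p (Kn n) (fun G =>
   \sum_(v : 'I_n) \sum_(A : {set 'I_n}) \sum_(B : {set 'I_n} | ok v A B) f v A B G))).
  have f0 v A B G : 0 <= f v A B G by rewrite mulr_ge0.
  apply: Pr_Gnp_le_Ex => // [G _|G GK].
    by apply: sumr_ge0 => v _; apply: sumr_ge0 => A _; apply: sumr_ge0.
  move=> /existsNP[v] /existsNP[A] /existsNP[B] /not_implyP[AN] /not_implyP[BN].
  move=> /not_implyP[dAB] /not_implyP[cA] /not_implyP[cB] /negP; rewrite -ltNge => hAB.
  rewrite (bigD1 v) //= -[leLHS]addr0; apply: lerD.
  - rewrite (bigD1 A) //= -[leLHS]addr0 lerD //; last first.
      by apply: sumr_ge0 => A' _; apply: sumr_ge0.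
    have ABN : A :|: B \subset nbr G v by rewrite subUset AN.
    have okv : ok v A B.
      apply/and4P; split=> //.
      by apply: contra (nbr_irr GK v); apply: (subsetP ABN).
    rewrite (bigD1 B) //= -[leLHS]addr0 lerD //; last exact: sumr_ge0.
    rewrite /f (_ : cross _ _ \subset G); last first.
      apply/subsetP => e /crossP[a [b [/set1P-> bAB ->]]].
      by have := subsetP ABN b bAB; rewrite inE.
    by rewrite -sum_cross // natr_sum (ltW hAB) mulr1.
  - by apply: sumr_ge0 => v' _; apply: sumr_ge0 => A' _; apply: sumr_ge0.
rewrite Ex_sum; apply: (@le_trans _ _ (\sum_(v : 'I_n) \sum_(A : {set 'I_n}) \sum_(B : {set 'I_n})
   p ^+ #|A| * p ^+ #|B| * expR (- (gam * D * L / 80)))).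
  apply: ler_sum => v _; rewrite Ex_sum; apply: ler_sum => A _; rewrite Ex_sum.
  rewrite big_mkcond; apply: ler_sum => B _; case: ifP => [|_]; last first.
    by rewrite !mulr_ge0 ?exprn_ge0 ?expR_ge0.
  case/and4P => vAB dAB cA cB.
  have dv : [disjoint [set v] & A :|: B] by rewrite disjoints1.
  rewrite /f (Ex_indep _ _ (D1 := cross [set v] (A :|: B)) (D2 := cross A B)).
  - rewrite Ex_subset ?cross_Kn // card_cross // cards1 mul1n cardsU disjoint_setI0 // cards0 subn0 exprD.
    rewrite ler_wpM2l ?mulr_ge0 ?exprn_ge0 //.
    apply: le_trans (lower_tail p01 _ (cross_Kn dAB)) _.
    rewrite ler_expR card_cross // natrM.
    (* The exponent is at most |A| L (1/8 - 3/20) = - |A| L / 40, and |A| is at least gam D / 2. *)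
    have hb : L / 4 <= p * #|B|%:R by rewrite LE; nra.
    have L0 : 0 <= L by rewrite LE !mulr_ge0.
    have : #|A|%:R * (L / 4) <= #|A|%:R * (p * #|B|%:R) by rewrite ler_wpM2l.
    have : gam * D / 2 * L <= #|A|%:R * L by rewrite ler_wpM2r.
    by lra.
  - rewrite -setI_eq0; apply/eqP/setP => e; rewrite in_setI in_set0; apply/negP => /andP[].
    move=> /crossP[a [b [/set1P-> bAB ->]]] /crossP[a' [b' [aA bB]]] /set2_eq[] [e1 e2].
      by case/negP: vAB; rewrite e1 inE aA.
    by case/negP: vAB; rewrite e1 inE bB orbT.
  - by move=> G; rewrite subsetI subxx andbT.
  - by move=> G; rewrite -setIA setIid.
have -> : \sum_(v : 'I_n) \sum_(A : {set 'I_n}) \sum_(B : {set 'I_n})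
   p ^+ #|A| * p ^+ #|B| * expR (- (gam * D * L / 80)) =
   n%:R * ((1 + p) ^+ n * (1 + p) ^+ n * expR (- (gam * D * L / 80))).
  rewrite sumr_const card_ord -[LHS]mulr_natl; congr (_ * _).
  have <- : \sum_(A : {set 'I_n}) p ^+ #|A| = (1 + p) ^+ n by rewrite sum_pow_card card_ord.
  rewrite -[RHS]mulrA [RHS]mulr_suml; apply: eq_bigr => A _.
  by rewrite mulr_suml mulr_sumr; apply: eq_bigr => B _; rewrite mulrA.
have hp : (1 + p) ^+ n <= expR D by apply: exprn_le_expR; lra.
have hp0 : 0 <= (1 + p) ^+ n by rewrite exprn_ge0 //; lra.
rewrite {1}(n_expR R n0).
apply: (@le_trans _ _ (expR (ln n%:R) * (expR D * expR D * expR (- (gam * D * L / 80))))).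
  rewrite ler_wpM2l ?expR_ge0 // ler_wpM2r ?expR_ge0 //.
  by rewrite ler_pM.
rewrite -!expRD ler_expR.
(* The constant 240 makes the gain at least 3 D: 2 D pays for the choices of [A] and [B], and the
   remaining D, at least 2 ln n, for the choice of [v] and the final bound. *)
have h3 : 240 <= gam * L.
  have : 240 / gam <= L by lra.
  by rewrite ler_pdivrMr // mulrC.
have D0 : 0 <= D by rewrite mulr_ge0.
have := ler_wpM2l D0 h3; lra.
Qed.

(** * Stars, codegrees, and edges in few triangles *)

Section Blocks.
Variables (R : realType) (n : nat).
Implicit Types (x y z w : 'I_n) (U V : {set 'I_n}) (G : {set {set 'I_n}}).

Lemma cross1P U w e : reflect (exists2 u, u \in U & e = [set u; w]) (e \in cross U [set w]).
Proof.
apply: (iffP (crossP _ _ _)) => [[a [b [aU /set1P-> ->]]]|[u uU ->]]; first by exists a.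
by exists u, w; rewrite uU set11.
Qed.

Lemma disjoint_cross1 U V w w' : w \notin V -> w' \notin U -> w != w' ->
  [disjoint cross U [set w] & cross V [set w']].
Proof.
move=> wV w'U ww'; rewrite -setI_eq0; apply/eqP/setP => e; rewrite in_setI in_set0.
apply/negP => /andP[/cross1P[u uU ->] /cross1P[v vV]] /set2_eq[] [e1 e2].
  by rewrite e2 eqxx in ww'.
by rewrite -e1 uU in w'U.
Qed.

Lemma cross1_Kn U w : w \notin U -> cross U [set w] \subset Kn n.
Proof. by move=> wU; apply: cross_Kn; rewrite disjoint_sym disjoints1. Qed.

Lemma card_cross1 U w : w \notin U -> #|cross U [set w]| = #|U|.
Proof. by move=> wU; rewrite card_cross ?cards1 ?muln1 // disjoint_sym disjoints1. Qed.

Lemma set2_cross1 x U w : x \notin U -> w != x -> [set x; w] \notin cross U [set w].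
Proof.
move=> xU wx; apply/cross1P => -[u uU] /set2_eq[] [e1 e2]; first by rewrite e1 uU in xU.
by rewrite e1 eqxx in wx.
Qed.

Lemma setU_cross1 x U w : [set x; w] |: cross U [set w] = cross (x |: U) [set w].
Proof.
apply/setP => e; rewrite in_setU1; apply/orP/cross1P => [[/eqP->|/cross1P[u uU ->]]|[u]].
- by exists x; rewrite ?setU11.
- by exists u => //; rewrite inE uU orbT.
by rewrite in_setU1 => /orP[/eqP->|uU] ->; [left|right; apply/cross1P; exists u].
Qed.

(** The product over [w] is [t] to the number of edges between [U] and the neighbours [w] of [x],
    that is, to the sum of the codegrees of [x] with [U], up to the range of [w]. Different [w]
    outside [x |: U] use disjoint edge sets, so the expectation factorises. *)
Definition star_weight (t : R) x U w (G : {set {set 'I_n}}) : R :=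
  if [set x; w] \in G then t ^+ #|G :&: cross U [set w]| else 1.

Lemma Ex_star_weight (p t : R) x U (J : {set 'I_n}) : x \notin U -> [disjoint J & x |: U] ->
  Ex p (Kn n) (fun G => \prod_(w in J) star_weight t x U w G) =
  (1 - p + p * (1 - p + p * t) ^+ #|U|) ^+ #|J|.
Proof.
move=> xU dJ.
have hJ w : w \in J -> w \notin U /\ w != x.
  by move=> /(disjointFr dJ); rewrite in_setU1 => /negbT; rewrite negb_or => /andP[].
apply: Ex_blocks => [w wJ|w w' wJ w'J ww'].
  have [wU wx] := hJ _ wJ; split; rewrite ?card_cross1 ?cross1_Kn ?set2_cross1 //.
  by rewrite inE cards2 [x == w]eq_sym (negPf wx).
have := hJ _ wJ; have := hJ _ w'J => -[w'U w'x] [wU wx].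
by rewrite !setU_cross1; apply: disjoint_cross1; rewrite // in_setU1 negb_or ?w'x ?wx.
Qed.

Lemma star_weight_dep (t : R) x U w : depends_on (cross (x |: U) [set w]) (star_weight t x U w).
Proof.
move=> G; rewrite /star_weight -setU_cross1 !inE eqxx andbT -setIA.
by rewrite (setIidPr (subsetUr _ _)).
Qed.

Lemma prod_star_weight_dep (t : R) x U (J : {set 'I_n}) (D : {set {set 'I_n}}) :
  (forall w, w \in J -> cross (x |: U) [set w] \subset D) ->
  depends_on D (fun G => \prod_(w in J) star_weight t x U w G).
Proof.
move=> hD G /=; apply: eq_bigr => w wJ; apply: (depends_onS (hD _ wJ)); exact: star_weight_dep.
Qed.

End Blocks.

(** Exponential Markov inequality for the sum of two codegrees. Leaving [x], [y], [z] out of the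
    product can only lower the count. *)
Lemma prod_low_weight (R : realType) n (G : {set {set 'I_n}}) (x y z : 'I_n) (s m : R) :
  0 <= s -> (codeg G x y)%:R + (codeg G x z)%:R <= m ->
  1 <= expR (s * m) * \prod_(w in ~: [set x; y; z]) star_weight (expR (- s)) x [set y; z] w G.
Proof.
move=> s0 hm; set J := ~: _.
have -> : \prod_(w in J) star_weight (expR (- s)) x [set y; z] w G =
    expR (- s) ^+ (\sum_(w in J | [set x; w] \in G) #|G :&: cross [set y; z] [set w]|).
  by rewrite -prodrXr big_mkcondr.
rewrite -expRM_natl -expRD -[leLHS]expR0 ler_expR mulrN mulrC -mulrBl mulr_ge0 // subr_ge0.
apply: le_trans hm; rewrite -natrD ler_nat.
apply: (@leq_trans (\sum_(w in J | [set x; w] \in G) ((w \in nbr G y) + (w \in nbr G z)))).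
  apply: leq_sum => w _.
  apply: (@leq_trans #|(if w \in nbr G y then [set [set y; w]] else set0) :|:
                       (if w \in nbr G z then [set [set z; w]] else set0)|).
    apply: subset_leq_card; apply/subsetP => e; rewrite in_setI => /andP[eG /cross1P[u]].
    by rewrite !inE => /orP[]/eqP-> eE; rewrite -?eE eG inE eE eqxx ?orbT.
  by apply: leq_trans (leq_card_setU _ _) _; apply: leq_add; case: ifP; rewrite ?cards1 ?cards0.
rewrite big_split /=; apply: leq_add; rewrite -big_mkcondr sum1_card; apply: subset_leq_card;
  by apply/subsetP => w; rewrite unfold_in /= !inE => /andP[/andP[_ ->] ->].
Qed.

(** With t = exp(-2), one vertex [w] contributes 1 - p^2 (1 - t) (2 - p (1 - t)). The constant 21/25
    is a lower bound for 1 - t, and 2 - p reflects the star at [x] that both codegrees share. *)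
Lemma low_pair_bound (R : realType) n (p : R) (x y z : 'I_n) (m : R) : 0 <= p <= 1 ->
  x != y -> x != z -> y != z ->
  Ex p (Kn n) (fun G => ([set [set x; y]; [set x; z]] \subset G)%:R *
     (expR (2 * m) * \prod_(w in ~: [set x; y; z]) star_weight (expR (- 2)) x [set y; z] w G)) <=
  p ^+ 2 * expR (2 * m - 21 / 25 * (2 - p) * p ^+ 2 * (n%:R - 3)).
Proof.
move=> p01 xy xz yz; have /andP[p0 p1] := p01.
have xU : x \notin [set y; z] by rewrite !inE negb_or xy xz.
have dJ : [disjoint ~: [set x; y; z] & x |: [set y; z]].
  by rewrite setUA disjoint_sym -subsets_disjoint.
have yzN : [set x; y] != [set x; z].
  by apply/eqP => /set2_eq[] [e1 e2]; [rewrite e2 eqxx in yz | rewrite e1 eqxx in xz].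
have hS : [set [set x; y]; [set x; z]] \subset Kn n.
  by rewrite subUset !sub1set !inE !cards2 xy xz.
rewrite (Ex_indep _ _ (D1 := [set [set x; y]; [set x; z]])
   (D2 := \bigcup_(w in ~: [set x; y; z]) cross (x |: [set y; z]) [set w])).
- rewrite Ex_subset // cards2 yzN ler_wpM2l ?exprn_ge0 // ExZ Ex_star_weight // expRD.
  rewrite ler_wpM2l ?expR_ge0 // cards2 yz.
  have -> : #|~: [set x; y; z]| = (n - 3)%N.
    by rewrite cardsCs setCK card_ord -setUA cardsU1 cards2 xU yz.
  have n3 : (3 <= n)%N.
    rewrite -[n in (_ <= n)%N]card_ord (_ : 3 = #|x |: [set y; z]|)%N ?max_card //.
    by rewrite cardsU1 cards2 xU yz.
  have t1 : expR (- 2) <= 4 / 25 :> R.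
    rewrite (_ : -2 = -1 + -1); last by ring.
    rewrite expRD; have := expRN1_le R; have := expR_ge0 (-1 : R); nra.
  have t0 := expR_ge0 (-2 : R); move: (expR (-2) : R) t0 t1 => t t0 t1.
  set c := 21 / 25 * (2 - p) * p ^+ 2.
  have c1 : c <= 1.
    have h1 : (2 - p) * p <= 1 by have := sqr_ge0 (1 - p); rewrite expr2; nra.
    have : (2 - p) * p * p <= 1 by nra.
    by rewrite /c expr2; lra.
  apply: (@le_trans _ _ ((1 + - c) ^+ (n - 3))).
    have q0 : 0 <= 1 - p + p * t by nra.
    rewrite lerXn2r ?nnegrE //; [|by lra|].
      by rewrite addr_ge0 ?subr_ge0 // mulr_ge0 // exprn_ge0.
    have -> : 1 - p + p * (1 - p + p * t) ^+ 2 = 1 - p ^+ 2 * ((1 - t) * (2 - p * (1 - t))) by ring.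
    rewrite /c [_ * p ^+ 2]mulrC lerD2l lerN2 ler_wpM2l ?sqr_ge0 //; nra.
  apply: le_trans (exprn_le_expR _ _) _; first lra.
  by rewrite ler_expR natrB // mulrN mulrC.
- apply/bigcup_disjointP => w; rewrite setUA in_setC => wxyz.
  rewrite -setI_eq0; apply/eqP/setP => e; rewrite in_setI in_set0; apply/negP => /andP[].
  rewrite !inE => eE /cross1P[u uU eE']; case/negP: wxyz; move: eE; rewrite eE' !inE.
  by case/orP => /eqP/set2_eq[] [e1 e2]; rewrite e2 eqxx ?orbT.
- by move=> G; rewrite subsetI subxx andbT.
- move=> G /=; congr (_ * _); apply: prod_star_weight_dep => w wJ.
  exact: (bigcup_sup w).
Qed.

(** A first moment over n^3 p^2 = n^2 L adjacent pairs of edges. Each pair is low with probability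
    about exp(-2 L) up to the losses in the constants, so [L] must exceed ln n by a constant
    factor. *)
Lemma whp_isolated_low (R : realType) :
  whp (fun n (p : R) G => isolated_low_edges G (n%:R * p ^+ 2)).
Proof.
apply: (@whp_expRM _ (ln 10 + 10) (1 / 10)); first lra.
apply: dense_regimeW (dense_regime_and (dense_regime_and (dense_regime_p01 R)
  (dense_regime_ln 1)) (dense_regime_np 1000)) => n p [[[p01 hL] l1] hnp].
have /andP[p0 p1] := p01.
have n0 : (0 < n)%N by apply: (@nat_gt0_ln R); lra.
set L := n%:R * p ^+ 2 in hL *; set l := ln _ in hL l1 hnp *.
pose ok (q : 'I_n * 'I_n * 'I_n) := [&& q.1.1 != q.1.2, q.1.1 != q.2 & q.1.2 != q.2].
pose f (q : 'I_n * 'I_n * 'I_n) (G : {set {set 'I_n}}) : R :=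
  ([set [set q.1.1; q.1.2]; [set q.1.1; q.2]] \subset G)%:R *
     (expR (2 * (2 * (1 / 100 * L))) *
      \prod_(w in ~: [set q.1.1; q.1.2; q.2]) star_weight (expR (- 2)) q.1.1 [set q.1.2; q.2] w G).
have f0 q G : 0 <= f q G.
  rewrite !mulr_ge0 ?expR_ge0 //; apply: prodr_ge0 => w _; rewrite /star_weight.
  by case: ifP => //; rewrite exprn_ge0 ?expR_ge0.
apply: (@le_trans _ _ (Ex p (Kn n) (fun G => \sum_(q | ok q) f q G))).
  apply: Pr_Gnp_le_Ex => // [G _|G GK]; first exact: sumr_ge0.
  move=> /existsNP[x] /existsNP[y] /existsNP[z] /not_implyP[xy] /not_implyP[xz] /not_implyP[yz].
  move=> /not_implyP[lxy] /not_implyP[lxz] _.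
  rewrite (bigD1 (x, y, z)) /=; last by rewrite /ok /= (nbr_neq GK xy) (nbr_neq GK xz).
  rewrite -[leLHS]addr0; apply: lerD; last exact: sumr_ge0.
  rewrite /f /= (_ : _ \subset _); last first.
    by rewrite subUset !sub1set; move: xy xz; rewrite !inE => -> ->.
  by rewrite [true%:R * _]mul1r; apply: prod_low_weight => //; lra.
rewrite Ex_sum; set B := p ^+ 2 * expR (2 * (2 * (1 / 100 * L)) - 21 / 25 * (2 - p) * p ^+ 2 * (n%:R - 3)).
apply: (@le_trans _ _ (\sum_(q : 'I_n * 'I_n * 'I_n) B)).
  rewrite big_mkcond; apply: ler_sum => -[[x y] z] _; case: ifP => [/and3P[]|_].
    by move=> *; apply: low_pair_bound.
  by rewrite mulr_ge0 ?sqr_ge0 ?expR_ge0.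
rewrite sumr_const !card_prod card_ord -[leLHS]mulr_natl !natrM.
have -> : n%:R * n%:R * n%:R * B = n%:R * n%:R * (L * expR (2 * (2 * (1 / 100 * L)) -
    21 / 25 * (2 - p) * p ^+ 2 * (n%:R - 3))) by rewrite /B /L; ring.
(* The factor [L] of n^2 L is absorbed at the cost of L / 10 in the exponent. *)
have hLe : L <= 10 * expR (1 / 10 * L).
  by have := expR_ge1Dx (1 / 10 * L); lra.
apply: (@le_trans _ _ (expR l * expR l * (10 * expR (1 / 10 * L) * expR (2 * (2 * (1 / 100 * L)) -
    21 / 25 * (2 - p) * p ^+ 2 * (n%:R - 3))))).
  rewrite -(n_expR R n0) ler_wpM2l ?mulr_ge0 // ler_wpM2r ?expR_ge0 //.
have e10 : expR (ln 10) = 10 :> R by rewrite lnK // posrE.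
rewrite -[X in _ * (X * _ * _)]e10.
rewrite -!expRD ler_expR.
have -> : 21 / 25 * (2 - p) * p ^+ 2 * (n%:R - 3) = 21 / 25 * (2 - p) * (L - 3 * p ^+ 2).
  by rewrite /L; ring.
have p2 : p ^+ 2 <= 1 by rewrite expr2; nra.
have p20 : 0 <= p ^+ 2 by apply: sqr_ge0.
have L0 : 0 <= L by rewrite mulr_ge0.
have -> : 21 / 25 * (2 - p) * (L - 3 * p ^+ 2) = 21 / 25 * ((2 - p) * L) - 63 / 25 * ((2 - p) * p ^+ 2).
  by ring.
have hB : (2 - p) * p ^+ 2 <= 2.
  apply: (@le_trans _ _ (2 * p ^+ 2)); first by rewrite ler_wpM2r //; lra.
  lra.
(* For small p the net exponent exceeds (21/25 * 199/100 - 4/100 - 1/10) L > 1.53 L, hence 2.1 ln n.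
   For larger p the factor 2 - p may drop to 1, but then L = (n p) p is at least 10 ln n. *)
have [ps|pb] := leP p (1 / 100).
  have : 199 / 100 * L <= (2 - p) * L by rewrite ler_wpM2r //; lra.
  lra.
have : 10 * l <= L.
  have : n%:R * p * (1 / 100) <= n%:R * p * p by rewrite ler_wpM2l ?mulr_ge0 //; lra.
  by rewrite /L expr2 mulrA; lra.
have : 1 * L <= (2 - p) * L by rewrite ler_wpM2r //; lra.
lra.
Qed.

(** * Odd triangles *)

Lemma card_le_fibers (I J : finType) (h : I -> J) (A : {set I}) (c : nat) :
  (forall i, i \in A -> #|[set j in A | h j == h i]| <= c)%N -> (#|A| <= c * #|h @: A|)%N.
Proof.
move=> hc; rewrite -sum1_card (partition_big_imset h) /= mulnC -sum_nat_const.
apply: leq_sum => j /imsetP[i iA ->]; rewrite sum1_card.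
apply: leq_trans (hc i iA); apply: subset_leq_card; apply/subsetP => x.
by rewrite unfold_in inE.
Qed.

(* A subfamily maximal subject to the degree cap: every discarded member contains a saturated point. *)
Lemma capped_subfamily (T : finType) (O : {set {set T}}) (c d : nat) : (0 < c)%N ->
  (forall D, D \in O -> #|D| = 3%N) -> (forall e, #|[set D in O | e \in D]| <= d)%N ->
  exists B : {set {set T}}, [/\ B \subset O, forall e, (#|[set D in B | e \in D]| <= c)%N
    & (#|O| * c <= #|B| * (c + 3 * d))%N].
Proof.
move=> c0 O3 Od.
pose P (B : {set {set T}}) := (B \subset O) && [forall e, (#|[set D in B | e \in D]| <= c)%N].
have P0 : exists B, P B.
  exists set0; rewrite /P sub0set; apply/forallP => e.
  by rewrite eq_card0 // => D; rewrite !inE.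
have [B /maxsetP[/andP[BO /forallP Bc] Bmax]] := ex_maxset P0.
exists B; split=> //.
pose Sat := [set e | #|[set D in B | e \in D]| == c].
have sumB : (\sum_e #|[set D in B | e \in D]| = 3 * #|B|)%N.
  under eq_bigr do rewrite -sum1_card big_mkcond.
  rewrite exchange_big /= mulnC -sum_nat_const [RHS]big_mkcond; apply: eq_bigr => D _.
  case: ifP => DB; last by apply: big1 => e _; rewrite inE DB.
  rewrite -(O3 D) ?(subsetP BO) // -sum1_card [RHS]big_mkcond; apply: eq_bigr => e _.
  by rewrite inE DB.
have SatB : (#|Sat| * c <= 3 * #|B|)%N.
  rewrite -sumB -sum_nat_const (bigID (mem Sat) predT) /= -[leqLHS]addn0 leq_add //.
  by apply: leq_sum => e; rewrite inE => /eqP->.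
have cover : O \subset B :|: \bigcup_(e in Sat) [set D in O | e \in D].
  apply/subsetP => D DO; rewrite inE; case: (boolP (D \in B)) => //= DB.
  have [/exists_inP[e eS eD]|/exists_inPn nS] := boolP [exists e in Sat, e \in D].
    by apply/bigcupP; exists e => //; rewrite inE DO.
  have PB : P (D |: B).
    rewrite /P subUset sub1set DO BO; apply/forallP => e.
    have : [set D' in D |: B | e \in D'] \subset
        (if e \in D then [set D] else set0) :|: [set D' in B | e \in D'].
      apply/subsetP => D'; rewrite !inE => /andP[/orP[/eqP->|->] eD']; first by rewrite eD' inE eqxx.
      by rewrite eD' orbT.
    move/subset_leq_card/leq_trans; apply; apply: leq_trans (leq_card_setU _ _) _.
    case: ifP => eD; last by rewrite cards0 add0n.
    rewrite cards1 add1n ltn_neqAle Bc andbT.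
    by have := nS e; rewrite inE eD; case: (_ == c) => // /(_ isT).
  have /setP /(_ D) := Bmax _ PB (subsetUr _ _).
  by rewrite setU11 (negPf DB).
have : (#|O| <= #|B| + #|Sat| * d)%N.
  apply: leq_trans (subset_leq_card cover) _; apply: leq_trans (leq_card_setU _ _) _.
  rewrite leq_add2l -sum_nat_const.
  apply: (@leq_trans (\sum_(e in Sat) #|[set D in O | e \in D]|)); last exact: leq_sum.
  apply: (big_ind2 (fun (A : {set {set T}}) m => #|A| <= m)%N) => //; first by rewrite cards0.
  by move=> A1 m1 A2 m2 h1 h2; apply: leq_trans (leq_card_setU _ _) (leq_add h1 h2).
move: SatB; move: #|O| #|B| #|Sat| => o b s hs ho; nia.
Qed.

Section Triples.
Variable n : nat.
Implicit Types (A B : {set 'I_n}).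

Lemma pairsI A B : pairs A :&: pairs B = pairs (A :&: B).
Proof. by apply/setP => e; rewrite !inE subsetI; case: (_ == 2)%N; rewrite ?andbF ?andbT. Qed.

Lemma card_pairsI A B : #|A| = 3 -> #|B| = 3 -> A != B -> (#|pairs A :&: pairs B| <= 1)%N.
Proof.
move=> A3 B3 AB; rewrite pairsI card_pairs.
have : (#|A :&: B| < 3)%N.
  rewrite ltnNge; apply: contra AB => h.
  have /eqP e : A :&: B == A by rewrite eqEcard subsetIl A3.
  by rewrite eqEcard A3 B3 leqnn andbT -e subsetIr.
by case: #|_| => [|[|[|]]].
Qed.

Lemma pairs_inj A B : #|A| = 3 -> #|B| = 3 -> pairs A = pairs B -> A = B.
Proof.
move=> A3 B3 AB; apply/eqP; apply: contraT => /(card_pairsI A3 B3).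
by rewrite AB setIid card_pairs B3.
Qed.

Lemma set3_card (x y z : 'I_n) : x != y -> x != z -> y != z -> #|[set x; y; z]| = 3.
Proof. by move=> xy xz yz; rewrite -setUA cardsU1 cards2 !inE negb_or xy xz yz. Qed.

Lemma triangles_janson_arith (R : realType) (eps p X Y c q : R) :
  eps * (Y * p * 1) <= eps * (Y * p * (6 * c * X)) ->
  eps * Y * c * (X * p) <= 5 * q * (X * p) ->
  eps / 60 * Y * p <= q * (X * p / 2).
Proof.
rewrite (_ : eps * (Y * p * (6 * c * X)) = 6 * (eps * Y * c * (X * p))); last by ring.
rewrite (_ : eps / 60 * Y * p = 1 / 60 * (eps * (Y * p * 1))); last by field.
rewrite (_ : q * (X * p / 2) = 1 / 10 * (5 * q * (X * p))); last by field.
move: (eps * _) (eps * _ * _ * _) (5 * q * _) => a b d; lra.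
Qed.

(** All of [O] may be too correlated, so Janson's inequality is applied to a subfamily with at most
    [b.+1] triangles on each edge. It keeps a proportion [b.+1 / (5 n)] of the triangles, hence at
    least eps n^2 / (30 p^2) of them, and each contributes p^3 / 2 to the exponent. *)
Lemma triangles_janson (R : realType) (p eps : R) (V : {set 'I_n}) (O : {set {set {set 'I_n}}}) :
  0 < p <= 1 -> 1 <= n%:R * p ^+ 2 ->
  (forall D, D \in O -> exists A, [/\ D = pairs A, #|A| = 3 & A \subset V]) ->
  eps * n%:R ^+ 3 <= #|O|%:R ->
  Ex p (pairs V) (fun G => (avoids O G)%:R) <= expR (- (eps / 60 * n%:R ^+ 2 * p)).
Proof.
move=> /andP[p0 p1] np O3 hO; have p01 : 0 <= p <= 1 by rewrite (ltW p0).
(* This cap gives [3 b p^5 <= p^3 / 2], while truncation still leaves [b.+1] above 1 / (6 p^2). *)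
pose b := Num.truncn (1 / (6 * p ^+ 2)).
have p20 : 0 < p ^+ 2 by rewrite exprn_gt0.
have r0 : 0 <= 1 / (6 * p ^+ 2) by rewrite divr_ge0 // mulr_ge0 // ltW.
have b1 : b%:R <= 1 / (6 * p ^+ 2) by rewrite /b truncn_le.
have b2 : 1 / (6 * p ^+ 2) < b.+1%:R by apply: truncnS_gt.
have {}b1 : 6 * b%:R * p ^+ 2 <= 1.
  by move: b1; rewrite ler_pdivlMr ?mulr_gt0 // mulrCA mulrA.
have {}b2 : 1 <= 6 * b.+1%:R * p ^+ 2.
  by move: b2; rewrite ltr_pdivrMr ?mulr_gt0 // mulrCA mulrA => /ltW.
have n1 : (1 <= n)%N by case: n np => // h; rewrite mul0r in h; lra.
have bn : (b.+1 <= 2 * n)%N.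
  rewrite -(ler_nat R) natrM -natr1; have : b%:R <= n%:R :> R.
    rewrite -(ler_pM2r p20); have := ler0n R b; nra.
  have : 1 <= n%:R :> R by rewrite ler1n.
  lra.
have OD D : D \in O -> #|D| = 3%N by move=> /O3[A [-> A3 _]]; rewrite card_pairs A3.
have Od e : (#|[set D in O | e \in D]| <= n)%N.
  have : [set D in O | e \in D] \subset [set pairs (z |: e) | z : 'I_n].
    apply/subsetP => D; rewrite inE => /andP[/O3[A [-> A3 _]]]; rewrite inE => /andP[eA /eqP e2].
    have : #|A :\: e| == 1%N by rewrite cardsD (setIidPr eA) A3 e2.
    case/cards1P => z Az; apply/imsetP; exists z => //; congr pairs.
    by apply/setP => x; rewrite -Az !inE; case xe: (x \in e); rewrite ?orbF //= (subsetP eA).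
  by move/subset_leq_card/leq_trans; apply; apply: leq_trans (leq_imset_card _ _) _; rewrite card_ord.
have [B [BO Bc cB]] := capped_subfamily (ltn0Sn b) OD Od.
apply: (@le_trans _ _ (Ex p (pairs V) (fun G => (avoids B G)%:R))).
  apply: le_Ex => // G _; rewrite ler_nat; case: (avoidsP O G) => // h.
  by rewrite (_ : avoids B G) //; apply/avoidsP => D DB; apply/h/(subsetP BO).
apply: le_trans (janson (b := b) p01 _ _ Bc) _.
- move=> D DB; split; last by apply/OD/(subsetP BO).
  have [A [-> _ AV]] := O3 _ (subsetP BO _ DB).
  by apply/subsetP => e; rewrite !inE => /andP[/subset_trans->].
- move=> D D' DB D'B DD'; have [A [DE A3 _]] := O3 _ (subsetP BO _ DB).
  have [A' [DE' A3' _]] := O3 _ (subsetP BO _ D'B).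
  rewrite cardsU (OD _ (subsetP BO _ DB)) (OD _ (subsetP BO _ D'B)) DE DE'.
  have : (#|pairs A :&: pairs A'| <= 1)%N.
    by apply: card_pairsI => //; apply: contra_neq DD'; rewrite DE DE' => ->.
  by case: #|_| => [|[|]].
have p3 : 3%:R * b%:R * p ^+ 5 <= p ^+ 3 / 2.
  rewrite (_ : 3%:R * b%:R * p ^+ 5 = 6 * b%:R * p ^+ 2 * (p ^+ 3 / 2)); last by field.
  by rewrite -[leRHS]mul1r ler_wpM2r // divr_ge0 // exprn_ge0 // ltW.
have p31 : p ^+ 3 <= 1 by rewrite exprn_ile1 // ltW.
have p30 : 0 <= p ^+ 3 by rewrite exprn_ge0 // ltW.
apply: (@le_trans _ _ ((1 + - (p ^+ 3 / 2)) ^+ #|B|)).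
  rewrite lerXn2r ?nnegrE ?natrM //; last lra; last lra.
  by rewrite addr_ge0 ?subr_ge0 // !mulr_ge0 ?exprn_ge0 // ltW.
apply: le_trans (exprn_le_expR _ _) _; first lra.
rewrite ler_expR mulrN lerN2.
have hB : eps * n%:R ^+ 2 * b.+1%:R <= 5 * #|B|%:R.
  have n0 : 0 < n%:R :> R by rewrite ltr0n.
  rewrite -(ler_pM2r n0).
  apply: (@le_trans _ _ (#|O|%:R * b.+1%:R)).
    rewrite (_ : _ * n%:R = eps * n%:R ^+ 3 * b.+1%:R); last by ring.
    by rewrite ler_wpM2r.
  apply: (@le_trans _ _ (#|B|%:R * (b.+1%:R + 3%:R * n%:R))).
    by rewrite -!(natrM, natrD) ler_nat.
  have h5 : (b.+1 + 3 * n <= 5 * n)%N by move: (b) bn => b' bn'; clear -bn'; lia.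
  by rewrite [5 * _]mulrC -mulrA ler_wpM2l // -natrM -natrD -natrM ler_nat.
have hp := ltW p0.
have := ler_wpM2r p30 hB.
have h6 : n%:R ^+ 2 * p * 1 <= n%:R ^+ 2 * p * (6 * b.+1%:R * p ^+ 2).
  by rewrite ler_wpM2l ?mulr_ge0 ?sqr_ge0.
have [e0|e0] := leP 0 eps; last first.
  move=> _; apply: (@le_trans _ _ 0); last by rewrite mulr_ge0 // divr_ge0.
  by rewrite -mulrA mulr_le0_ge0 ?mulr_ge0 ?sqr_ge0 //; lra.
have := ler_wpM2l e0 h6; rewrite (_ : p ^+ 3 = p ^+ 2 * p) ?exprSr //.
exact: triangles_janson_arith.
Qed.

End Triples.

(** * Predicting a cocycle from few vertices *)

Section Prediction.
Variables (n : nat) (S : {set 'I_n}).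
Implicit Types (G F H f : {set {set 'I_n}}) (u v x y : 'I_n).

Definition touching : {set {set 'I_n}} := Kn n :\: pairs (~: S).

(* [predict H f x y] is the value on the pair [xy] forced by a cocycle whose restriction to the
   edges touching [S] is [f], where [H] is the set of edges of the graph touching [S]. *)
Definition predict H f x y :=
  [exists v in S, [&& x \in nbr H v, y \in nbr H v & (x \in nbr f v) (+) (y \in nbr f v)]].
Definition covered H x y := [exists v in S, (x \in nbr H v) && (y \in nbr H v)].
(** On an uncovered pair [predict] is false by default rather than forced. Hence [odd_triples] asks
    for coverage of all three pairs, while [odd_link] does not; [card_odd_triples] pays for the
    difference. *)
Definition oddly H f u x y := predict H f u x (+) predict H f u y (+) predict H f x y.
Definition uncovered_pairs H :=
  [set q : 'I_n * 'I_n | [&& q.1 \notin S, q.2 \notin S, q.1 != q.2 & ~~ covered H q.1 q.2]].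
Definition odd_link H f u :=
  [set q : 'I_n * 'I_n | [&& q.1 \notin S, q.2 \notin S & oddly H f u q.1 q.2]].
Definition odd_triples H f :=
  [set t : 'I_n * 'I_n * 'I_n | [&& t.1.1 \notin S, t.1.2 \notin S & t.2 \notin S] &&
     [&& oddly H f t.1.1 t.1.2 t.2, covered H t.1.1 t.1.2, covered H t.1.1 t.2 & covered H t.1.2 t.2]].

Lemma predictC H f x y : predict H f x y = predict H f y x.
Proof. by apply: eq_existsb => v; case: (v \in S); rewrite //= andbCA addbC. Qed.

Lemma predictxx H f x : predict H f x x = false.
Proof. by apply/negbTE/exists_inPn => v _; rewrite addbb !andbF. Qed.

Lemma oddly_neq H f u x y : oddly H f u x y -> [/\ u != x, u != y & x != y].
Proof.
move=> o; split; apply: contraTneq o => ->; rewrite /oddly predictxx.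
- by rewrite addFb addbb.
- by rewrite addbF predictC addbb.
- by rewrite addbF addbb.
Qed.

Lemma nbr_touching G v : G \subset Kn n -> v \in S -> nbr (G :&: touching) v = nbr G v.
Proof.
move=> GK vS; apply/setP => x; rewrite !inE; case eG: (_ \in G) => //=.
have := subsetP GK _ eG; rewrite inE => ->; rewrite !andbT subUset sub1set inE vS.
by [].
Qed.

Lemma predictP G F x y : G \subset Kn n -> cocycle G F -> y \in nbr G x ->
  covered (G :&: touching) x y ->
  (y \in nbr F x) = predict (G :&: touching) (F :&: touching) x y.
Proof.
move=> GK cF xy cov; have FK : F \subset Kn n := subset_trans cF.1 GK.
have tri v : x \in nbr G v -> y \in nbr G v -> (y \in nbr F x) = (x \in nbr F v) (+) (y \in nbr F v).
  move=> vx vy; have := cocycle_triangle GK cF vx vy xy.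
  by case: (x \in nbr F v); case: (y \in nbr F v); case: (y \in nbr F x).
apply/idP/exists_inP => [xyF|[v vS]].
  have /exists_inP[v vS] := cov; rewrite !nbr_touching // => /andP[vx vy].
  by exists v => //; rewrite !nbr_touching // vx vy -tri.
by rewrite !nbr_touching // => /and3P[vx vy]; rewrite -tri.
Qed.

Lemma touchingP e : reflect (exists v w, [/\ v \in S, v != w & e = [set v; w]]) (e \in touching).
Proof.
apply: (iffP idP) => [|[v [w [vS vw ->]]]]; last first.
  by rewrite !inE cards2 vw andbT subUset sub1set inE vS.
rewrite !inE andbC => /andP[/cards2P[a [b [ab ->]]]]; rewrite cards2 ab andbT subUset !sub1set !inE.
rewrite negb_and !negbK => /orP[aS|bS]; first by exists a, b.
by exists b, a; rewrite setUC eq_sym.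
Qed.

Lemma card_touching : (#|touching| <= #|S| * n)%N.
Proof.
rewrite -[n in (_ * n)%N]card_ord -cardsT -cardsX.
apply: leq_trans (leq_imset_card (fun q : 'I_n * 'I_n => [set q.1; q.2]) _).
apply: subset_leq_card; apply/subsetP => e /touchingP[v [w [vS vw ->]]].
by apply/imsetP; exists (v, w) => //; rewrite in_setX vS inE.
Qed.

Lemma KnE : Kn n = touching :|: pairs (~: S).
Proof.
rewrite /touching; apply/setP => e; rewrite !inE; case: (#|e| == 2%N); rewrite ?andbF // !andbT.
by rewrite orNb.
Qed.

Lemma touching_disjoint : [disjoint touching & pairs (~: S)].
Proof. by rewrite disjoint_sym disjoint_setDr. Qed.

Section Fixed.
Variables (H f G2 F : {set {set 'I_n}}).
Hypotheses (HS : H \subset touching) (G2S : G2 \subset pairs (~: S)).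
Let G := H :|: G2.
Hypotheses (cF : cocycle G F) (Ff : F :&: touching = f).

Lemma GK : G \subset Kn n.
Proof. by rewrite KnE setUSS. Qed.

Lemma G_touching : G :&: touching = H.
Proof.
rewrite setIUl (setIidPl HS).
suff -> : G2 :&: touching = set0 by rewrite setU0.
apply/eqP; rewrite setI_eq0; apply: disjointWl G2S _.
by rewrite disjoint_sym touching_disjoint.
Qed.

Lemma predict_eq x y : y \in nbr G x -> covered H x y -> (y \in nbr F x) = predict H f x y.
Proof. move=> xy; have := predictP GK cF xy; rewrite Ff G_touching; apply. Qed.

(** If a covered edge [xy] forms an even triple with [u], its predicted value is the sum of those of
    [ux] and [uy], which says whether the cut around the predicted neighbours of [u] separates [x]
    from [y]. *)
Lemma symd_cut_sub u :
  symd F (cut_edges G [set x | predict H f u x]) \subset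
  H :|: (G2 :&: [set [set q.1; q.2] | q in odd_link H f u :|: uncovered_pairs H]).
Proof.
apply/subsetP => e eFc.
have eG : e \in G.
  move: eFc; rewrite in_symd; case eF: (e \in F); first by rewrite (subsetP cF.1).
  by rewrite inE => /andP[].
rewrite in_setU; have [//|eH /=] := boolP (e \in H).
have eG2 : e \in G2 by move: eG; rewrite in_setU (negPf eH).
rewrite in_setI eG2; have := subsetP G2S _ eG2; rewrite inE => /andP[eS /cards2P[x [y [xy eE]]]].
move: eS; rewrite eE subUset !sub1set !in_setC => /andP[xS yS].
apply/imsetP; exists (x, y) => //; rewrite !inE xS yS xy /=.
have [cov|] := boolP (covered H x y); last by rewrite orbT.
rewrite orbF; move: eFc; rewrite in_symd [e \in cut_edges _ _]inE eG eE card_set2I // !inE /= -eE.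
have xyG : y \in nbr G x by rewrite inE -eE.
have := predict_eq xyG cov; rewrite [y \in nbr F x]inE -eE => ->.
by rewrite /oddly; case: (predict H f x y); case: (predict H f u x); case: (predict H f u y).
Qed.

Lemma no_odd_triangle t : t \in odd_triples H f -> ~~ (pairs [set t.1.1; t.1.2; t.2] \subset G2).
Proof.
case: t => [[u x] y]; rewrite inE /= => /andP[_ /and4P[o c1 c2 c3]]; apply/negP => sG.
have [ux uy xy] := oddly_neq o.
have inG a b : a \in [set u; x; y] -> b \in [set u; x; y] -> a != b -> b \in nbr G a.
  move=> aT bT ab; rewrite inE in_setU; apply/orP; right; apply: (subsetP sG).
  by rewrite inE subUset !sub1set aT bT cards2 ab.
have uxG : x \in nbr G u by apply: inG; rewrite // !inE eqxx ?orbT.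
have uyG : y \in nbr G u by apply: inG; rewrite // !inE eqxx ?orbT.
have xyG : y \in nbr G x by apply: inG; rewrite // !inE eqxx ?orbT.
have := cocycle_triangle GK cF uxG uyG xyG.
by rewrite !predict_eq // => /negP; apply.
Qed.

End Fixed.

(** An odd triple that is not in [odd_triples] has an uncovered pair in one of three positions, with
    the remaining vertex free. *)
Lemma card_odd_triples H f :
  (\sum_(u | u \notin S) #|odd_link H f u| <= #|odd_triples H f| + 3 * (n * #|uncovered_pairs H|))%N.
Proof.
pose U := uncovered_pairs H.
pose T1 := [set t : 'I_n * 'I_n * 'I_n | (t.1.1, t.1.2) \in U].
pose T2 := [set t : 'I_n * 'I_n * 'I_n | (t.1.1, t.2) \in U].
pose T3 := [set t : 'I_n * 'I_n * 'I_n | (t.1.2, t.2) \in U].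
have bound (T : {set 'I_n * 'I_n * 'I_n}) (h : 'I_n * 'I_n * 'I_n -> 'I_n * ('I_n * 'I_n)) :
    injective h -> (forall t, t \in T -> (h t).2 \in U) -> (#|T| <= n * #|U|)%N.
  move=> hi hT; rewrite -(card_imset _ hi) -[n in (n * _)%N]card_ord -cardsT -cardsX.
  by apply: subset_leq_card; apply/subsetP => q /imsetP[t tT ->]; rewrite inE in_setT /= hT.
have c1 : (#|T1| <= n * #|U|)%N.
  apply: (bound _ (fun t => (t.2, (t.1.1, t.1.2)))) => [[[a b] c] [[a' b'] c'] /= [-> -> ->]//|t].
  by rewrite inE.
have c2 : (#|T2| <= n * #|U|)%N.
  apply: (bound _ (fun t => (t.1.2, (t.1.1, t.2)))) => [[[a b] c] [[a' b'] c'] /= [-> -> ->]//|t].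
  by rewrite inE.
have c3 : (#|T3| <= n * #|U|)%N.
  apply: (bound _ (fun t => (t.1.1, (t.1.2, t.2)))) => [[[a b] c] [[a' b'] c'] /= [-> -> ->]//|t].
  by rewrite inE.
pose A := [set t : 'I_n * 'I_n * 'I_n | (t.1.1 \notin S) && ((t.1.2, t.2) \in odd_link H f t.1.1)].
have -> : (\sum_(u | u \notin S) #|odd_link H f u| = #|A|)%N.
  rewrite -sum1_card (eq_bigr (fun u => \sum_(q in odd_link H f u) 1)%N) => [|u _]; last by rewrite sum1_card.
  rewrite pair_big_dep /= (reindex (fun t : 'I_n * 'I_n * 'I_n => (t.1.1, (t.1.2, t.2)))) /=.
    by apply: eq_bigl => t; rewrite [RHS]inE.
  by exists (fun q => (q.1, q.2.1, q.2.2)) => [[[a b] c]|[a [b c]]].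
apply: (@leq_trans #|odd_triples H f :|: (T1 :|: (T2 :|: T3))|).
  apply: subset_leq_card; apply/subsetP => -[[u x] y]; rewrite inE /= => /andP[uS].
  rewrite inE /= => /and3P[xS yS o]; have [ux uy xy] := oddly_neq o.
  rewrite !inE /= uS xS yS o ux uy xy /=.
  by case: (covered H u x); case: (covered H u y); case: (covered H x y); rewrite ?orbT.
apply: leq_trans (leq_card_setU _ _) _; rewrite leq_add2l !mulSn mul0n addn0.
apply: leq_trans (leq_card_setU _ _) _; apply: leq_add c1 _.
exact: leq_trans (leq_card_setU _ _) (leq_add c2 c3).
Qed.

End Prediction.

Section ConditionalBound.
Variables (R : realType) (n : nat) (S : {set 'I_n}) (p eps : R) (H f : {set {set 'I_n}}).
Hypotheses (p01 : 0 < p <= 1) (np : 1 <= n%:R * p ^+ 2) (e0 : 0 < eps).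
Hypotheses (HS : H \subset touching S) (S2 : (2 * #|S| <= n)%N).
Hypothesis (unc : #|uncovered_pairs S H|%:R <= eps / 192 * n%:R ^+ 2).

(** The bad event for the unexposed edges once [H] and the guess [f] are fixed. The bound on [H]
    ensures that exposed edges make up at most half of the distance to a cut. *)
Definition far_extension (G2 : {set {set 'I_n}}) := exists F, [/\ cocycle (H :|: G2) F,
  F :&: touching S = f, #|H|%:R <= eps / 2 * n%:R ^+ 2 * p &
  forall A, eps * n%:R ^+ 2 * p <= #|symd F (cut_edges (H :|: G2) A)|%:R].

Let p01' : 0 <= p <= 1. Proof. by case/andP: p01 => p0 p1; rewrite (ltW p0). Qed.

(** For the cut predicted by [u], at least eps n^2 p / 2 of the discrepancy must come from random
    edges in a set [Z] of at most eps n^2 / 12 pairs, three times the mean allowed by the factor 2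
    of [upper_tail]. *)
Lemma far_extension_small_link u : #|odd_link S H f u|%:R <= eps / 16 * n%:R ^+ 2 ->
  Ex p (pairs (~: S)) (fun G2 => `[< far_extension G2 >]%:R) <= expR (- (eps / 4 * n%:R ^+ 2 * p)).
Proof.
move=> hu; case/andP: (p01) => p0 p1.
pose Z := [set [set q.1; q.2] | q in odd_link S H f u :|: uncovered_pairs S H].
have cZ : #|Z|%:R <= eps / 12 * n%:R ^+ 2.
  apply: (@le_trans _ _ (#|odd_link S H f u|%:R + #|uncovered_pairs S H|%:R)).
    rewrite -natrD ler_nat; apply: leq_trans (leq_imset_card _ _) _; exact: leq_card_setU.
  move: hu unc; set N := n%:R ^+ 2; set a := #|_|%:R; set b := #|_|%:R => ha hb.
  have : 0 <= eps * N by rewrite mulr_ge0 ?sqr_ge0 // ltW.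
  lra.
apply: (@le_trans _ _ (Ex p (pairs (~: S)) (fun G2 =>
   (eps / 2 * n%:R ^+ 2 * p <= #|G2 :&: Z|%:R)%R%:R))).
  apply: le_Ex => // G2 G2S; rewrite ler_nat; case: asboolP => // -[F [cF Ff cH far]].
  suff -> : eps / 2 * n%:R ^+ 2 * p <= #|G2 :&: Z|%:R by [].
  have := far [set x | predict S H f u x].
  have := subset_leq_card (symd_cut_sub HS G2S cF Ff u).
  move/leq_trans => /(_ _ (leq_card_setU _ _)); rewrite -/Z -(ler_nat R) natrD => h1 h2.
  have := le_trans h2 h1; lra.
apply: le_trans (upper_tail p01' _ _ _) _; rewrite ler_expR.
have : p * #|Z|%:R <= p * (eps / 12 * n%:R ^+ 2) by rewrite ler_wpM2l // ltW.
rewrite (_ : p * (eps / 12 * n%:R ^+ 2) = 1 / 12 * (eps * n%:R ^+ 2 * p)); last by field.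
rewrite (_ : 2 * p * #|Z|%:R = 2 * (p * #|Z|%:R)); last by ring.
rewrite (_ : eps / 2 * n%:R ^+ 2 * p = 1 / 2 * (eps * n%:R ^+ 2 * p)); last by field.
rewrite (_ : eps / 4 * n%:R ^+ 2 * p = 1 / 4 * (eps * n%:R ^+ 2 * p)); last by field.
have : 0 <= eps * n%:R ^+ 2 * p by rewrite !mulr_ge0 ?sqr_ge0 // ltW.
move: (p * _) (eps * _ * _) => a b; lra.
Qed.

(** At least n / 2 choices of [u] give eps n^3 / 32 odd triples; those with an uncovered pair number
    at most eps n^3 / 64. The factor 27 bounds the orderings of a triangle, and 60 comes from
    [triangles_janson]. *)
Lemma far_extension_odd : (forall u, u \notin S -> eps / 16 * n%:R ^+ 2 <= #|odd_link S H f u|%:R) ->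
  Ex p (pairs (~: S)) (fun G2 => `[< far_extension G2 >]%:R) <=
  expR (- (eps / 64 / 27 / 60 * n%:R ^+ 2 * p)).
Proof.
move=> hu; case/andP: (p01) => p0 p1.
pose h (t : 'I_n * 'I_n * 'I_n) := pairs [set t.1.1; t.1.2; t.2].
pose O := h @: odd_triples S H f.
have T3 t : t \in odd_triples S H f -> #|[set t.1.1; t.1.2; t.2]| = 3%N.
  by rewrite inE => /andP[_ /andP[/oddly_neq[ux uy xy] _]]; rewrite set3_card.
have cO : (#|odd_triples S H f| <= 27 * #|O|)%N.
  apply: card_le_fibers => t tO; set V := [set t.1.1; t.1.2; t.2].
  rewrite (_ : 27 = #|setX (setX V V) V|)%N; last by rewrite !cardsX T3.
  apply: subset_leq_card; apply/subsetP => -[[a b] c].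
  rewrite inE => /andP[t'O /eqP /(pairs_inj (T3 _ t'O) (T3 _ tO)) /= VV].
  by rewrite !in_setX /V -VV !inE !eqxx ?orbT.
have hO : eps / 64 / 27 * n%:R ^+ 3 <= #|O|%:R.
  have cS : n%:R / 2 <= #|~: S|%:R :> R.
    rewrite cardsCs setCK card_ord natrB; last by move: S2; lia.
    by move: S2; rewrite -(ler_nat R) natrM; lra.
  have h1 : eps / 16 * n%:R ^+ 2 * (n%:R / 2) <= #|odd_triples S H f|%:R +
      3 * (n%:R * (eps / 192 * n%:R ^+ 2)).
    apply: (@le_trans _ _ (\sum_(u | u \notin S) #|odd_link S H f u|%:R)).
      apply: (@le_trans _ _ (\sum_(u | u \notin S) eps / 16 * n%:R ^+ 2)); last exact: ler_sum.
      rewrite (eq_bigl (fun u => u \in ~: S)) => [|u]; last by rewrite inE.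
      by rewrite sumr_const -[leRHS]mulr_natr ler_wpM2l // mulr_ge0 ?sqr_ge0 // divr_ge0 // ltW.
    rewrite -natr_sum; apply: (@le_trans _ _ (#|odd_triples S H f| + 3 * (n * #|uncovered_pairs S H|))%:R).
      by rewrite ler_nat card_odd_triples.
    by rewrite natrD !natrM lerD2l !ler_wpM2l.
  have : #|odd_triples S H f|%:R <= 27 * #|O|%:R :> R by rewrite -natrM ler_nat.
  rewrite (_ : eps / 64 / 27 * n%:R ^+ 3 = 1 / 27 * (1 / 64 * (eps * n%:R ^+ 3))); last by field.
  move: h1; rewrite (_ : eps / 16 * n%:R ^+ 2 * (n%:R / 2) = 1 / 32 * (eps * n%:R ^+ 3)); last by field.
  rewrite (_ : 3 * (n%:R * (eps / 192 * n%:R ^+ 2)) = 1 / 64 * (eps * n%:R ^+ 3)); last by field.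
  move: (eps * _) (#|odd_triples _ _ _|%:R) (#|O|%:R) => a b c; lra.
apply: le_trans (triangles_janson (V := ~: S) p01 np _ hO).
  apply: le_Ex => // G2 G2S; rewrite ler_nat; case: asboolP => // -[F [cF Ff cH far]].
  suff -> : avoids O G2 by [].
  by apply/avoidsP => D /imsetP[t tO ->]; apply: no_odd_triangle cF Ff _ tO.
move=> D /imsetP[t tO ->]; exists [set t.1.1; t.1.2; t.2]; split; rewrite ?T3 //.
apply/subsetP => x; move: tO; rewrite inE => /andP[/and3P[a b c] _].
by rewrite !inE => /orP[/orP[]|] /eqP->.
Qed.

Lemma far_extension_le : Ex p (pairs (~: S)) (fun G2 => `[< far_extension G2 >]%:R) <=
  expR (- (eps / 64 / 27 / 60 * n%:R ^+ 2 * p)).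
Proof.
case/andP: (p01) => p0 p1.
have [/existsP[u /andP[uS hu]]|nu] :=
    boolP [exists u, (u \notin S) && (#|odd_link S H f u|%:R <= eps / 16 * n%:R ^+ 2)].
  apply: le_trans (far_extension_small_link hu) _; rewrite ler_expR lerN2.
  have h : eps / 64 / 27 / 60 <= eps / 4 by have := e0; lra.
  by apply: ler_wpM2r; [apply: ltW | apply: ler_wpM2r => //; apply: sqr_ge0].
apply: far_extension_odd.
move=> u uS; move: nu; rewrite negb_exists => /forallP/(_ u); rewrite uS /= -ltNge; exact: ltW.
Qed.

End ConditionalBound.

(** * Every cocycle is close to a cut *)

Section NearCut.
Variables (R : realType) (eps : R).
Hypothesis e01 : 0 < eps <= 1.

(** [c] is the rate in [far_extension_le]. Half of it pays for guessing [F] on the edges touching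
    [S], which fixes [del]. *)
Let c : R := eps / 64 / 27 / 60.
Let del : R := c / 2.
Let k (n : nat) : nat := Num.truncn (del * n%:R).
Let S (n : nat) : {set 'I_n} := [set x in take (k n) (enum 'I_n)].

Let e0 : 0 < eps. Proof. by case/andP: e01. Qed.
Let del0 : 0 < del. Proof. by rewrite /del /c; have := e0; lra. Qed.
Let del_le : del <= eps / 1000. Proof. by rewrite /del /c; have := e0; lra. Qed.
Let del_half : del <= 1 / 2. Proof. by have := del_le; case/andP: e01; lra. Qed.

Let k_le n : (k n)%:R <= del * n%:R.
Proof. by rewrite /k truncn_le // mulr_ge0 // ltW. Qed.

Let k_half n : (2 * k n <= n)%N.
Proof.
rewrite -(ler_nat R) natrM; have := k_le n; have := del_half; have := ler0n R n => n0 hd hk.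
have := ler_wpM2r n0 hd; lra.
Qed.

Let card_S n : #|S n| = k n.
Proof.
rewrite cardsE; have /card_uniqP -> : uniq (take (k n) (enum 'I_n)) by rewrite take_uniq ?enum_uniq.
by rewrite size_takel // size_enum_ord; have := k_half n; lia.
Qed.

Let card_touching_le n : #|touching (S n)|%:R <= del * n%:R ^+ 2.
Proof.
apply: (@le_trans _ _ (k n * n)%:R); first by rewrite ler_nat -card_S card_touching.
by rewrite natrM expr2 mulrA ler_wpM2r.
Qed.

Definition near_cut n (p : R) (G : {set {set 'I_n}}) := forall F, cocycle G F ->
  exists A, #|symd F (cut_edges G A)|%:R < eps * n%:R ^+ 2 * p.

Let few_touching n (p : R) (G : {set {set 'I_n}}) : Prop :=
  #|G :&: touching (S n)|%:R <= eps / 2 * n%:R ^+ 2 * p.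
Let few_uncovered n (p : R) (G : {set {set 'I_n}}) : Prop :=
  #|uncovered_pairs (S n) (G :&: touching (S n))|%:R <= eps / 192 * n%:R ^+ 2.

Let regime (K : R) : dense_regime (fun n p => [/\ 0 < p <= 1, 7 / 5 * ln n%:R <= n%:R * p ^+ 2,
  1 <= ln n%:R :> R & K * ln n%:R <= n%:R ^+ 2 * p]).
Proof.
have := dense_regime_and (dense_regime_and (dense_regime_p01 R) (dense_regime_ln 1)) (dense_regime_np `|K|).
apply: dense_regimeW => n p [[[p01 hL] l1] hnp]; have /andP[p0 p1] := p01.
have n0 : (0 < n)%N by apply: (@nat_gt0_ln R); lra.
split=> //.
  rewrite p1 andbT lt_neqAle p0 andbT; apply/eqP => h.
  by move: hL; rewrite -h expr0n mulr0; lra.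
apply: (@le_trans _ _ (n%:R * p)).
  apply: le_trans hnp; rewrite ler_wpM2r ?ler_norm //; lra.
rewrite expr2 -mulrA ler_peMl ?mulr_ge0 // ler1n //.
Qed.

Let whp_few_touching : whp few_touching.
Proof.
apply: (@whp_expR _ 0); apply: dense_regimeW (regime (4 / eps)) => n p [/andP[p0 p1] _ l1 hn].
have p01 : 0 <= p <= 1 by rewrite ltW.
apply: (@le_trans _ _ (Ex p (Kn n) (fun G => (eps / 2 * n%:R ^+ 2 * p <= #|G :&: touching (S n)|%:R)%R%:R))).
  apply: Pr_Gnp_le_Ex => // G GK /negP; rewrite -ltNge => /ltW h.
  by rewrite h.
apply: le_trans (upper_tail p01 _ _ _) _; rewrite ler_expR.
have h1 := ler_wpM2r (ltW p0) (card_touching_le n).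
have h2 : del * n%:R ^+ 2 * p <= eps / 1000 * n%:R ^+ 2 * p.
  by apply: ler_wpM2r; [apply: ltW | apply: ler_wpM2r; [apply: sqr_ge0 | apply: del_le]].
have h3 : ln n%:R <= eps / 4 * n%:R ^+ 2 * p.
  have := ler_wpM2l (ltW e0) hn.
  rewrite (_ : eps * (4 / eps * ln n%:R) = 4 * ln n%:R); last by field; rewrite gt_eqF.
  rewrite (_ : eps * (n%:R ^+ 2 * p) = eps * n%:R ^+ 2 * p); last by ring.
  rewrite (_ : eps / 4 * n%:R ^+ 2 * p = 1 / 4 * (eps * n%:R ^+ 2 * p)); last by field.
  move: (eps * _ * _) => a; lra.
move: h1 h2 h3; rewrite (_ : 2 * p * #|touching (S n)|%:R = 2 * (#|touching (S n)|%:R * p)); last by ring.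
rewrite (_ : eps / 4 * n%:R ^+ 2 * p = 1 / 4 * (eps * n%:R ^+ 2 * p)); last by field.
rewrite (_ : eps / 2 * n%:R ^+ 2 * p = 1 / 2 * (eps * n%:R ^+ 2 * p)); last by field.
rewrite (_ : eps / 1000 * n%:R ^+ 2 * p = 1 / 1000 * (eps * n%:R ^+ 2 * p)); last by field.
have : 0 <= eps * n%:R ^+ 2 * p by rewrite !mulr_ge0 ?sqr_ge0 ?(ltW e0) ?(ltW p0).
move: (eps * n%:R ^+ 2 * p) (del * n%:R ^+ 2 * p) (#|touching (S n)|%:R * p) (ln _) => a b d l; lra.
Qed.

Let uncovered_weight n (G : {set {set 'I_n}}) x y : x \notin S n -> y \notin S n -> G \subset Kn n ->
  ~~ covered (S n) (G :&: touching (S n)) x y ->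
  1 <= \prod_(v in S n) star_weight (0 : R) x [set y] v G.
Proof.
move=> xS yS GK /exists_inPn nc; rewrite big1 // => v vS; rewrite /star_weight.
case: ifP => // xv; rewrite (_ : G :&: _ = set0) ?cards0 ?expr0 //.
apply/eqP; rewrite -subset0; apply/subsetP => e; rewrite in_setI => /andP[eG /cross1P[u /set1P-> eE]].
have xv' : x \in nbr G v by rewrite nbr_sym inE.
have yv : y \in nbr G v by rewrite nbr_sym inE -eE.
by have := nc _ vS; rewrite !nbr_touching // xv' yv.
Qed.

(** A pair is uncovered with probability [(1 - p ^+ 2) ^+ k n], at most a constant times n to the
    power -7 del / 5. This small power suffices for Markov's inequality, because a fixed proportion
    of uncovered pairs is tolerated. *)
Let whp_few_uncovered : whp few_uncovered.
Proof.
apply: (@whp_expRM _ (ln (192 / eps) + 1) (del * (7 / 5))); first by have := del0; lra.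
apply: dense_regimeW (regime 1) => n p [/andP[p0 p1] hL l1 _].
have p01 : 0 <= p <= 1 by rewrite ltW.
have n0 : (0 < n)%N by apply: (@nat_gt0_ln R); lra.
have n20 : 0 < n%:R ^+ 2 :> R by rewrite exprn_gt0 // ltr0n.
pose ok (q : 'I_n * 'I_n) := [&& q.1 \notin S n, q.2 \notin S n & q.1 != q.2].
pose f (q : 'I_n * 'I_n) (G : {set {set 'I_n}}) : R :=
   \prod_(v in S n) star_weight (0 : R) q.1 [set q.2] v G.
have f0 q G : 0 <= f q G.
  by apply: prodr_ge0 => v _; rewrite /star_weight; case: ifP => // _; rewrite exprn_ge0.
have e192 : 0 <= 192 / eps by rewrite divr_ge0 // ltW.
apply: (@le_trans _ _ (Ex p (Kn n) (fun G => 192 / eps * (n%:R ^+ 2)^-1 * \sum_(q | ok q) f q G))).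
  apply: Pr_Gnp_le_Ex => // [G _|G GK /negP].
    by apply: mulr_ge0; [apply: mulr_ge0; rewrite ?invr_ge0 ?(ltW n20)|apply: sumr_ge0].
  rewrite -ltNge => h.
  have h2 : #|uncovered_pairs (S n) (G :&: touching (S n))|%:R <= \sum_(q | ok q) f q G.
    rewrite -sum1_card natr_sum [leLHS]big_mkcond [leRHS]big_mkcond; apply: ler_sum => q _.
    rewrite inE /ok; case: (boolP (q.1 \in S n)) => //= xS; case: (boolP (q.2 \in S n)) => //= yS.
    case: eqVneq => //= _; case: ifP => [|_]; last exact: f0.
    exact: uncovered_weight.
  have h3 := le_trans (ltW h) h2.
  rewrite [leLHS](_ : 1 = 192 / eps * (n%:R ^+ 2)^-1 * (eps / 192 * n%:R ^+ 2)).
    by apply: ler_wpM2l; [apply: mulr_ge0; rewrite ?invr_ge0 ?(ltW n20)|exact: h3].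
  by field; rewrite pnatr_eq0 -lt0n n0 gt_eqF.
rewrite ExZ Ex_sum.
have hq q : ok q -> Ex p (Kn n) (f q) = (1 + - p ^+ 2) ^+ k n.
  case: q => [x y] /and3P[/= xS yS xy]; rewrite /f Ex_star_weight ?inE //=; last first.
    by rewrite disjoint_sym disjoints_subset subUset !sub1set !in_setC xS.
  rewrite cards1 expr1 mulr0 addr0 card_S; congr (_ ^+ _); ring.
have hk : (1 + - p ^+ 2) ^+ k n <= expR (1 - del * (7 / 5 * ln n%:R)).
  have p21 : p ^+ 2 <= 1 by rewrite exprn_ile1 // ltW.
  apply: le_trans (exprn_le_expR _ _) _; first lra.
  (* Truncation loses less than one vertex of [S], hence at most p^2 <= 1 in the exponent. *)
  rewrite ler_expR; have hk1 : del * n%:R - 1 <= (k n)%:R.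
    by rewrite lerBlDr natr1; apply/ltW/truncnS_gt.
  have := ler_wpM2r (sqr_ge0 p) hk1; have := ler_wpM2l (ltW del0) hL.
  rewrite (_ : (del * n%:R - 1) * p ^+ 2 = del * (n%:R * p ^+ 2) - p ^+ 2); last by ring.
  rewrite mulrN; move: p21; move: (del * (n%:R * p ^+ 2)) (del * (7 / 5 * ln n%:R)) ((k n)%:R * p ^+ 2) (p ^+ 2) => a b d e.
  lra.
rewrite (eq_bigr _ hq).
apply: (@le_trans _ _ (192 / eps * (n%:R ^+ 2)^-1 * (n%:R ^+ 2 * expR (1 - del * (7 / 5 * ln n%:R))))).
  apply: ler_wpM2l; first by apply: mulr_ge0; rewrite ?invr_ge0 ?(ltW n20).
  apply: (@le_trans _ _ (\sum_(q : 'I_n * 'I_n) expR (1 - del * (7 / 5 * ln n%:R)))).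
    by rewrite [leLHS]big_mkcond; apply: ler_sum => q _; case: ifP => _; rewrite ?expR_ge0.
  by rewrite sumr_const card_prod card_ord -[leLHS]mulr_natl natrM expr2.
rewrite mulrA mulrVK ?unitfE ?gt_eqF //.
have e : expR (ln (192 / eps)) = 192 / eps by rewrite lnK // posrE divr_gt0.
rewrite -[X in X * _]e -expRD ler_expR (_ : del * (7 / 5) * ln n%:R = del * (7 / 5 * ln n%:R)); last by rewrite -[LHS]mulrA.
by rewrite addrA.
Qed.

Let whp_near_cut_regular :
  whp (fun n p G => few_touching p G -> few_uncovered p G -> near_cut p G).
Proof.
apply: (@whp_expR _ 0); apply: dense_regimeW (regime (2 / c)) => n p [p01 hL l1 hn].
have /andP[p0 p1] := p01; have p01' : 0 <= p <= 1 by rewrite ltW.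
have np1 : 1 <= n%:R * p ^+ 2 by lra.
rewrite Pr_GnpE (KnE (S n)) Ex_setU ?touching_disjoint //.
set B := expR (- (c * n%:R ^+ 2 * p)).
(* Guesses [f] are subsets of the actual [H], so their number is averaged over [H]: 2^|H| has mean
   [(1 + p) ^+ #|touching (S n)|], at most exp(del n^2 p), whereas all subsets of [touching] would
   cost a factor without p in the exponent. *)
apply: (@le_trans _ _ (Ex p (touching (S n)) (fun H => B * 2 ^+ #|H :&: touching (S n)|))).
  apply: le_Ex => // H HS; rewrite (setIidPl HS).
  have HG (G2 : {set {set 'I_n}}) : G2 \subset pairs (~: S n) -> (H :|: G2) :&: touching (S n) = H.
    exact: G_touching.
  have [hu|hu] := pselect (#|uncovered_pairs (S n) H|%:R <= eps / 192 * n%:R ^+ 2); last first.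
    rewrite (eq_Ex p (g := fun=> 0)) => [|G2 G2S].
      by rewrite Ex_const mulr_ge0 ?expR_ge0 // exprn_ge0.
    case: asboolP => // h; exfalso; apply: h => _ h; case: hu; move: h.
    by rewrite /few_uncovered HG.
  apply: (@le_trans _ _ (Ex p (pairs (~: S n)) (fun G2 =>
      \sum_(f in powerset H) `[< far_extension (S n) p eps H f G2 >]%:R))).
    apply: le_Ex => // G2 G2S; case: asboolP => [|_]; last by apply: sumr_ge0.
    move=> /not_implyP[ft /not_implyP[_ /existsNP[F /not_implyP[cF nA]]]].
    have fH : F :&: touching (S n) \in powerset H.
      by rewrite inE; apply: subset_trans (setSI _ cF.1) _; rewrite HG.
    rewrite (bigD1 _ fH) /= -[leLHS]addr0; apply: lerD; last exact: sumr_ge0.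
    rewrite (_ : `[< _ >] = true) //; apply/asboolP; exists F; split=> //.
      by move: ft; rewrite /few_touching HG.
    by move=> A; rewrite leNgt; apply/negP => h; apply: nA; exists A.
  rewrite Ex_sum; apply: (@le_trans _ _ (\sum_(f in powerset H) B)).
    apply: ler_sum => f _; apply: far_extension_le => //.
    by rewrite card_S k_half.
  by rewrite sumr_const card_powerset -[leLHS]mulr_natr natrX.
rewrite ExZ Ex_pow_card setIid.
have -> : 1 - p + p * 2 = 1 + p by ring.
apply: (@le_trans _ _ (B * expR (del * n%:R ^+ 2 * p))).
  rewrite ler_wpM2l ?expR_ge0 //; apply: le_trans (exprn_le_expR _ _) _; first lra.
  by rewrite ler_expR ler_wpM2r // ltW.
rewrite /B -expRD ler_expR /del.
have c0 : 0 < c by rewrite /c; have := e0; lra.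
move: hn; rewrite mulrAC ler_pdivrMr // => hn.
rewrite (_ : c / 2 * n%:R ^+ 2 * p = 1 / 2 * (n%:R ^+ 2 * p * c)); last by field.
rewrite (_ : c * n%:R ^+ 2 * p = n%:R ^+ 2 * p * c); last by ring.
move: (_ * c) hn => a; lra.
Qed.

Lemma whp_near_cut : whp near_cut.
Proof.
apply: whpW (whp_and whp_few_touching (whp_and whp_few_uncovered whp_near_cut_regular)).
by move=> n p G _ _ [h1 [h2 h3]]; apply: h3.
Qed.

End NearCut.

(** * The sparse regime *)

Section LoneEdges.
Variables (R : realType) (n : nat) (p : R).
Hypothesis p01 : 0 <= p <= 1.
Implicit Types (a b c d w : 'I_n) (G : {set {set 'I_n}}).

Definition lone_edge a b G : R := (([set a; b] \in G) && (codeg G a b == 0%N))%:R.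

Lemma lone_edgeC a b G : lone_edge a b G = lone_edge b a G.
Proof. by rewrite /lone_edge setUC codegC. Qed.

Lemma prod_star_weight1 a (U J : {set 'I_n}) G : (forall u, u \in U -> codeg G a u = 0%N) ->
  \prod_(w in J) star_weight (0 : R) a U w G = 1.
Proof.
move=> hU; apply: big1 => w wJ; rewrite /star_weight; case: ifP => // aw.
rewrite (_ : G :&: _ = set0) ?cards0 ?expr0 //.
apply/eqP; rewrite -subset0; apply/subsetP => e; rewrite in_setI => /andP[eG /cross1P[u uU eE]].
move: (hU _ uU) => /eqP; rewrite cards_eq0 => /eqP/setP/(_ w).
by rewrite in_setI !inE aw -eE eG.
Qed.

Lemma Ex_mem e : e \in Kn n -> Ex p (Kn n) (fun G => (e \in G)%:R) = p.
Proof.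
move=> eK; rewrite -[RHS]expr1 -(cards1 e) -(Ex_subset p (E := Kn n)) ?sub1set //.
by apply: eq_Ex => G _; rewrite sub1set.
Qed.

Lemma set2_Kn a b : a != b -> [set a; b] \in Kn n.
Proof. by move=> ab; rewrite inE cards2 ab. Qed.

Let Dstar (U J : {set 'I_n}) := \bigcup_(w in J) cross U [set w].

Lemma star_dep a (U J : {set 'I_n}) :
  depends_on (Dstar (a |: U) J) (fun G => \prod_(w in J) star_weight (0 : R) a U w G).
Proof. by apply: prod_star_weight_dep => w wJ; apply: (bigcup_sup w). Qed.

Lemma disjoint_star (e U J : {set 'I_n}) : [disjoint e & J] -> [disjoint [set e] & Dstar U J].
Proof.
move=> dJ; rewrite disjoints1; apply/negP => /bigcupP[w wJ /cross1P[u uU eE]].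
by have := disjointFl dJ wJ; rewrite eE !inE eqxx orbT.
Qed.

Lemma Ex_lone_edge a b : a != b ->
  Ex p (Kn n) (lone_edge a b) = p * (1 - p ^+ 2) ^+ (n - 2).
Proof.
move=> ab; set J := ~: [set a; b].
have dJ : [disjoint [set a; b] & J] by rewrite -setI_eq0 setICr.
rewrite (eq_Ex p (g := fun G => ([set a; b] \in G)%:R * \prod_(w in J) star_weight (0 : R) a [set b] w G)).
  rewrite (Ex_indep _ _ (disjoint_star (a |: [set b]) dJ)); last exact: star_dep.
    rewrite Ex_mem ?set2_Kn // Ex_star_weight ?inE //; last by rewrite disjoint_sym.
    rewrite cards1 expr1 mulr0 addr0 cardsCs setCK card_ord cards2 ab; congr (_ * _ ^+ _); ring.
  by move=> G; rewrite in_setI set11 andbT.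
move=> G GK; rewrite /lone_edge; case abG: (_ \in G); rewrite ?mul0r //= mul1r.
have [/eqP c0|/eqP c0] := boolP (codeg G a b == 0%N).
  by rewrite prod_star_weight1 // => u; rewrite inE => /eqP->.
have /set0Pn[w] : nbr G a :&: nbr G b != set0 by rewrite -cards_eq0; apply/eqP.
rewrite in_setI => /andP[aw bw].
have wJ : w \in J.
  by rewrite !inE negb_or ![w == _]eq_sym (nbr_neq GK aw) (nbr_neq GK bw).
rewrite (bigD1 w) //= /star_weight (_ : [set a; w] \in G); last by move: aw; rewrite inE.
rewrite (_ : G :&: _ = [set [set b; w]]) ?cards1 ?expr1 ?mul0r //.
apply/setP => e; rewrite in_setI in_set1; apply/andP/eqP => [[_ /cross1P[u /set1P-> ->]]//|->].
by split; [move: bw; rewrite inE|apply/cross1P; exists b; rewrite ?set11].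
Qed.

(** Testing only common neighbours outside the four vertices weakens the event, but leaves two
    conditions on disjoint edge sets, hence independent. *)
Lemma Ex_lone_disjoint a b c d : a != b -> c != d -> a != c -> a != d -> b != c -> b != d ->
  Ex p (Kn n) (fun G => lone_edge a b G * lone_edge c d G) <= p ^+ 2 * (1 - p ^+ 2) ^+ (2 * (n - 4)).
Proof.
move=> ab cd ac ad bc bd; set J := ~: ([set a; b] :|: [set c; d]).
have dJ1 : [disjoint [set a; b] & J] by rewrite disjoints_subset /J setCK subsetUl.
have dJ2 : [disjoint [set c; d] & J] by rewrite disjoints_subset /J setCK subsetUr.
have cJ : #|J| = (n - 4)%N.
  rewrite cardsCs setCK card_ord cardsU !cards2 ab cd.
  rewrite (_ : [set a; b] :&: [set c; d] = set0) ?cards0 //.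
  apply/setP => x; rewrite !inE; apply/negP => /andP[/orP[]/eqP-> /orP[]/eqP e];
    by rewrite e eqxx in ac ad bc bd.
pose f1 G : R := ([set a; b] \in G)%:R * \prod_(w in J) star_weight (0 : R) a [set b] w G.
pose f2 G : R := ([set c; d] \in G)%:R * \prod_(w in J) star_weight (0 : R) c [set d] w G.
have Ef1 : Ex p (Kn n) f1 = p * (1 - p ^+ 2) ^+ (n - 4).
  rewrite (Ex_indep _ _ (disjoint_star (a |: [set b]) dJ1)); last exact: star_dep.
    rewrite Ex_mem ?set2_Kn // Ex_star_weight ?inE //; last by rewrite disjoint_sym.
    rewrite cards1 expr1 mulr0 addr0 cJ; congr (_ * _ ^+ _); ring.
  by move=> G; rewrite in_setI set11 andbT.
have Ef2 : Ex p (Kn n) f2 = p * (1 - p ^+ 2) ^+ (n - 4).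
  rewrite (Ex_indep _ _ (disjoint_star (c |: [set d]) dJ2)); last exact: star_dep.
    rewrite Ex_mem ?set2_Kn // Ex_star_weight ?inE //; last by rewrite disjoint_sym.
    rewrite cards1 expr1 mulr0 addr0 cJ; congr (_ * _ ^+ _); ring.
  by move=> G; rewrite in_setI set11 andbT.
have -> : p ^+ 2 * (1 - p ^+ 2) ^+ (2 * (n - 4)) = Ex p (Kn n) (fun G => f1 G * f2 G).
  rewrite (Ex_indep _ _ (D1 := [set a; b] |: Dstar (a |: [set b]) J) (D2 := [set c; d] |: Dstar (c |: [set d]) J)).
  - by rewrite Ef1 Ef2 -[RHS]expr2 exprMn -exprM mulnC.
  - rewrite -setI_eq0; apply/eqP/setP => e; rewrite in_setI !in_setU1 in_set0; apply/negP.
    case/andP => /orP[/eqP->|e1] /orP[/eqP|e2].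
    + by case/set2_eq => -[e3 e4]; move: ac ad; rewrite ?e3 eqxx.
    + by have := disjoint_star (c |: [set d]) dJ1; rewrite disjoints1 e2.
    + by move=> eE; have := disjoint_star (a |: [set b]) dJ2; rewrite disjoints1 -eE e1.
    case/bigcupP: e1 => w wJ /cross1P[u uU ->] in e2 *.
    case/bigcupP: e2 => w' wJ' /cross1P[u' uU'] /set2_eq[] [e3 e4].
      move: uU uU'; rewrite !inE e3 => /orP[]/eqP-> /orP[]/eqP e5; by rewrite e5 eqxx in ac ad bc bd.
    by have := disjointFr dJ1 uU; rewrite e3 wJ'.
  - apply: depends_onM; [apply: (@depends_onS _ _ [set [set a; b]]) | apply: depends_onS (star_dep _ _ _)].
    + by rewrite sub1set setU11.
    + by move=> G; rewrite in_setI set11 andbT.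
    + exact: subsetUr.
  - apply: depends_onM; [apply: (@depends_onS _ _ [set [set c; d]]) | apply: depends_onS (star_dep _ _ _)].
    + by rewrite sub1set setU11.
    + by move=> G; rewrite in_setI set11 andbT.
    + exact: subsetUr.
apply: le_Ex => // G GK; rewrite /lone_edge /f1 /f2.
have sw x U w : 0 <= star_weight (0 : R) x U w G by rewrite /star_weight; case: ifP => // _; rewrite exprn_ge0.
have [/andP[-> /eqP h1]|_] := boolP (([set a; b] \in G) && _); last first.
  by rewrite mul0r !mulr_ge0 // prodr_ge0.
have [/andP[-> /eqP h2]|_] := boolP (([set c; d] \in G) && _); last first.
  by rewrite mulr0 !mulr_ge0 // prodr_ge0.
by rewrite !prod_star_weight1 ?mulr1 // => u; rewrite inE => /eqP->.
Qed.

(** Each outside vertex [w] must miss [a], or miss both [b] and [d]. *)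
Lemma Ex_lone_adjacent a b d : a != b -> a != d -> b != d ->
  Ex p (Kn n) (fun G => lone_edge a b G * lone_edge a d G) <=
  p ^+ 2 * (1 - p + p * (1 - p) ^+ 2) ^+ (n - 3).
Proof.
move=> ab ad bd; set J := ~: [set a; b; d].
have dJ : [disjoint J & a |: [set b; d]] by rewrite setUA disjoint_sym -subsets_disjoint.
have aU : a \notin [set b; d] by rewrite !inE negb_or ab ad.
have nE : [set a; b] != [set a; d].
  by apply/eqP => /set2_eq[] [e1 e2]; [rewrite e2 eqxx in bd | rewrite e1 eqxx in ad].
pose D := [set [set a; b]; [set a; d]].
have -> : p ^+ 2 * (1 - p + p * (1 - p) ^+ 2) ^+ (n - 3) =
   Ex p (Kn n) (fun G => (D \subset G)%:R * \prod_(w in J) star_weight (0 : R) a [set b; d] w G).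
  rewrite (Ex_indep _ _ (D1 := D) (D2 := Dstar (a |: [set b; d]) J)); last exact: star_dep.
  - rewrite Ex_subset ?subUset ?sub1set ?set2_Kn // Ex_star_weight // !cards2 nE bd mulr0 addr0.
    by rewrite cardsCs setCK card_ord -setUA cardsU1 aU cards2 bd.
  - rewrite -setI_eq0; apply/eqP/setP => e; rewrite in_setI in_set0; apply/negP => /andP[].
    rewrite !inE => /orP[]/eqP-> /bigcupP[w wJ /cross1P[u uU /set2_eq[] [e1 e2]]];
    by move: wJ; rewrite !inE -?e1 -?e2 eqxx ?orbT.
  - by move=> G; rewrite subsetI subxx andbT.
apply: le_Ex => // G GK; rewrite /lone_edge.
have sw x U w : 0 <= star_weight (0 : R) x U w G by rewrite /star_weight; case: ifP => // _; rewrite exprn_ge0.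
have [/andP[abG /eqP h1]|_] := boolP (([set a; b] \in G) && _); last first.
  by rewrite mul0r mulr_ge0 // prodr_ge0.
have [/andP[adG /eqP h2]|_] := boolP (([set a; d] \in G) && _); last first.
  by rewrite mulr0 mulr_ge0 // prodr_ge0.
rewrite prod_star_weight1 => [|u]; last by rewrite !inE => /orP[]/eqP->.
by rewrite /D subUset !sub1set abG adG !mulr1.
Qed.

(** [e1] is the probability that a given pair is a lone edge; [Dd] and [A] bound the joint
    probability for disjoint and for adjacent pairs; [N] counts ordered pairs, so every lone edge is
    counted twice. *)
Local Notation e1 := (p * (1 - p ^+ 2) ^+ (n - 2)).
Local Notation Dd := (p ^+ 2 * (1 - p ^+ 2) ^+ (2 * (n - 4))).
Local Notation A := (p ^+ 2 * (1 - p + p * (1 - p) ^+ 2) ^+ (n - 3)).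
Local Notation N := ((n * n.-1)%:R : R).

Let q0 : 0 <= 1 - p ^+ 2.
Proof. by case/andP: p01 => p0 p1; rewrite subr_ge0 exprn_ile1. Qed.
Let e1_ge0 : 0 <= e1. Proof. by case/andP: p01 => p0 _; rewrite mulr_ge0 ?exprn_ge0. Qed.
Let Dd_ge0 : 0 <= Dd. Proof. by rewrite mulr_ge0 ?sqr_ge0 ?exprn_ge0. Qed.
Let A_ge0 : 0 <= A.
Proof.
case/andP: p01 => p0 p1; rewrite mulr_ge0 ?sqr_ge0 ?exprn_ge0 // addr_ge0 ?subr_ge0 //.
by rewrite mulr_ge0 ?sqr_ge0.
Qed.

(** One bound for all overlaps: the indicators are easy to sum over [(c, d)], giving 4 n for shared
    vertices and 2 for equal edges. *)
Lemma Ex_lone_pair a b c d : a != b -> c != d ->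
  Ex p (Kn n) (fun G => lone_edge a b G * lone_edge c d G) <=
  Dd + ((c == a) + (c == b) + (d == a) + (d == b))%:R * A + (((c, d) == (a, b)) + ((c, d) == (b, a)))%:R * e1.
Proof.
move=> ab cd.
have same x y : x != y -> Ex p (Kn n) (fun G => lone_edge x y G * lone_edge x y G) <= e1.
  move=> xy; rewrite -(Ex_lone_edge xy); apply: le_Ex => // G _.
  by rewrite /lone_edge; case: (_ && _); rewrite ?mul0r ?mulr1.
have fin (m : nat) (j : nat) x : x <= Dd \/ ((0 < m)%N /\ x <= A) \/ ((0 < j)%N /\ x <= e1) ->
    x <= Dd + m%:R * A + j%:R * e1.
  have mA : 0 <= m%:R * A by rewrite mulr_ge0.
  have je : 0 <= j%:R * e1 by rewrite mulr_ge0.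
  case=> [h|[[m0 h]|[j0 h]]].
  - have := Dd_ge0; lra.
  - have : 1 * A <= m%:R * A by rewrite ler_wpM2r // ler1n.
    have := Dd_ge0; lra.
  have : 1 * e1 <= j%:R * e1 by rewrite ler_wpM2r // ler1n.
  have := Dd_ge0; lra.
apply: fin.
have flip x y z t : Ex p (Kn n) (fun G => lone_edge x y G * lone_edge z t G) =
    Ex p (Kn n) (fun G => lone_edge x y G * lone_edge t z G).
  by apply: eq_Ex => G _; rewrite [lone_edge z t G]lone_edgeC.
have flip' x y z t : Ex p (Kn n) (fun G => lone_edge x y G * lone_edge z t G) =
    Ex p (Kn n) (fun G => lone_edge y x G * lone_edge z t G).
  by apply: eq_Ex => G _; rewrite [lone_edge x y G]lone_edgeC.
have [ca|ca] := eqVneq c a.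
  subst c; have [db|db] := eqVneq d b.
    by subst d; right; right; rewrite eqxx; split=> //; apply: same.
  by right; left; split=> //; apply: Ex_lone_adjacent => //; rewrite eq_sym.
have [cb|cb] := eqVneq c b.
  subst c; have [da|da] := eqVneq d a.
    subst d; right; right; rewrite eqxx addn1; split=> //; rewrite flip; exact: same.
  right; left; split=> //; rewrite flip'; by apply: Ex_lone_adjacent; rewrite 1?eq_sym // eq_sym.
have [da|da] := eqVneq d a.
  subst d; right; left; split=> //; rewrite flip; apply: Ex_lone_adjacent => //; by rewrite eq_sym.
have [db|db] := eqVneq d b.
  subst d; right; left; split=> //; rewrite flip flip'; by apply: Ex_lone_adjacent; rewrite 1?eq_sym // eq_sym.
by left; apply: Ex_lone_disjoint => //; rewrite eq_sym.
Qed.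

Let ok (i : 'I_n * 'I_n) := i.1 != i.2.

Let card_ok : #|ok| = (n * n.-1)%N.
Proof.
have := cardC (fun i : 'I_n * 'I_n => i.1 == i.2); rewrite card_prod card_ord.
have -> : #|(fun i : 'I_n * 'I_n => i.1 == i.2)| = n.
  have -> : #|(fun i : 'I_n * 'I_n => i.1 == i.2)| = #|[set (x, x) | x : 'I_n]|.
    apply: eq_card => -[x y]; rewrite unfold_in /=; apply/eqP/imsetP => [/= ->|[z _ [-> ->]]//].
    by exists y.
  by rewrite card_imset ?card_ord // => x y [].
have -> : #|predC (fun i : 'I_n * 'I_n => i.1 == i.2)| = #|ok| by apply: eq_card.
move: #|ok| => m; case: n => [|k] /=; nia.
Qed.

(** Chebyshev's inequality: under [Q] the count [X] vanishes, so it deviates from its mean by the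
    whole mean. *)
Lemma lone_edges_second_moment : 0 < e1 -> (1 < n)%N -> Pr_Gnp p (@Q n) * (N * e1) ^+ 2 <=
  N ^+ 2 * (Dd - e1 ^+ 2) + 4 * n%:R * N * A + 2 * N * e1.
Proof.
move=> e10 n1.
pose X (G : {set {set 'I_n}}) : R := \sum_(i | ok i) lone_edge i.1 i.2 G.
have EX : Ex p (Kn n) X = N * e1.
  rewrite /X Ex_sum (eq_bigr (fun=> e1)) => [|[a b] ab]; last exact: Ex_lone_edge.
  by rewrite sumr_const card_ok mulr_natl.
have EX2 : Ex p (Kn n) (fun G => X G * X G) <= N * (N * Dd + 4 * n%:R * A + 2 * e1).
  rewrite (eq_Ex p (g := fun G => \sum_(i | ok i) \sum_(j | ok j) lone_edge i.1 i.2 G * lone_edge j.1 j.2 G)).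
    rewrite Ex_sum; apply: (@le_trans _ _ (\sum_(i | ok i) (N * Dd + 4 * n%:R * A + 2 * e1))); last first.
      by rewrite sumr_const card_ok -[leLHS]mulr_natl.
    apply: ler_sum => -[a b] ab; rewrite Ex_sum.
    apply: (@le_trans _ _ (\sum_(j | ok j) (Dd + ((j.1 == a) + (j.1 == b) + (j.2 == a) + (j.2 == b))%:R * A +
        ((j == (a, b)) + (j == (b, a)))%:R * e1))).
      by apply: ler_sum => -[c d] cd; apply: Ex_lone_pair.
    rewrite !big_split /= sumr_const card_ok; apply: lerD; [apply: lerD|].
    - by rewrite -[leLHS]mulr_natl.
    - rewrite -mulr_suml ler_wpM2r // -natr_sum -natrM ler_nat.
      apply: (@leq_trans (\sum_(j : 'I_n * 'I_n) ((j.1 == a) + (j.1 == b) + (j.2 == a) + (j.2 == b)))).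
        by rewrite [leqRHS](bigID ok) leq_addr.
      have s1 x : (\sum_(j : 'I_n * 'I_n) (j.1 == x) = n)%N.
        rewrite -(pair_big predT predT (fun i j => (i == x) : nat)) /=.
        under eq_bigr do rewrite sum_nat_const card_ord.
        by rewrite -big_distrr /= (bigD1 x) //= eqxx big1 ?muln1 // => y /negPf->.
      have s2 x : (\sum_(j : 'I_n * 'I_n) (j.2 == x) = n)%N.
        rewrite -(pair_big predT predT (fun i j => (j == x) : nat)) /=.
        rewrite exchange_big /=; under eq_bigr do rewrite sum_nat_const card_ord.
        by rewrite -big_distrr /= (bigD1 x) //= eqxx big1 ?muln1 // => y /negPf->.
      by rewrite !big_split /= !s1 !s2 !mulSn mul0n addn0 !addnA.
    rewrite -mulr_suml ler_wpM2r // -natr_sum ler_nat.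
    apply: (@leq_trans (\sum_(j : 'I_n * 'I_n) ((j == (a, b)) + (j == (b, a))))).
      by rewrite [leqRHS](bigID ok) leq_addr.
    have s x : (\sum_(j : 'I_n * 'I_n) (j == x) = 1)%N.
      by rewrite (bigD1 x) //= eqxx big1 // => y /negPf->.
    by rewrite big_split /= !s.
  by move=> G _; rewrite /X mulr_suml; apply: eq_bigr => i _; rewrite mulr_sumr.
have N0 : 0 < N * e1 by rewrite mulr_gt0 // ltr0n muln_gt0; lia.
set mu := N * e1 in EX N0 *.
have hP : Pr_Gnp p (@Q n) * mu ^+ 2 <= Ex p (Kn n) (fun G => (X G - mu) ^+ 2).
  rewrite Pr_GnpE -ExZr; apply: le_Ex => // G GK; case: asboolP => [QG|_]; last first.
    by rewrite mul0r sqr_ge0.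
  rewrite (_ : X G = 0) ?mul1r ?sub0r ?sqrrN //; apply: big1 => -[a b] _; rewrite /lone_edge /=.
  case abG: (_ \in G) => //=; case: eqP => // /eqP; rewrite cards_eq0 => /eqP c0.
  have [t [[x [y [z [xy yz xz tE /subsetP tG]]]] abt]] := QG _ abG.
  have sub3 : [set a; b] \subset [set x; y; z].
    move: abt; rewrite tE !inE => /orP[/orP[]|] /eqP->; apply/subsetP => v;
      by rewrite !inE => /orP[]->; rewrite ?orbT.
  have all3 u v : u \in [set x; y; z] -> v \in [set x; y; z] -> u != v -> [set u; v] \in G.
    have xyG : [set x; y] \in G by apply: tG; rewrite tE !inE eqxx.
    have yzG : [set y; z] \in G by apply: tG; rewrite tE !inE eqxx orbT.
    have xzG : [set x; z] \in G by apply: tG; rewrite tE !inE eqxx orbT.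
    rewrite !inE => /orP[/orP[]|]/eqP-> /orP[/orP[]|]/eqP->; rewrite ?eqxx // => _.
    + by rewrite setUC.
    + by rewrite setUC.
    + by rewrite setUC.
  have : ~~ ([set x; y; z] \subset [set a; b]).
    apply/negP => /subset_leq_card; rewrite -setUA cardsU1 cards2 !inE negb_or xy xz yz cards2.
    by case: (a != b).
  case/subsetPn => w w3; rewrite !inE negb_or => /andP[wa wb].
  have ha : a \in [set x; y; z] by apply: (subsetP sub3); rewrite !inE eqxx.
  have hb : b \in [set x; y; z] by apply: (subsetP sub3); rewrite !inE eqxx orbT.
  have : w \in nbr G a :&: nbr G b by rewrite !inE !all3 // eq_sym.
  by rewrite c0 inE.
apply: le_trans hP _.
have -> : Ex p (Kn n) (fun G => (X G - mu) ^+ 2) = Ex p (Kn n) (fun G => X G * X G) - mu ^+ 2.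
  rewrite (eq_Ex p (g := fun G => X G * X G + (mu ^+ 2 - 2 * mu * X G))) => [|G _]; last by ring.
  by rewrite ExD ExB Ex_const ExZ EX; ring.
rewrite /mu; move: EX2; set E := Ex _ _ _ => EX2.
rewrite (_ : N ^+ 2 * (Dd - e1 ^+ 2) + 4 * n%:R * N * A + 2 * N * e1 =
  N * (N * Dd + 4 * n%:R * A + 2 * e1) - (N * e1) ^+ 2); last by ring.
by rewrite lerD2r.
Qed.

End LoneEdges.

(** * Conclusion *)

Section MinimalCocycle.
Variables (n : nat) (G : {set {set 'I_n}}).
Hypothesis GK : G \subset Kn n.
Implicit Types (F : {set {set 'I_n}}) (A B : {set 'I_n}).

Lemma cut_edges_even A t : triangle_of G t -> ~~ odd #|cut_edges G A :&: t|.
Proof.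
move=> tG; have [s [us s3 ts tsub]] := triangle_cycle tG.
have := cycle_cut_even A us s3; rewrite -ts.
rewrite (_ : [set e in t | _] = cut_edges G A :&: t) //; apply/setP => e; rewrite !inE.
by case eT: (e \in t); rewrite ?andbF //= (subsetP tsub _ eT) andbT.
Qed.

Lemma cocycle_symd F A : cocycle G F -> cocycle G (symd F (cut_edges G A)).
Proof.
move=> cF; split=> [|t tG].
  by apply/subsetP => e; rewrite in_symd [e \in cut_edges _ _]inE; case: (boolP (e \in F)) => [/(subsetP cF.1)//|_ /andP[]].
by rewrite odd_symd_setI (negPf (cF.2 _ tG)) (negPf (cut_edges_even _ tG)).
Qed.

Lemma cut_edges_symd A B : symd (cut_edges G A) (cut_edges G B) = cut_edges G (symd A B).
Proof.
apply/setP => e; rewrite in_symd ![e \in cut_edges _ _]inE; case eG: (e \in G) => //=.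
have := subsetP GK _ eG; rewrite inE => /cards2P[x [y [xy ->]]].
by rewrite !card_set2I // !in_symd; case: (x \in A); case: (x \in B); case: (y \in A); case: (y \in B).
Qed.

Lemma card_cut1 (F : {set {set 'I_n}}) v : F \subset Kn n -> #|F :&: cut_edges (Kn n) [set v]| = #|nbr F v|.
Proof.
move=> FK; have <- : nbr F v :&: ~: [set v] = nbr F v.
  by apply/setIidPl/subsetP => x vx; rewrite !inE eq_sym (nbr_neq FK vx).
rewrite card_nbrI ?inE ?eqxx //; apply: eq_card => e; rewrite !in_setI [e \in cut_edges _ _]inE.
case eF: (e \in F) => //=; rewrite (subsetP FK _ eF) /=.
have := subsetP FK _ eF; rewrite inE => /cards2P[x [y [xy ->]]]; rewrite card_set2I // !inE.
apply/idP/crossP => [|[a [b [/set1P-> bv]]] /set2_eq[] [-> ->]].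
- have [xv|xv] := eqVneq x v => /= yv.
    by exists v, y; rewrite -xv set11 !inE eq_sym.
  by exists v, x; rewrite (eqP yv) set11 !inE xv setUC.
- by rewrite eqxx; move: bv; rewrite !inE => /negPf->.
by rewrite eqxx; move: bv; rewrite !inE => /negPf->.
Qed.

Lemma sum_nbr_le F : F \subset Kn n -> (\sum_v #|nbr F v| <= 2 * #|F|)%N.
Proof.
move=> FK; apply: leq_trans (leq_trans (sum_nbrI_le setT FK) _).
  rewrite [leqRHS](eq_bigl xpredT) => [|v]; last by rewrite inE.
  by apply: leq_sum => v _; rewrite setTI.
by rewrite leq_mul2l subset_leq_card ?subsetIl.
Qed.

(* The degree bound is minimality against adding the cut around [v]. *)
Lemma exists_minimal_cocycle F : cocycle G F -> exists A, let F' := symd F (cut_edges G A) in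
  [/\ cocycle G F', forall v, (2 * #|nbr F' v| <= #|nbr G v|)%N
    & forall B, (#|F'| <= #|symd F (cut_edges G B)|)%N].
Proof.
move=> cF; have [A _ minA] := @arg_minnP _ set0 xpredT (fun A => #|symd F (cut_edges G A)|) isT.
exists A => F'; have cF' := cocycle_symd A cF; split=> // [v|B]; last exact: minA.
have FG := cF'.1; have FK : F' \subset Kn n := subset_trans FG GK.
have cutI (H : {set {set 'I_n}}) : H \subset G -> #|H :&: cut_edges G [set v]| = #|nbr H v|.
  move=> HG; rewrite -(card_cut1 v (subset_trans HG GK)); apply: eq_card => e.
  rewrite !in_setI ![e \in cut_edges _ _]inE; case eH: (e \in H) => //=.
  by rewrite (subsetP HG _ eH) (subsetP GK) // (subsetP HG _ eH).
have : (#|F'| <= #|symd F' (cut_edges G [set v])|)%N.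
  by rewrite /F' -symdA cut_edges_symd; apply: minA.
have := card_symd F' (cut_edges G [set v]); rewrite (cutI _ FG).
have <- : #|cut_edges G [set v]| = #|nbr G v|.
  rewrite -(cutI _ (subxx G)) (setIidPr _) //.
  by apply/subsetP => e; rewrite inE => /andP[].
rewrite -muln2; move: #|symd F' _| #|nbr F' v| #|F'| #|cut_edges G _| => a b c d; lia.
Qed.

End MinimalCocycle.

(** * Choice of constants and the dense case *)

Section DenseRegime.
Variable R : realType.

(** [gam] and [rho] are the values for which [whp_sparse] holds with [m = gam * D], [u = L] and with
    [m = rho * n], [u = D]. The last constant makes 2 eps n^2 p equal to the bound
    [rho * gam * n * D] required of [F]. *)
Let kap : R := 1 / 6000.
Let gam : R := expR (- (8 / kap)).
Let kap' : R := gam / 90.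
Let rho : R := expR (- (8 / kap')).
Let eps : R := rho * gam / 2.

Lemma whp_triangle_space : whp (fun n (p : R) (G : {set {set 'I_n}}) => Q G ->
  forall X, triangle_space G X <-> cycle_space G X).
Proof.
have g0 : 0 < gam := expR_gt0 _.
have r0 : 0 < rho := expR_gt0 _.
have kap0 : 0 < kap by rewrite /kap; lra.
have kap'0 : 0 < kap' by rewrite /kap'; lra.
have g1 : gam <= 1.
  by rewrite /gam -[leRHS]expR0 ler_expR oppr_le0 divr_ge0 // ltW.
have r1 : rho <= 1.
  by rewrite /rho -[leRHS]expR0 ler_expR oppr_le0 divr_ge0 // ltW.
have e01 : 0 < eps <= 1.
  rewrite /eps divr_gt0 ?mulr_gt0 //=.
  have : rho * gam <= 1 * 1 by rewrite ler_pM // ltW.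
  lra.
have reg : dense_regime (fun n (p : R) => [/\ 0 <= p <= 1, 7 / 5 * ln n%:R <= n%:R * p ^+ 2 & 1 <= ln n%:R :> R]).
  by apply: dense_regimeW (dense_regime_and (dense_regime_p01 R) (dense_regime_ln 1)) => n p [[]].
have s1 : whp (fun n (p : R) G => sparse_subsets G (gam * (n%:R * p)) kap (n%:R * p ^+ 2)).
  apply: whp_sparse => //; apply: dense_regimeW reg => n p [_ hL _]; split=> //.
  by rewrite /gam le_eqVlt; apply/orP; left; apply/eqP; ring.
have s2 : whp (fun n (p : R) G => sparse_subsets G (rho * n%:R) kap' (n%:R * p)).
  apply: whp_sparse => //; apply: dense_regimeW reg => n p [/andP[p0 p1] hL _]; split=> //.
    apply: le_trans hL _; rewrite ler_wpM2l // expr2 ler_piMr //.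
  by rewrite /rho le_eqVlt; apply/orP; left; apply/eqP; ring.
apply: (whp_regime reg).
have W := whp_and (@whp_degree R) (whp_and (@whp_isolated_low R) (whp_and (whp_link_expansion g0)
  (whp_and (whp_near_cut e01) (whp_and s1 s2)))).
apply: whpW W.
move=> n p G p01 GK [hdeg [hlow [hexp [hcut [hs1 hs2]]]]] [_ hL l1] QG.
have n0 : (0 < n)%N by apply: (@nat_gt0_ln R); lra.
have nR : 0 < n%:R :> R by rewrite ltr0n.
have L0 : 0 < n%:R * p ^+ 2 by lra.
have p0 : 0 < p.
  have /andP[p0 _] := p01; rewrite lt_neqAle p0 andbT; apply/eqP => h.
  by move: L0; rewrite -h expr0n mulr0 ltxx.
apply: contrapT => /exists_noncut_cocycle [F [cF nF]].
have [A [cF' hmin mF]] := exists_minimal_cocycle GK cF.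
apply: (nF A); set F' := symd F _ in cF' hmin mF.
suff F0 : F' = set0.
  by rewrite -(symdK (cut_edges G A) F) [X in symd _ X]symdC -/F' F0 symdC symd0.
have [B hB] := hcut _ cF.
have FK : F' \subset Kn n := subset_trans cF'.1 GK.
apply: (@small_cocycle_eq0 R n G F' GK cF' (n%:R * p) (n%:R * p ^+ 2) gam rho) => //.
  by rewrite mulr_gt0.
rewrite -natr_sum; apply: (@le_trans _ _ (2 * #|F'|)%:R).
  by rewrite ler_nat sum_nbr_le.
rewrite natrM; apply: (@le_trans _ _ (2 * (eps * n%:R ^+ 2 * p))).
  by rewrite ler_wpM2l //; apply: le_trans (ltW hB); rewrite ler_nat mF.
by rewrite /eps le_eqVlt; apply/orP; left; apply/eqP; field.
Qed.

End DenseRegime.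

(** Without triangles [Q] leaves no edge, hence no cycle, and both spaces are trivial. *)
Lemma Q_has_triangle n (G : {set {set 'I_n}}) : Q G ->
  ~ (forall X, triangle_space G X <-> cycle_space G X) -> exists t, triangle_of G t.
Proof.
move=> QG nTC; apply: contrapT => nt; apply: nTC => X; split.
  by apply: span2_mono; apply: triangle_cycle.
move=> [K [KC XK]]; exists K; split=> // C CK.
have [s [us s3 Cs CG]] := KC _ CK; exfalso; apply: nt.
case: s s3 Cs us => [|x [|y s]] // _ Cs _.
have xyG : [set x; y] \in G.
  apply: (subsetP CG); rewrite Cs; apply/imsetP; exists (x, y) => //.
  by rewrite /= inE eqxx.
by have [t [tG _]] := QG _ xyG; exists t.
Qed.

Lemma pairs_set3 n (a b c : 'I_n) : a != b -> b != c -> a != c ->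
  pairs [set a; b; c] = [set [set a; b]; [set b; c]; [set a; c]].
Proof.
move=> ab bc ac; apply/setP => e; apply/idP/idP; last first.
  rewrite !inE => /orP[/orP[]|] /eqP->; rewrite subUset !sub1set !inE !eqxx ?orbT cards2.
  - by rewrite ab.
  - by rewrite bc.
  - by rewrite ac.
rewrite inE => /andP[es /cards2P[x [y [xy eE]]]]; move: es; rewrite eE subUset !sub1set !inE.
case/andP => /orP[/orP[]|] /eqP xE /orP[/orP[]|] /eqP yE; subst x y; rewrite ?eqxx ?orbT //;
  try by rewrite eqxx in xy.
- by rewrite [[set b; a]]setUC eqxx.
- by rewrite [[set c; a]]setUC eqxx ?orbT.
- by rewrite [[set c; b]]setUC eqxx ?orbT.
Qed.

Lemma Pr_triangle_le (R : realType) n (p : R) : 0 <= p <= 1 ->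
  Pr_Gnp p (fun G : {set {set 'I_n}} => exists t, triangle_of G t) <= (n%:R * p) ^+ 3.
Proof.
move=> p01; have /andP[p0 p1] := p01.
pose ok (q : 'I_n * 'I_n * 'I_n) := [&& q.1.1 != q.1.2, q.1.2 != q.2 & q.1.1 != q.2].
pose D (q : 'I_n * 'I_n * 'I_n) := pairs [set q.1.1; q.1.2; q.2].
apply: (@le_trans _ _ (Ex p (Kn n) (fun G => \sum_(q | ok q) (D q \subset G)%:R))).
  apply: Pr_Gnp_le_Ex => // [G _|G GK [t [a [b [c [ab bc ac tE tG]]]]]]; first exact: sumr_ge0.
  rewrite (bigD1 (a, b, c)) /=; last by rewrite /ok /= ab bc ac.
  rewrite -[leLHS]addr0; apply: lerD; last exact: sumr_ge0.
  suff -> : D (a, b, c) \subset G by [].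
  by rewrite /D /= pairs_set3 // -tE.
rewrite Ex_sum; apply: (@le_trans _ _ (\sum_(q : 'I_n * 'I_n * 'I_n) p ^+ 3)).
  rewrite big_mkcond; apply: ler_sum => -[[a b] c] _; case: ifP => [/and3P[/= ab bc ac]|_].
    by rewrite Ex_subset ?pairs_Kn // card_pairs set3_card.
  by rewrite exprn_ge0.
rewrite sumr_const !card_prod card_ord -[leLHS]mulr_natl !natrM le_eqVlt.
by apply/orP; left; apply/eqP; ring.
Qed.


(** * Asymptotics of the second moment *)

Section SparseRegime.
Variable R : realType.
Implicit Types (n : nat) (p eps : R).

Lemma expR_ge_pow5 (x : R) : 0 <= x -> x ^+ 5 / 120 <= expR x.
Proof. by move=> x0; apply: le_trans (expR_ge1Dxn 4 x0); rewrite lerDr. Qed.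

(** For x = p^2 at most 1/4, 1 - x is at least exp(- x - 2 x^2), and the accumulated error 2 n p^4
    is at most 1 because n p^3 is bounded. *)
Lemma power_lower (n : nat) (p : R) : 0 <= p <= 1 / 2 -> n%:R * p ^+ 3 <= 1 / 2 ->
  expR (- (n%:R * p ^+ 2) - 1) <= (1 - p ^+ 2) ^+ n.
Proof.
move=> /andP[p0 p1] np3; set x := p ^+ 2; have x0 : 0 <= x by apply: sqr_ge0.
have x1 : x <= 1 / 4 by rewrite /x expr2; nra.
have h : expR (- (x + 2 * x ^+ 2)) <= 1 - x.
  have e1 := expR_ge1Dx (x + 2 * x ^+ 2); have e2 := expR_gt0 (x + 2 * x ^+ 2).
  rewrite expRN -[1 - x]invrK lef_pV2 ?posrE ?invr_gt0 //; last lra.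
  apply: le_trans e1; rewrite -[leLHS]mul1r ler_pdivrMr; last lra.
  rewrite expr2; nra.
have x0' : 0 <= 1 - x by lra.
have h2 : expR (n%:R * (- (x + 2 * x ^+ 2))) <= (1 - x) ^+ n.
  by rewrite expRM_natl lerXn2r ?nnegrE ?expR_ge0.
apply: le_trans h2; rewrite ler_expR.
have : n%:R * (2 * x ^+ 2) <= 1.
  rewrite (_ : n%:R * (2 * x ^+ 2) = 2 * (n%:R * p ^+ 3) * p); last by rewrite /x; ring.
  have : 0 <= n%:R * p ^+ 3 by rewrite mulr_ge0 ?exprn_ge0.
  nra.
rewrite mulrN mulrDr; lra.
Qed.

(** Adjacent pairs are correlated by a bounded factor only: 1 - 2 p^2 + p^3 differs from the square
    of 1 - p^2 by order p^3, and n p^3 is bounded. The 6 covers e <= 3 and the two missing factors 1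
    - p^2. *)
Lemma lone_ratio (n : nat) (p : R) : (4 <= n)%N -> 0 <= p <= 1 / 4 -> n%:R * p ^+ 3 <= 1 / 2 ->
  p ^+ 2 * (1 - p + p * (1 - p) ^+ 2) ^+ (n - 3) <= 6 * (p * (1 - p ^+ 2) ^+ (n - 2)) ^+ 2.
Proof.
move=> n4 /andP[p0 p1] np3.
set q := 1 - p ^+ 2; have p21 : p ^+ 2 <= 1 / 16 by rewrite expr2; nra.
have q0 : 0 <= q by rewrite /q; lra.
have p30 : 0 <= p ^+ 3 by rewrite exprn_ge0.
have r0 : 0 <= 1 - p + p * (1 - p) ^+ 2 by rewrite addr_ge0 ?mulr_ge0 ?sqr_ge0 //; lra.
have hr : 1 - p + p * (1 - p) ^+ 2 <= q ^+ 2 * (1 + 2 * p ^+ 3).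
  rewrite -subr_ge0 (_ : _ - _ = p ^+ 3 * (1 + p - 4 * p ^+ 2 + 2 * p ^+ 4)); last by rewrite /q; ring.
  rewrite mulr_ge0 //; have : 0 <= p ^+ 4 by rewrite exprn_ge0.
  lra.
have hr2 : (1 - p + p * (1 - p) ^+ 2) ^+ (n - 3) <= q ^+ (2 * (n - 3)) * 3.
  apply: (@le_trans _ _ ((q ^+ 2 * (1 + 2 * p ^+ 3)) ^+ (n - 3))).
    by rewrite lerXn2r ?nnegrE // mulr_ge0 ?sqr_ge0 //; lra.
  rewrite exprMn -exprM ler_wpM2l ?exprn_ge0 //.
  apply: le_trans (exprn_le_expR _ _) _; first lra.
  apply: le_trans (expR1_le R); rewrite ler_expR.
  apply: (@le_trans _ _ (n%:R * (2 * p ^+ 3))); last lra.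
  by rewrite ler_wpM2r ?mulr_ge0 // ler_nat leq_subr.
rewrite exprMn [leRHS]mulrCA ler_wpM2l ?sqr_ge0 // -exprM.
rewrite (_ : ((n - 2) * 2 = 2 * (n - 3) + 2)%N); last lia.
rewrite exprD; apply: le_trans hr2 _; rewrite mulrCA ler_wpM2l ?exprn_ge0 //.
have : 15 / 16 <= q by rewrite /q; lra.
rewrite expr2; nra.
Qed.

(** Disjoint pairs, adjacent pairs and the diagonal each contribute at most eps / 4 of the squared
    mean. *)
Lemma no_lone_edge_arith (N e1 Dd A x P eps : R) : 0 < eps <= 1 -> 0 < e1 -> 0 < N ->
  P * (N * e1) ^+ 2 <= N ^+ 2 * (Dd - e1 ^+ 2) + 4 * x * N * A + 2 * N * e1 ->
  Dd <= (1 + eps / 4) * e1 ^+ 2 -> A <= 6 * e1 ^+ 2 -> 0 <= x -> 96 * x <= eps * N ->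
  8 <= eps * N * e1 -> P <= 3 / 4 * eps.
Proof.
move=> /andP[e0 _] e10 N0 hP hD hA x0 hx h8.
have m0 : 0 < (N * e1) ^+ 2 by rewrite exprn_gt0 // mulr_gt0.
rewrite -(ler_pM2r m0); apply: le_trans hP _.
have N20 : 0 <= N ^+ 2 by apply: sqr_ge0.
have a1 : N ^+ 2 * (Dd - e1 ^+ 2) <= N ^+ 2 * (eps / 4 * e1 ^+ 2).
  by rewrite ler_wpM2l //; lra.
have a2 : 4 * x * N * A <= 4 * x * N * (6 * e1 ^+ 2).
  by rewrite ler_wpM2l // !mulr_ge0 // ltW.
have a3 : 96 * x * (N * e1 ^+ 2) <= eps * N * (N * e1 ^+ 2).
  by rewrite ler_wpM2r // mulr_ge0 ?sqr_ge0 // ltW.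
have a4 : 8 * (N * e1) <= eps * N * e1 * (N * e1).
  by rewrite ler_wpM2r // mulr_ge0 // ltW.
move: a1 a2 a3 a4.
rewrite (_ : N ^+ 2 * (eps / 4 * e1 ^+ 2) = 1 / 4 * (eps * (N * e1) ^+ 2)); last by field.
rewrite (_ : 4 * x * N * (6 * e1 ^+ 2) = 1 / 4 * (96 * x * (N * e1 ^+ 2))); last by field.
rewrite (_ : eps * N * (N * e1 ^+ 2) = eps * (N * e1) ^+ 2); last by ring.
rewrite (_ : eps * N * e1 * (N * e1) = eps * (N * e1) ^+ 2); last by ring.
rewrite (_ : 2 * N * e1 = 2 * (N * e1)); last by ring.
rewrite (_ : 3 / 4 * eps * (N * e1) ^+ 2 = 3 / 4 * (eps * (N * e1) ^+ 2)); last by ring.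
move: (N * e1) (eps * (N * e1) ^+ 2) (96 * x * (N * e1 ^+ 2)) (N ^+ 2 * (Dd - e1 ^+ 2)) (4 * x * N * A) => a b c d e; lra.
Qed.

(** The mean is of order n^2 p exp(- n p^2). If n p^2 <= 1, the exponential is bounded below and n^2
    p is at least eps n / 2. Otherwise n^2 p is at least n^(3/2) and the exponential loses n^(7/5)
    up to a constant, leaving n^(1/10). *)
Lemma lone_edge_count_large (n : nat) (p eps l : R) : 0 < eps <= 1 -> 0 <= p <= 1 / 4 ->
  (1 < n)%N -> n%:R = expR l -> (20 / eps) ^+ 2 <= n%:R -> 10 * (16 / eps) <= l ->
  n%:R * p ^+ 2 <= 7 / 5 * l -> eps / 2 <= n%:R * p -> n%:R * p ^+ 3 <= 1 / 2 ->
  8 <= eps * (n * n.-1)%:R * (p * (1 - p ^+ 2) ^+ (n - 2)).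
Proof.
move=> /andP[e0 e1] /andP[p0 p1] n1 nl hn hl hL hnp np3.
have p21 : p ^+ 2 <= 1 / 16 by rewrite expr2; nra.
have hq : expR (- (n%:R * p ^+ 2) - 1) <= (1 - p ^+ 2) ^+ (n - 2).
  apply: (@le_trans _ _ ((1 - p ^+ 2) ^+ n)); first by apply: power_lower => //; lra.
  rewrite ler_wiXn2l ?leq_subr //; have := sqr_ge0 p; lra.
have hN : 1 / 2 * n%:R ^+ 2 <= (n * n.-1)%:R :> R.
  have n2 : 2 <= n%:R :> R by rewrite (ler_nat R 2).
  rewrite natrM -subn1 natrB 1?ltnW // expr2; nra.
have key : 16 <= eps * (n%:R ^+ 2 * p * expR (- (n%:R * p ^+ 2) - 1)).
  have [L1|L1] := leP (n%:R * p ^+ 2) 1.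
    have h2 : 4 / 25 * (1 / 2) <= expR (- (n%:R * p ^+ 2) - 1).
      apply: (@le_trans _ _ (expR (- 1 - 1))); last by rewrite ler_expR; lra.
      rewrite expRD; have : 1 / 3 <= expR (- 1) :> R.
        by rewrite expRN div1r lef_pV2 ?posrE ?expR_gt0 ?expR1_le.
      nra.
    have h3 : 10 * 20 / eps <= n%:R ^+ 2 * p.
      rewrite (_ : n%:R ^+ 2 * p = n%:R * (n%:R * p)); last by ring.
      apply: (@le_trans _ _ ((20 / eps) ^+ 2 * (eps / 2))).
        by rewrite le_eqVlt; apply/orP; left; apply/eqP; field; rewrite gt_eqF.
      apply: ler_pM; [exact: sqr_ge0| |exact: hn|exact: hnp].
      by rewrite divr_ge0 // ltW.
    have h4 : 10 * 20 <= eps * (n%:R ^+ 2 * p).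
      have := ler_wpM2l (ltW e0) h3; rewrite [eps * (_ / _)]mulrC divfK ?gt_eqF //.
    rewrite mulrA; have := expR_ge0 (- (n%:R * p ^+ 2) - 1); nra.
  have h3 : expR (3 / 2 * l) <= n%:R ^+ 2 * p.
    have : expR (3 / 2 * l) ^+ 2 <= (n%:R ^+ 2 * p) ^+ 2.
      rewrite -expRM_natl (_ : 2%:R * (3 / 2 * l) = 3%:R * l); last by field.
      rewrite expRM_natl -nl (_ : (n%:R ^+ 2 * p) ^+ 2 = n%:R ^+ 3 * (n%:R * p ^+ 2)); last by ring.
      by rewrite -[leLHS]mulr1 ler_wpM2l ?exprn_ge0 // ltW.
    by rewrite ler_sqr // nnegrE ?expR_ge0 ?mulr_ge0 ?exprn_ge0.
  have h4 : 16 / eps <= n%:R ^+ 2 * p * expR (- (n%:R * p ^+ 2) - 1).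
    apply: (@le_trans _ _ (expR (3 / 2 * l) * expR (- (7 / 5 * l) - 1))).
      rewrite -expRD; apply: le_trans (expR_ge1Dx _); lra.
    apply: ler_pM; rewrite ?expR_ge0 // ler_expR; lra.
  by have := ler_wpM2l (ltW e0) h4; rewrite [eps * (_ / _)]mulrC divfK ?gt_eqF.
set E := expR _ in hq key; set q := (1 - _) ^+ _ in hq *.
have E0 : 0 <= E by apply: expR_ge0.
apply: (@le_trans _ _ (eps * (1 / 2 * n%:R ^+ 2) * (p * E))).
  rewrite (_ : eps * (1 / 2 * n%:R ^+ 2) * (p * E) = 1 / 2 * (eps * (n%:R ^+ 2 * p * E))); last by ring.
  lra.
apply: ler_pM; [| |by rewrite ler_wpM2l // ltW|by rewrite ler_wpM2l].
  by apply: mulr_ge0; [apply: ltW|apply: mulr_ge0; [apply: divr_ge0|apply: sqr_ge0]].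
by rewrite mulr_ge0.
Qed.

Lemma sparse_Q_le (eps : R) : 0 < eps <= 1 -> exists N, forall n p, (N <= n)%N -> 0 <= p <= 1 ->
  n%:R * p ^+ 2 <= 7 / 5 * ln n%:R -> eps / 2 <= n%:R * p -> Pr_Gnp p (@Q n) <= 3 / 4 * eps.
Proof.
move=> e01; have /andP[e0 e1] := e01.
have [N hN] := ln_large (Num.max 40 (10 * (16 / eps))).
exists N => n p nN /andP[p0 p1] hL hnp; have p01 : 0 <= p <= 1 by rewrite p0.
move: (hN n nN); rewrite ge_max => /andP[l40 leps].
have n0 : (0 < n)%N by apply: (@nat_gt0_ln R); apply: lt_le_trans l40.
have nl := n_expR R n0; set l := ln n%:R in hL l40 leps nl *.
have l0 : 0 <= l by apply: le_trans l40.
have nl5 : l ^+ 5 / 120 <= n%:R by rewrite nl expR_ge_pow5.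
have l2 : 40 * 40 <= l ^+ 2 by rewrite expr2 ler_pM.
have l30 : 0 <= l ^+ 3 by rewrite exprn_ge0.
(* The factor 11 is chosen because 11 / 4 exceeds the cube of 7/5, which yields n p^3 <= 1/2 below;
   l >= 40 makes l^2 / 120 exceed 11. *)
have nl3 : 11 * l ^+ 3 <= n%:R.
  apply: le_trans nl5; rewrite (_ : l ^+ 5 / 120 = l ^+ 2 / 120 * l ^+ 3); last by field.
  by rewrite ler_wpM2r // ler_pdivlMr //; apply: le_trans l2; rewrite -!natrM ler_nat.
have nll : l * l <= n%:R.
  apply: le_trans nl3; rewrite (_ : 11 * l ^+ 3 = l * l * (11 * l)); last by ring.
  rewrite -[leLHS]mulr1 ler_wpM2l ?mulr_ge0 //.
  by apply: (@le_trans _ _ (11 * 40)); [rewrite -natrM ler1n | rewrite ler_wpM2l].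
have leps' : 10 * 16 <= l * eps.
  have := ler_wpM2r (ltW e0) leps; rewrite mulrA divfK ?gt_eqF //.
have nR : 0 < n%:R :> R by rewrite ltr0n.
clear nl5 hN nN.
have hp2 : p ^+ 2 <= eps / 40.
  rewrite -(ler_pM2l nR); apply: le_trans hL _.
  apply: (@le_trans _ _ (11 * l ^+ 3 * (eps / 40))); last by rewrite ler_wpM2r // divr_ge0 // ltW.
  rewrite (_ : 11 * l ^+ 3 * (eps / 40) = l * eps * (11 / 40 * l) * l); last by field.
  rewrite ler_wpM2r //; apply: (@le_trans _ _ (10 * 16 * (11 / 40 * 40))); first lra.
  apply: ler_pM; [by rewrite mulr_ge0|by rewrite mulr_ge0 ?divr_ge0|exact: leps'|].
  by apply: ler_wpM2l; rewrite ?divr_ge0.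
have hp : p <= 1 / 4.
  rewrite leNgt; apply/negP => h; have : 1 / 4 * (1 / 4) <= p * p by rewrite ler_pM ?divr_ge0 // ltW.
  move: hp2 e1; rewrite expr2; clear; lra.
have np3 : n%:R * p ^+ 3 <= 1 / 2.
  have : (n%:R * p ^+ 3) ^+ 2 * n%:R <= (1 / 2) ^+ 2 * n%:R.
    rewrite (_ : (n%:R * p ^+ 3) ^+ 2 * n%:R = (n%:R * p ^+ 2) ^+ 3); last by ring.
    apply: (@le_trans _ _ ((7 / 5 * l) ^+ 3)).
      by rewrite lerXn2r // nnegrE; apply: mulr_ge0 => //; [apply: sqr_ge0|apply: divr_ge0].
    rewrite exprMn; move: nl3 l30; move: (l ^+ 3) (n%:R : R); clear => a b; lra.
  by rewrite ler_pM2r // ler_sqr // nnegrE; [apply: mulr_ge0; rewrite ?exprn_ge0|apply: divr_ge0].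
have p_gt0 : 0 < p.
  rewrite lt_neqAle p0 andbT; apply/eqP => h; move: hnp.
  by rewrite -h mulr0 leNgt divr_gt0.
have q0 : 0 < 1 - p ^+ 2 by move: hp2 e1; clear; lra.
have e10 : 0 < p * (1 - p ^+ 2) ^+ (n - 2) by rewrite mulr_gt0 ?exprn_gt0.
have n4 : (4 <= n)%N.
  rewrite -(ler_nat R); apply: le_trans nll; apply: (@le_trans _ _ (40 * 40)); last by rewrite ler_pM.
  by rewrite -natrM ler_nat.
have n1 : (1 < n)%N by apply: leq_trans n4.
have N0 : 0 < (n * n.-1)%:R :> R by rewrite ltr0n muln_gt0 n0 /= -subn1 subn_gt0.
apply: (no_lone_edge_arith e01 e10 N0 (lone_edges_second_moment p01 e10 n1)) => //.
(* [Dd] lacks four factors 1 - p^2 of [e1 ^+ 2]; p^2 <= eps / 40 keeps their product above 1 - eps /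
   10. *)
- rewrite exprMn [leRHS]mulrCA ler_wpM2l ?sqr_ge0 // -exprM.
  rewrite (_ : ((n - 2) * 2 = 2 * (n - 4) + 4)%N); last by move: n4; clear; lia.
  rewrite exprD [leRHS]mulrCA -[leLHS]mulr1 ler_wpM2l ?exprn_ge0 ?(ltW q0) //.
  move: q0 hp2; have := sqr_ge0 p; move: (p ^+ 2) e0 e1; clear => x e0 e1 x0 q0 hx.
  have h1 : 1 - 4 * x <= (1 - x) ^+ 4.
    rewrite (_ : (1 - x) ^+ 4 = 1 - 4 * x + x ^+ 2 * (6 - 4 * x + x ^+ 2)); last by ring.
    by rewrite lerDl mulr_ge0 ?sqr_ge0 //; have := sqr_ge0 x; lra.
  have h2 : 1 <= (1 + eps / 4) * (1 - eps / 10) by nra.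
  apply: le_trans h2 _; rewrite ler_wpM2l //; lra.
- by apply: lone_ratio => //; rewrite p0.
- have h : 10 * 20 <= eps * n%:R.
    apply: (@le_trans _ _ (l * eps * l)); last by rewrite mulrAC [leLHS]mulrC ler_wpM2l // ltW.
    apply: (@le_trans _ _ (10 * 16 * 40)); first by rewrite -!natrM ler_nat.
    by apply: ler_pM => //; apply: mulr_ge0.
  have n2 : 2 <= n%:R :> R by rewrite (ler_nat R 2).
  rewrite natrM -subn1 natrB //; move: h n2 e0; move: (n%:R : R); clear => x h n2 e0.
  rewrite (_ : eps * (x * (x - 1)) = eps * x * (x - 1)); last by ring.
  apply: (@le_trans _ _ (10 * 20 * (x - 1))); first lra.
  by rewrite ler_wpM2r //; lra.
apply: (lone_edge_count_large (l := l)) => //; rewrite ?p0 //.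
apply: le_trans nll; rewrite -expr2 ler_sqr ?nnegrE ?divr_ge0 ?(ltW e0) //.
by rewrite ler_pdivrMr //; apply: le_trans leps'; rewrite -natrM ler_nat.
Qed.

End SparseRegime.

Unset Implicit Arguments.

Theorem theorem1p3 (R : realType) (eps : R) : 0 < eps ->
  exists N : nat, forall n : nat, (N <= n)%N ->
    forall p : R, 0 <= p <= 1 ->
      @Pr_Gnp R n p (fun G => Q G /\
        ~ (forall X, triangle_space G X <-> cycle_space G X)) < eps.
Proof.
(* The sparse estimates assume a tolerance of at most 1. *)
move=> e0; pose e := Num.min eps 1.
have e_gt0 : 0 < e by rewrite lt_min e0 /=.
have e_le : e <= eps by rewrite ge_min lexx.
have e1 : e <= 1 by rewrite ge_min lexx orbT.
have e01 : 0 < e <= 1 by rewrite e_gt0.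
have [N1 h1] := @whp_triangle_space R eps e0.
have [N2 h2] := sparse_Q_le e01.
exists (maxn N1 N2) => n; rewrite geq_max => /andP[n1 n2] p p01.
have /andP[p0 p1] := p01.
have [L|L] := leP (7 / 5 * ln n%:R) (n%:R * p ^+ 2).
  apply: le_lt_trans (h1 n p n1 p01 L); apply: Pr_Gnp_le => // G _ [QG nTC] h.
  exact/nTC/h.
have [np|np] := leP (e / 2) (n%:R * p).
  apply: (@le_lt_trans _ _ (Pr_Gnp p (@Q n))); first by apply: Pr_Gnp_le => // G _ [].
  by apply: le_lt_trans (h2 n p n2 p01 (ltW L) np) _; lra.
(* Here n p < e / 2 <= 1/2, so the expected number of triangles, at most (n p)^3, is already below
   eps. *)
apply: (@le_lt_trans _ _ (Pr_Gnp p (fun G : {set {set 'I_n}} => exists t, triangle_of G t))).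
  by apply: Pr_Gnp_le => // G _ [QG nTC]; apply: Q_has_triangle.
apply: le_lt_trans (@Pr_triangle_le R n p p01) _.
have x0 : 0 <= n%:R * p by rewrite mulr_ge0.
apply: (@le_lt_trans _ _ (n%:R * p)); last lra.
by rewrite -[leRHS]expr1 ler_wiXn2l //; lra.
Qed.
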